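(* There exists a family of real dimension $4$ of (pairs of) mutually unbiased bases in $\mathbb C^6$; that is, for $n=6$ the moduli space ${\cal M}_{\mathbb R}$ of pairs of mutually unbiased bases in $\mathbb C^6$ contains a real submanifold of dimension $4$.
   Context: Let $V=\mathbb C^n$ with its standard Hermitian metric $\langle\ ,\ \rangle$. Two orthonormal bases $\{e_i\}$, $\{f_j\}$ of $V$ are mutually unbiased if $|\langle e_i,f_j\rangle|^2=\frac1n$ for all $i,j$. Up to changing the phases of the basis vectors, a pair of mutually unbiased bases is the same as a pair of systems of rank 1 Hermitian projectors $\{p_i\}_{i=1}^n,\{q_j\}_{j=1}^n$ with $p_ip_{i'}=0$ ($i\neq i'$), $q_jq_{j'}=0$ ($j\ne j'$) and $\mathrm{Tr}\,p_iq_j=\frac1n$ for all $i,j$. Let $\bar{\cal X}$ be the complex affine variety of all pairs $(\{p_i\}_{i=1}^n,\{q_j\}_{j=1}^n)$ of systems of (not necessarily Hermitian) rank 1 projectors in $V$ with $p_ip_{i'}=0$ for $i\ne i'$, $q_jq_{j'}=0$ for $j\neq j'$, and $\mathrm{Tr}\,p_iq_j=\frac1n$ for all $i,j$. Let ${\cal X}\subset\bar{\cal X}$ be the open subvariety of smooth points, ${\cal X}_{\mathbb R}\subset{\cal X}$ the real subvariety of points for which all the projectors are Hermitian, and ${\cal M}_{\mathbb R}={\cal X}_{\mathbb R}/U(n)$ (simultaneous conjugation). It is embedded in ${\cal M}={\cal X}/GL(V)$, with $GL(V)$ acting by simultaneous conjugation. *)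

(* Defs.v *)
From HB Require Import structures.
From mathcomp Require Import all_boot all_order all_algebra.
From mathcomp Require Import all_classical all_reals all_analysis.
From mathcomp Require Import complex spectral sesquilinear generic_quotient.
(* the notations of mpoly clash with those of MathComp-Analysis *)
From mathcomp Require Import -(notations) mpoly.

Set Implicit Arguments.
Unset Strict Implicit.
Unset Printing Implicit Defensive.

Import Order.TTheory GRing.Theory Num.Theory.
Import numFieldNormedType.Exports.

Local Open Scope classical_set_scope.
Local Open Scope ring_scope.
Local Open Scope complex_scope.
Local Open Scope sesquilinear_scope.

(* A point x of a complex variety Z in C^N is smooth when Z is given, on some
   Zariski-open neighbourhood [h != 0] of x, by polynomial equations
   f_1 = ... = f_r = 0 whose differentials at x are linearly independent.  Only
   the set Z is used: no set of defining equations is fixed in advance. *)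
Definition smooth_point (R : realType) (N : nat) (Z : set 'rV[R[i]]_N)
    (x : 'rV[R[i]]_N) : Prop :=
  Z x /\
  exists (r : nat) (f : 'I_r -> mpoly N R[i]) (h : mpoly N R[i]),
    [/\ meval (x 0) h != 0,
        forall y : 'rV[R[i]]_N, meval (y 0) h != 0 ->
          (Z y <-> forall k, meval (y 0) (f k) = 0)
      & row_free (\matrix_(k < r, l < N) meval (x 0) (mderiv l (f k)))].

(* ({p_i}, {q_j}), with no condition on the matrices *)
Definition config (R : realType) (n : nat) : Type :=
  (('I_n -> 'M[R[i]]_n) * ('I_n -> 'M[R[i]]_n))%type.

(* (true, i, (a, b)) indexes the entry (a, b) of p_i, and
   (false, j, (a, b)) the entry (a, b) of q_j *)
Definition coord_index (n : nat) : finType := (bool * 'I_n * ('I_n * 'I_n))%type.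

Definition ncoord (n : nat) : nat := #|coord_index n|.

Definition config_coord (R : realType) (n : nat) (x : config R n) :
    'rV[(R[i])^o]_(ncoord n) :=
  \row_k (let: (b, i, (a, c)) := enum_val k in
          (if b then x.1 i else x.2 i) a c).

HB.instance Definition _ (R : realType) (n : nat) :=
  gen_eqMixin (config R n).
HB.instance Definition _ (R : realType) (n : nat) :=
  gen_choiceMixin (config R n).
(* the Euclidean topology of C^(ncoord n) *)
HB.instance Definition _ (R : realType) (n : nat) :=
  Topological.copy (config R n) (initial_topology (@config_coord R n)).

Definition rank1_projector (R : realType) (n : nat) (P : 'M[R[i]]_n) : Prop :=
  P *m P = P /\ \rank P = 1%N.

Definition Xbar (R : realType) (n : nat) : set (config R n) :=
  [set x | [/\ forall i, rank1_projector (x.1 i) /\ rank1_projector (x.2 i),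
               forall i i', i != i' -> x.1 i *m x.1 i' = 0,
               forall j j', j != j' -> x.2 j *m x.2 j' = 0
             & forall i j, \tr (x.1 i *m x.2 j) = n%:R^-1]].
Arguments Xbar R n : clear implicits.

Definition Xsm (R : realType) (n : nat) : set (config R n) :=
  [set x | Xbar R n x /\
     smooth_point (@config_coord R n @` Xbar R n) (config_coord x)].
Arguments Xsm R n : clear implicits.

(* For a pair of mutually unbiased bases (e_i), (f_j), the projectors onto the
   lines C.e_i and C.f_j satisfy Tr p_i q_j = |<e_i, f_j>|^2; conversely, a pair
   of systems of Hermitian projectors determines the bases up to phases. *)
Definition XR (R : realType) (n : nat) : set (config R n) :=
  [set x | Xsm R n x /\
     forall i, ((x.1 i)^t* = x.1 i) /\ ((x.2 i)^t* = x.2 i)].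
Arguments XR R n : clear implicits.

Definition conj_config (R : realType) (n : nat) (u : 'M[R[i]]_n)
    (x : config R n) : config R n :=
  (fun i => u *m x.1 i *m u^t*, fun j => u *m x.2 j *m u^t*).

Definition same_orbit (R : realType) (n : nat) : rel (XR R n) :=
  fun x y => `[< exists2 u : 'M[R[i]]_n,
                   u \is unitarymx & val y = conj_config u (val x) >].

Lemma unitarymxV (R : realType) (n : nat) (u : 'M[R[i]]_n) :
  u \is unitarymx -> u^t* *m u = 1%:M.
Proof. by move=> /unitarymxP/mulmx1C. Qed.

Lemma conj_config1 (R : realType) (n : nat) (x : config R n) :
  conj_config 1%:M x = x.
Proof.
have H : (1%:M : 'M[R[i]]_n)^t* = 1%:M by rewrite trmx1 map_mx1.
by case: x => p q; congr pair; apply/funext => i /=; rewrite H mul1mx mulmx1.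
Qed.

Lemma conj_configM (R : realType) (n : nat) (u v : 'M[R[i]]_n)
    (x : config R n) :
  conj_config u (conj_config v x) = conj_config (u *m v) x.
Proof.
have H : (u *m v)^t* = v^t* *m u^t* by rewrite trmx_mul map_mxM.
by case: x => p q; congr pair; apply/funext => i /=; rewrite H !mulmxA.
Qed.

Lemma same_orbit_equiv (R : realType) (n : nat) :
  equiv_class_of (@same_orbit R n).
Proof.
have sym (x y : XR R n) : same_orbit x y -> same_orbit y x.
  move=> /asboolP[u uU e]; apply/asboolP; exists (u^t*).
    by rewrite trmxC_unitary.
  by rewrite e conj_configM unitarymxV// conj_config1.
split=> [x|x y|y x z].
- apply/asboolP; exists 1%:M; last by rewrite conj_config1.
  by apply/unitarymxP; rewrite trmx1 map_mx1 mulmx1.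
- by apply/idP/idP; apply: sym.
- move=> /asboolP[u uU e] /asboolP[v vU e']; apply/asboolP.
  exists (v *m u); first exact: mul_unitarymx.
  by rewrite e' e conj_configM.
Qed.

Canonical same_orbit_equiv_rel (R : realType) (n : nat) :=
  EquivRelPack (same_orbit_equiv R n).

(* X_R / U(n), with the quotient topology *)
Definition MR (R : realType) (n : nat) :=
  quotient_topology {eq_quot (same_orbit_equiv_rel R n)}%qT.

Definition orbit_class (R : realType) (n : nat) (x : XR R n) : MR R n :=
  \pi_(MR R n)%qT x.

Fixpoint C_k (R : realType) (d k : nat) (U : set 'rV[R]_d)
    (g : 'rV[R]_d -> R) : Prop :=
  match k with
  | 0 => forall t, U t -> {for t, continuous g}
  | k'.+1 => (forall t v, U t -> derivable g t v) /\
             (forall v, C_k k' U (fun t => 'D_v g t))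
  end.

(* U is meant to be open *)
Definition C_infty (R : realType) (d : nat) (U : set 'rV[R]_d)
    (g : 'rV[R]_d -> R) : Prop := forall k, C_k k U g.

Definition re_coord (R : realType) (n : nat) (k : 'I_(ncoord n))
  (x : config R n) : R := complex.Re (config_coord x 0 k).

Definition im_coord (R : realType) (n : nat) (k : 'I_(ncoord n))
  (x : config R n) : R := complex.Im (config_coord x 0 k).

Definition smooth_map (R : realType) (n d : nat) (U : set 'rV[R]_d)
    (phi : 'rV[R]_d -> config R n) : Prop :=
  forall k, C_infty U (re_coord k \o phi) /\ C_infty U (im_coord k \o phi).

(* infinitesimal simultaneous conjugation *)
Definition ad_config (R : realType) (n : nat) (a : 'M[R[i]]_n)
    (x : config R n) : config R n :=
  (fun i => a *m x.1 i - x.1 i *m a, fun j => a *m x.2 j - x.2 j *m a).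

(* The tangent space at x of the orbit U(n).x is [ad_config a x] for a in u(n),
   and T_[x] M_R = T_x X_R / T_x (U(n).x).  Hence [phi] followed by the
   projection to M_R is an immersion at t when a tangent vector v whose image
   by the differential of [phi] is tangent to the orbit must vanish. *)
Definition immersive_mod_orbits (R : realType) (n d : nat)
    (phi : 'rV[R]_d -> config R n) (t : 'rV[R]_d) : Prop :=
  forall (v : 'rV[R]_d) (a : 'M[R[i]]_n), a^t* = - a ->
    (forall k, 'D_v (re_coord k \o phi) t = re_coord k (ad_config a (phi t)) /\
               'D_v (im_coord k \o phi) t = im_coord k (ad_config a (phi t))) ->
    v = 0.

(* S is a d-dimensional embedded real C^infty submanifold of M_R: around each of
   its points it has a parametrization by an open set of R^d which is a smooth
   immersion into M_R and a homeomorphism onto an open subset of S.  The group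
   PU(n) is compact and acts freely on the manifold X_R, so X_R -> M_R is a
   principal bundle, and a map to M_R is smooth exactly when it lifts locally
   to a smooth map to X_R (that is, to the ambient affine space); a
   parametrization is given by such a lift.  Its continuity follows from
   smoothness; the last clause says that it is open onto S. *)
Definition real_submanifold (R : realType) (n d : nat) (S : set (MR R n)) :
    Prop :=
  forall s, S s ->
  exists (U : set 'rV[R]_d) (phi : 'rV[R]_d -> XR R n),
    let chart := @orbit_class R n \o phi in
    [/\ open U /\ (chart @` U) s,
        smooth_map U (fun t => val (phi t)),
        forall t, U t -> immersive_mod_orbits (fun t => val (phi t)) t,
        set_inj U chart
      & forall W, open W -> W `<=` U ->
          exists2 O : set (MR R n), open O & chart @` W = S `&` O].

(* Main.v *)
(* A pair of mutually unbiased bases of C^6 is, with p_i = E_ii and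
   (q_j)_kl = h_kj / (6 h_lj), a complex Hadamard matrix h.  Cut h into two halves
   of three rows.  When the rows of each half are orthogonal, the Gram matrix of
   the columns of the upper half minus 3 and the opposite of the one of the lower
   half, j and j', both satisfy j^2 = 9, have a zero diagonal, and satisfy
   equalities between symmetric functions of complementary triples of columns and
   the closedness of an alternating function tau of triples of columns.  All these
   equations are even, and h is Hadamard exactly when j = j'.  If moreover nine
   linear coordinates of j - j' vanish, then j = j' as soon as the system of
   divided differences of the even equations has a trivial kernel, which is an
   open condition.  So near a suitable point Hadamard matrices are cut out by the
   12 + 9 equations "orthogonal rows in each half, nine symmetric products of
   columns" in 25 unknowns; this is four equations fewer than unknowns.

   For complex h, this describes the variety of pairs of systems of projectors by
   393 equations with independent differentials in 432 coordinates, hence its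
   points are smooth.  For unimodular h, an implicit function theorem for quadratic
   maps, applied in R^50, gives a family parametrized by the imaginary parts of
   four entries.  These are U(6)-invariant functions, of the form
   Im Tr (p_0 q_j p_k q_0), which makes the chart injective and open in the
   quotient.  The kernels are computed at one matrix with entries sixth roots of
   unity, by a verified Gauss elimination over Z[w], w^2 + w + 1 = 0. *)
From Stdlib Require Import ZArith.
From HB Require Import structures.
Require Import Defs.
From mathcomp Require Import all_boot all_order all_algebra.
From mathcomp Require Import all_classical all_reals all_analysis.
From mathcomp Require Import complex spectral sesquilinear generic_quotient.
From mathcomp Require Import ring lra ssrZ zify.
From mathcomp Require Import -(notations) mpoly.

Set Implicit Arguments.
Unset Strict Implicit.
Unset Printing Implicit Defensive.

Import GRing.Theory Num.Theory.
Local Open Scope ring_scope.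

(** * Even equations of half of a Hadamard matrix *)

(** Orthogonality of all columns is 30 equations, one for each ordered pair, on the 25 free entries
    of a dephased matrix, while the solutions sought have four parameters; the implicit function
    theorem does not apply to so redundant a system. The obstacle is to find 21 equations with
    independent differentials that imply the others nearby. Evenness removes the redundancy: j and
    j' come from different rows but satisfy f(j) = f(j') = 0 for the same f, and f(j) - f(j') is
    linear in j - j' with coefficients depending on j and j'. At the base matrix j = j', so a single
    exact rank computation suffices there; a left inverse of the coefficient matrix turns its
    persistence into the non-vanishing of a polynomial. The even equations come from identities on 3
    x 3 and 3 x 4 submatrices, where orthogonality of the rows replaces a sum over some columns by
    the opposite of the sum over the remaining ones. The count 432 - 393 = 39 = 35 + 4 is the
    dimension of the orbits of PGL_6 plus the four parameters. *)

Definition o0 : 'I_6 := @Ordinal 6 0 isT.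
Definition o1 : 'I_6 := @Ordinal 6 1 isT.
Definition o2 : 'I_6 := @Ordinal 6 2 isT.
Definition o3 : 'I_6 := @Ordinal 6 3 isT.
Definition o4 : 'I_6 := @Ordinal 6 4 isT.
Definition o5 : 'I_6 := @Ordinal 6 5 isT.

Lemma ord6_ind (P : 'I_6 -> Prop) :
  P o0 -> P o1 -> P o2 -> P o3 -> P o4 -> P o5 -> forall i, P i.
Proof.
move=> p0 p1 p2 p3 p4 p5 [[|[|[|[|[|[|//]]]]]] i].
- by rewrite (_ : Ordinal i = o0) //; apply: val_inj.
- by rewrite (_ : Ordinal i = o1) //; apply: val_inj.
- by rewrite (_ : Ordinal i = o2) //; apply: val_inj.
- by rewrite (_ : Ordinal i = o3) //; apply: val_inj.
- by rewrite (_ : Ordinal i = o4) //; apply: val_inj.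
- by rewrite (_ : Ordinal i = o5) //; apply: val_inj.
Qed.

Lemma sum6 (V : nmodType) (f : 'I_6 -> V) :
  \sum_i f i = f o0 + f o1 + f o2 + f o3 + f o4 + f o5.
Proof.
rewrite !big_ord_recl big_ord0 addr0 !addrA.
by congr (f _ + f _ + f _ + f _ + f _ + f _); apply: val_inj.
Qed.

Lemma sum3 (V : nmodType) (f : 'I_3 -> V) :
  \sum_i f i = f (@Ordinal 3 0 isT) + f (@Ordinal 3 1 isT) + f (@Ordinal 3 2 isT).
Proof.
rewrite !big_ord_recl big_ord0 addr0 !addrA.
by congr (f _ + f _ + f _); apply: val_inj.
Qed.

Section EvenEquations.
Variable A : comPzRingType.
Implicit Types (D : A) (j : 'M[A]_6) (k l m : 'I_6).

Definition e2e3 D (u v w : A) : A :=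
  D ^+ 2 * (u * v + v * w + w * u) - u * v * w.

Definition edge j k l := j k l * j l k.
Definition triangle j k l m := j k l * j l m * j m k.

Definition split_eq D j k l m k' l' m' :=
  e2e3 D (edge j k l) (edge j l m) (edge j m k)
  - e2e3 D (edge j k' l') (edge j l' m') (edge j m' k').

Definition tau j k l m := triangle j k l m ^+ 2 - triangle j k m l ^+ 2.
Definition dtau j a b c d :=
  tau j b c d - tau j a c d + tau j a b d - tau j a b c.

(* All these equations are invariant under j -> -j, so that they hold for the
   reduced Gram matrices of both halves of a Hadamard matrix, which are opposite.
   D is a common denominator. *)
Definition even_eqs D j : Prop :=
  [/\ j *m j = (D ^+ 2 *+ 9)%:M, forall k, j k k = 0,
      split_eq D j o0 o1 o2 o3 o4 o5 = 0 /\ split_eq D j o0 o1 o3 o2 o4 o5 = 0,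
      split_eq D j o0 o1 o4 o2 o3 o5 = 0
    & dtau j o0 o1 o2 o3 = 0].

Lemma even_eqsN D j : even_eqs D j -> even_eqs D (- j).
Proof.
have eE k l : edge (- j) k l = edge j k l.
  by rewrite /edge !mxE mulrNN.
have tE k l m : tau (- j) k l m = tau j k l m.
  by rewrite /tau /triangle !mxE; ring.
move=> [jj j0 [s1 s2] s3 t]; split => //.
- by rewrite mulNmx mulmxN opprK.
- by move=> k; rewrite mxE j0 oppr0.
- by rewrite /split_eq !eE.
- by rewrite /split_eq !eE.
- by rewrite /dtau !tE.
Qed.

(** Homogeneity: [split_eq] and [tau] have degree 6 once [D] has weight one, which explains the
    factor D^2 in front of the quadratic term of [e2e3]. *)
Lemma even_eqsZ D j : even_eqs 1 j -> even_eqs D (D *: j).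
Proof.
have eE k l : edge (D *: j) k l = D ^+ 2 * edge j k l.
  by rewrite /edge !mxE; ring.
have tE k l m : tau (D *: j) k l m = D ^+ 6 * tau j k l m.
  by rewrite /tau /triangle !mxE; ring.
have sE k l m k' l' m' : split_eq D (D *: j) k l m k' l' m' =
    D ^+ 6 * split_eq 1 j k l m k' l' m'.
  by rewrite /split_eq !eE /e2e3; ring.
move=> [jj j0 [s1 s2] s3 t]; split.
- by rewrite -scalemxAl -scalemxAr jj scalerA scale_scalar_mx expr1n mulrnAr mulr1.
- by move=> k; rewrite mxE j0 mulr0.
- by rewrite !sE s1 s2 !mulr0.
- by rewrite sE s3 mulr0.
- have -> : dtau (D *: j) o0 o1 o2 o3 = D ^+ 6 * dtau j o0 o1 o2 o3.
    by rewrite /dtau !tE; ring.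
  by rewrite t mulr0.
Qed.

End EvenEquations.

(** * Identities for three orthogonal rows *)

Section FlatRows.
Variable F : fieldType.
Variable h : 'I_3 -> 'I_6 -> F.
Hypothesis h0 : forall i k, h i k != 0.
Hypothesis hort : forall i i', i != i' -> \sum_k h i k / h i' k = 0.

(** Inverses stand for complex conjugates, as for unimodular entries; all the identities become
    rational and hold over any field. *)
Definition gram3 : 'M[F]_6 := \matrix_(k, l) \sum_i h i l / h i k.

Local Notation r0 := (@Ordinal 3 0 isT).
Local Notation r1 := (@Ordinal 3 1 isT).
Local Notation r2 := (@Ordinal 3 2 isT).

(** The Gram matrix factors as Q P with P Q = 6, so its square is 6 times itself; subtracting 3
    completes the square. *)
Lemma gram3_sq : (gram3 - 3%:R%:M) *m (gram3 - 3%:R%:M) = 9%:R%:M.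
Proof.
pose P : 'M[F]_(3, 6) := \matrix_(i, k) h i k.
pose Q : 'M[F]_(6, 3) := \matrix_(k, i) (h i k)^-1.
have gE : gram3 = Q *m P.
  apply/matrixP => k l; rewrite !mxE; apply: eq_bigr => i _.
  by rewrite !mxE mulrC.
have PQ : P *m Q = 6%:R%:M.
  apply/matrixP => i i'; rewrite !mxE.
  under eq_bigr do rewrite !mxE.
  case: (eqVneq i i') => [<-|ne]; last by rewrite hort.
  under eq_bigr do rewrite divff//.
  by rewrite sumr_const card_ord.
have gg : gram3 *m gram3 = 6%:R *: gram3.
  by rewrite gE mulmxA -(mulmxA Q) PQ mul_mx_scalar -scalemxAl.
rewrite mulmxBl !mulmxBr gg mul_mx_scalar mul_scalar_mx -scalar_mxM.
rewrite -natrM; set g := gram3.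
have -> : 6%:R *: g = 3%:R *: g + 3%:R *: g :> 'M[F]_6.
  by rewrite -scalerDl -natrD.
by rewrite addrK opprB addrC subrK.
Qed.

Lemma gram3_diag k : (gram3 - 3%:R%:M) k k = 0.
Proof.
rewrite !mxE eqxx mulr1n; under eq_bigr do rewrite divff//.
by rewrite sumr_const card_ord subrr.
Qed.

Lemma gram3_off k l : k != l -> (gram3 - 3%:R%:M) k l =
  h r0 l / h r0 k + h r1 l / h r1 k + h r2 l / h r2 k.
Proof. by move=> kl; rewrite !mxE (negbTE kl) subr0 sum3. Qed.

(* The products K_ij K_ji of the off-diagonal entries of the row Gram matrix
   and of the column Gram matrix of a 3 x 3 matrix without zero entries have
   the same value of e_2 - e_3. *)
Lemma gram_transpose_dephased (a b c d : F) :
  a != 0 -> b != 0 -> c != 0 -> d != 0 ->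
  e2e3 1 ((1 + a + b) * (1 + a^-1 + b^-1))
         ((1 + c / a + d / b) * (1 + a / c + b / d))
         ((1 + c + d) * (1 + c^-1 + d^-1)) =
  e2e3 1 ((1 + a + c) * (1 + a^-1 + c^-1))
         ((1 + b / a + d / c) * (1 + a / b + c / d))
         ((1 + b + d) * (1 + b^-1 + d^-1)).
Proof.
move=> a0 b0 c0 d0; rewrite /e2e3; field.
by rewrite ?a0 ?b0 ?c0 ?d0.
Qed.

Definition rip (i i' : 'I_3) (S : seq 'I_6) := \sum_(k <- S) h i k / h i' k.

(** Edges and products of [rip] do not change when rows and columns are rescaled. The quantities
    [a], [b], [c], [d] are the entries left after making row [r0] and column [k] equal to 1. *)
Lemma e2e3_gram3 k l m : uniq [:: k; l; m] ->
  let j := gram3 - 3%:R%:M in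
  e2e3 1 (edge j k l) (edge j l m) (edge j m k) =
  e2e3 1 (rip r0 r1 [:: k; l; m] * rip r1 r0 [:: k; l; m])
         (rip r1 r2 [:: k; l; m] * rip r2 r1 [:: k; l; m])
         (rip r0 r2 [:: k; l; m] * rip r2 r0 [:: k; l; m]).
Proof.
rewrite /= !inE negb_or => /and3P[/andP[kl km] lm _].
pose a := h r1 l * h r0 k / (h r1 k * h r0 l).
pose c := h r1 m * h r0 k / (h r1 k * h r0 m).
pose b := h r2 l * h r0 k / (h r2 k * h r0 l).
pose d := h r2 m * h r0 k / (h r2 k * h r0 m).
have nz x y z t : [/\ h x y != 0, h z t != 0, h x t != 0 & h z y != 0].
  by split; exact: h0.
have [a0 b0 c0 d0] : [/\ a != 0, b != 0, c != 0 & d != 0].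
  by split; rewrite !mulf_neq0 ?invr_eq0 ?mulf_neq0 ?h0.
have [lk ml mk] : [/\ l != k, m != l & m != k].
  by rewrite (eq_sym l) (eq_sym m l) (eq_sym m).
have nh := h0; rewrite /edge !gram3_off// /rip !big_cons !big_nil !addr0.
have := @gram_transpose_dephased a b c d a0 b0 c0 d0.
set X := e2e3 _ _ _ _; set Y := e2e3 _ _ _ _ => XY.
transitivity X; first (congr e2e3; rewrite /a /b /c /d; field; by rewrite !nh).
by rewrite XY /Y; congr e2e3; rewrite /a /b /c /d; field; rewrite !nh.
Qed.

(** Orthogonality makes each [rip] over a triple the opposite of the one over the complementary
    triple; [e2e3_gram3] only involves products of two of them, where the signs cancel. *)
Lemma split_gram3 k l m k' l' m' :
  uniq [:: k; l; m] -> uniq [:: k'; l'; m'] ->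
  (forall f : 'I_6 -> F, \sum_i f i = f k + f l + f m + (f k' + f l' + f m')) ->
  split_eq 1 (gram3 - 3%:R%:M) k l m k' l' m' = 0.
Proof.
move=> u u' sE; rewrite /split_eq !e2e3_gram3//.
have rE i i' : i != i' -> rip i i' [:: k; l; m] = - rip i i' [:: k'; l'; m'].
  move=> ii; apply/eqP; rewrite -subr_eq0 opprK /rip !big_cons !big_nil !addr0.
  by rewrite !addrA -!addrA !addrA -(hort ii) sE !addrA.
by rewrite !rE// !mulrNN subrr.
Qed.

Definition det3 (a b c d e f k l m : F) : F :=
  a * (e * m - f * l) - b * (d * m - f * k) + c * (d * l - e * k).

(* The 4 x 4 determinant with a column of ones followed by the given entries. *)
Definition det41 (a b c d e f k l m p q r : F) : F :=
  det3 d e f k l m p q r - det3 a b c k l m p q r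
  + det3 a b c d e f p q r - det3 a b c d e f k l m.

Definition ratio (x y x' y' : F) : F := 1 + x' / x + y' / y.
Definition tau_ratio x1 y1 x2 y2 x3 y3 : F :=
  (ratio x1 y1 x2 y2 * ratio x2 y2 x3 y3 * ratio x3 y3 x1 y1) ^+ 2
  - (ratio x1 y1 x3 y3 * ratio x3 y3 x2 y2 * ratio x2 y2 x1 y1) ^+ 2.

(** With columns normalised as (1, x, y), [a], ..., [c'] are the six inner products of the three
    rows restricted to four columns. The alternating sum of the [tau] lies in the ideal of the two
    expressions annihilated by [haagerup]. *)
Lemma tau_closed_identity x1 y1 x2 y2 x3 y3 x4 y4 :
  x1 != 0 -> y1 != 0 -> x2 != 0 -> y2 != 0 ->
  x3 != 0 -> y3 != 0 -> x4 != 0 -> y4 != 0 ->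
  let a := x1^-1 + x2^-1 + x3^-1 + x4^-1 in
  let a' := x1 + x2 + x3 + x4 in
  let b := x1 / y1 + x2 / y2 + x3 / y3 + x4 / y4 in
  let b' := y1 / x1 + y2 / x2 + y3 / x3 + y4 / x4 in
  let c := y1 + y2 + y3 + y4 in
  let c' := y1^-1 + y2^-1 + y3^-1 + y4^-1 in
  let S := a * a' + b * b' + c * c' in
  let Dp := det41 (x1^-1) (x1 / y1) y1 (x2^-1) (x2 / y2) y2
              (x3^-1) (x3 / y3) y3 (x4^-1) (x4 / y4) y4 in
  let Dm := det41 x1 (y1 / x1) (y1^-1) x2 (y2 / x2) (y2^-1)
              x3 (y3 / x3) (y3^-1) x4 (y4 / x4) (y4^-1) in
  tau_ratio x2 y2 x3 y3 x4 y4 - tau_ratio x1 y1 x3 y3 x4 y4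
  + tau_ratio x1 y1 x2 y2 x4 y4 - tau_ratio x1 y1 x2 y2 x3 y3
  = Dp * (a * b * c + S - 4%:R) - Dm * (a' * b' * c' + S - 4%:R).
Proof.
move=> x10 y10 x20 y20 x30 y30 x40 y40 a a' b b' c c' S Dp Dm.
rewrite /S /Dp /Dm /a /a' /b /b' /c /c' /tau_ratio /det41 /det3 /ratio; field.
by rewrite x10 x20 x30 x40 y10 y20 y30 y40.
Qed.

(* Haagerup's relation: it only involves the sums over the four columns. *)
Lemma haagerup x5 y5 x6 y6 (a a' b b' c c' : F) :
  x5 != 0 -> y5 != 0 -> x6 != 0 -> y6 != 0 ->
  a = - (x5^-1 + x6^-1) -> a' = - (x5 + x6) ->
  b = - (x5 / y5 + x6 / y6) -> b' = - (y5 / x5 + y6 / x6) ->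
  c = - (y5 + y6) -> c' = - (y5^-1 + y6^-1) ->
  a * b * c + (a * a' + b * b' + c * c') - 4%:R = 0 /\
  a' * b' * c' + (a * a' + b * b' + c * c') - 4%:R = 0.
Proof.
move=> x50 y50 x60 y60 -> -> -> -> -> ->.
by split; field; rewrite x50 y50 x60 y60.
Qed.

(** The sums over the columns [a], [b], [c], [d] are the opposites of the sums over [e], [f], which
    is the situation of [haagerup]. *)
Lemma dtau_gram3 a b c d e f :
  uniq [:: a; b; c; d] ->
  (forall g : 'I_6 -> F, \sum_i g i = g a + g b + g c + g d + (g e + g f)) ->
  dtau (gram3 - 3%:R%:M) a b c d = 0.
Proof.
rewrite /= !inE !negb_or => /and4P[/and3P[ab ac ad] /andP[bc bd] cd _] sE.
pose x k := h r1 k / h r0 k; pose y k := h r2 k / h r0 k.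
have nh := h0.
have x0 k : x k != 0 by rewrite mulf_neq0 ?invr_eq0 ?h0.
have y0 k : y k != 0 by rewrite mulf_neq0 ?invr_eq0 ?h0.
have tE k l m : k != l -> l != m -> k != m ->
    tau (gram3 - 3%:R%:M) k l m = tau_ratio (x k) (y k) (x l) (y l) (x m) (y m).
  move=> kl lm km; have [lk ml mk] : [/\ l != k, m != l & m != k].
    by rewrite (eq_sym l) (eq_sym m l) (eq_sym m).
  rewrite /tau /triangle !gram3_off// /tau_ratio /ratio /x /y.
  by congr (_ ^+ 2 - _ ^+ 2); field; rewrite !nh.
rewrite /dtau !tE// tau_closed_identity//.
have ort i i' : i != i' -> h i a / h i' a + h i b / h i' b + h i c / h i' c
    + h i d / h i' d = - (h i e / h i' e + h i f / h i' f).
  by move=> /hort; rewrite sE => /eqP; rewrite addr_eq0 => /eqP.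
have iE k : (x k)^-1 = h r0 k / h r1 k by rewrite invf_div.
have iE' k : (y k)^-1 = h r0 k / h r2 k by rewrite invf_div.
have qE k : x k / y k = h r1 k / h r2 k by rewrite /x /y; field; rewrite !nh.
have qE' k : y k / x k = h r2 k / h r1 k by rewrite /x /y; field; rewrite !nh.
have [] := @haagerup (x e) (y e) (x f) (y f)
  ((x a)^-1 + (x b)^-1 + (x c)^-1 + (x d)^-1) (x a + x b + x c + x d)
  (x a / y a + x b / y b + x c / y c + x d / y d)
  (y a / x a + y b / x b + y c / x c + y d / x d)
  (y a + y b + y c + y d) ((y a)^-1 + (y b)^-1 + (y c)^-1 + (y d)^-1)
  (x0 e) (y0 e) (x0 f) (y0 f).
- by rewrite !iE ort.
- by rewrite /x ort.
- by rewrite !qE ort.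
- by rewrite !qE' ort.
- by rewrite /y ort.
- by rewrite !iE' ort.
by move=> -> ->; rewrite !mulr0 subrr.
Qed.

Lemma even_eqs_gram3 : even_eqs 1 (gram3 - 3%:R%:M).
Proof.
split.
- by rewrite gram3_sq expr1n.
- exact: gram3_diag.
- by split; apply: split_gram3 => // f; rewrite sum6; ring.
- by apply: split_gram3 => // f; rewrite sum6; ring.
- by apply: (@dtau_gram3 _ _ _ _ o4 o5) => // f; rewrite sum6; ring.
Qed.

End FlatRows.

(** * Divided differences of the even equations *)

Definition ords6 : seq 'I_6 := [:: o0; o1; o2; o3; o4; o5].
Definition pairs9 : seq ('I_6 * 'I_6) :=
  [:: (o0, o1); (o0, o2); (o0, o3); (o0, o4); (o0, o5);
      (o1, o2); (o1, o3); (o1, o4); (o1, o5)].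

(* The differences of the even equations at j and j', as linear forms in
   j - j'.  The scalars and the module are kept abstract: besides a commutative
   ring, they are instantiated with Eisenstein integers and vectors of
   coefficients, and with polynomial functions. *)
Section DifferenceForms.
Variables (S M : Type) (addS mulS : S -> S -> S) (oppS : S -> S).
Variables (addM : M -> M -> M) (oppM : M -> M) (sc : S -> M -> M) (zeroM : M).
Variables (D2 : S) (j j' : 'I_6 -> 'I_6 -> S) (x : 'I_6 -> 'I_6 -> M).

Local Infix "+s" := addS (at level 50, left associativity).
Local Infix "*s" := mulS (at level 40, left associativity).
Local Infix "+m" := addM (at level 50, left associativity).
Local Infix "*m'" := sc (at level 40).

Definition edgeS (i : 'I_6 -> 'I_6 -> S) k l := i k l *s i l k.
Definition triS (i : 'I_6 -> 'I_6 -> S) k l m := i k l *s i l m *s i m k.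

(** Telescoping: in each product the factors before the difference are taken from [j], those after
    it from [j']. *)
Definition dsq k l : M :=
  foldr (fun m z => j k m *m' x m l +m j' m l *m' x k m +m z) zeroM ords6.
Definition dedge k l := j k l *m' x l k +m j' l k *m' x k l.
Definition de2e3 k l m : M :=
  let u := edgeS j k l in let v := edgeS j l m in
  let v' := edgeS j' l m in let w := edgeS j m k in let w' := edgeS j' m k in
  let u' := edgeS j' k l in
  let du := dedge k l in let dv := dedge l m in let dw := dedge m k in
  D2 *m' ((u *m' dv +m v' *m' du) +m (v *m' dw +m w' *m' dv)
          +m (w *m' du +m u' *m' dw))
  +m oppM ((u *s v) *m' dw +m (u *s w') *m' dv +m (v' *s w') *m' du).
Definition dsplit k l m k' l' m' := de2e3 k l m +m oppM (de2e3 k' l' m').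
Definition dtri k l m :=
  (j k l *s j l m) *m' x m k +m (j k l *s j' m k) *m' x l m
  +m (j' l m *s j' m k) *m' x k l.
Definition dtauf k l m :=
  (triS j k l m +s triS j' k l m) *m' dtri k l m
  +m oppM ((triS j k m l +s triS j' k m l) *m' dtri k m l).
Definition ddtau a b c d :=
  dtauf b c d +m oppM (dtauf a c d) +m dtauf a b d +m oppM (dtauf a b c).

(** There are 36 + 6 + 9 + 4 = 55 forms. The nine indexed by [pairs9] come from the relations
    imposed on j - j', the others from the even equations. *)
Definition forms : seq M :=
  [seq dsq kl.1 kl.2 | kl <- [seq (k, l) | k <- ords6, l <- ords6]]
  ++ [seq x k k | k <- ords6]
  ++ [seq x kl.1 kl.2 +m oppM (x kl.2 kl.1) | kl <- pairs9]
  ++ [:: dsplit o0 o1 o2 o3 o4 o5; dsplit o0 o1 o3 o2 o4 o5;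
         dsplit o0 o1 o4 o2 o3 o5; ddtau o0 o1 o2 o3].
End DifferenceForms.

Section Parametricity.
Variables (S M S' M' : Type).
Variables (addS mulS : S -> S -> S) (addM : M -> M -> M) (oppM : M -> M)
  (sc : S -> M -> M) (zeroM : M).
Variables (addS' mulS' : S' -> S' -> S') (addM' : M' -> M' -> M')
  (oppM' : M' -> M') (sc' : S' -> M' -> M') (zeroM' : M').
Variables (RS : S -> S' -> Prop) (RM : M -> M' -> Prop).
Hypothesis raddS : forall a a' b b', RS a a' -> RS b b' -> RS (addS a b) (addS' a' b').
Hypothesis rmulS : forall a a' b b', RS a a' -> RS b b' -> RS (mulS a b) (mulS' a' b').
Hypothesis raddM : forall a a' b b', RM a a' -> RM b b' -> RM (addM a b) (addM' a' b').
Hypothesis roppM : forall a a', RM a a' -> RM (oppM a) (oppM' a').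
Hypothesis rsc : forall a a' b b', RS a a' -> RM b b' -> RM (sc a b) (sc' a' b').
Hypothesis rzero : RM zeroM zeroM'.

(** Since [forms] only uses the given operations, every relation compatible with them is inherited.
    This transfers the computation on Eisenstein integers to a field, and shows that the
    coefficients are polynomial. *)
Lemma forms_rel D2 D2' j1 j1' j2 j2' x x' :
  RS D2 D2' -> (forall k l, RS (j1 k l) (j1' k l)) ->
  (forall k l, RS (j2 k l) (j2' k l)) -> (forall k l, RM (x k l) (x' k l)) ->
  List.Forall2 RM
    (forms addS mulS addM oppM sc zeroM D2 j1 j2 x)
    (forms addS' mulS' addM' oppM' sc' zeroM' D2' j1' j2' x').
Proof.
move=> rD r1 r2 rx.
have re1 k l : RS (edgeS mulS j1 k l) (edgeS mulS' j1' k l) by apply: rmulS.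
have re2 k l : RS (edgeS mulS j2 k l) (edgeS mulS' j2' k l) by apply: rmulS.
have rt1 k l m : RS (triS mulS j1 k l m) (triS mulS' j1' k l m).
  by apply: rmulS => //; apply: rmulS.
have rt2 k l m : RS (triS mulS j2 k l m) (triS mulS' j2' k l m).
  by apply: rmulS => //; apply: rmulS.
have rsplit k l m k' l' m' :
    RM (dsplit mulS addM oppM sc D2 j1 j2 x k l m k' l' m')
       (dsplit mulS' addM' oppM' sc' D2' j1' j2' x' k l m k' l' m').
  by rewrite /dsplit /de2e3 /dedge /=;
     repeat first [assumption | apply: re1 | apply: re2 | apply: r1 | apply: r2
       | apply: rx | apply: raddM | apply: roppM | apply: rsc | apply: rmulS].
have rtau k l m : RM (dtauf addS mulS addM oppM sc j1 j2 x k l m)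
    (dtauf addS' mulS' addM' oppM' sc' j1' j2' x' k l m).
  by rewrite /dtauf /dtri;
     repeat first [assumption | apply: rt1 | apply: rt2 | apply: r1 | apply: r2
       | apply: rx | apply: raddM | apply: roppM | apply: rsc | apply: rmulS
       | apply: raddS].
have rsq k l : RM (dsq addM sc zeroM j1 j2 x k l)
    (dsq addM' sc' zeroM' j1' j2' x' k l).
  by rewrite /dsq; elim: ords6 => [|m s IH] //=; repeat first [exact: IH
    | apply: r1 | apply: r2 | apply: rx | apply: raddM | apply: rsc].
have fcat (T T' : Type) (R : T -> T' -> Prop) s1 s2 t1 t2 : List.Forall2 R s1 t1 ->
    List.Forall2 R s2 t2 -> List.Forall2 R (s1 ++ s2) (t1 ++ t2).
  by elim=> [|a b s t ab _ IH] //= /IH; constructor.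
have fmap (T U U' : Type) (R : U -> U' -> Prop) (s : seq T) f g :
    (forall a, R (f a) (g a)) -> List.Forall2 R (map f s) (map g s).
  by move=> fg; elim: s => [|a s IH] /=; constructor.
apply: (fcat); first by apply: fmap.
apply: (fcat); first by apply: fmap.
apply: (fcat); first by apply: fmap => a; apply: raddM => //; apply: roppM.
do 3! (constructor; first exact: rsplit).
constructor; last by constructor.
by rewrite /ddtau; repeat first [apply: rtau | apply: raddM | apply: roppM].
Qed.
End Parametricity.

Section Ring.
Variable A : comPzRingType.
Definition formsR (D2 : A) (j j' x : 'M[A]_6) : seq A :=
  forms +%R *%R +%R -%R *%R 0 D2 (fun_of_matrix j) (fun_of_matrix j')
    (fun_of_matrix x).

Lemma dsqE (j j' x : 'M[A]_6) k l :
  dsq +%R *%R 0 (fun_of_matrix j) (fun_of_matrix j') (fun_of_matrix x) k l =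
  (j *m x + x *m j') k l.
Proof. by rewrite !mxE !sum6 /dsq /=; ring. Qed.

Lemma even_eqs_forms (D : A) (j j' : 'M[A]_6) :
  even_eqs D j -> even_eqs D j' ->
  (forall k l : 'I_6, (k < 2)%N -> (k < l)%N -> (j - j') k l = (j - j') l k) ->
  forall y, y \in formsR (D ^+ 2) j j' (j - j') -> y = 0.
Proof.
move=> [jj j0 [s1 s2] s3 t] [jj' j0' [s1' s2'] s3' t'] func y.
have dspl k l m k' l' m' :
    dsplit *%R +%R -%R *%R (D ^+ 2) (fun_of_matrix j) (fun_of_matrix j')
      (fun_of_matrix (j - j')) k l m k' l' m' =
    split_eq D j k l m k' l' m' - split_eq D j' k l m k' l' m'.
  rewrite /dsplit /de2e3 /dedge /edgeS /split_eq /e2e3 /edge !mxE; ring.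
have dta k l m : dtauf +%R *%R +%R -%R *%R (fun_of_matrix j) (fun_of_matrix j')
    (fun_of_matrix (j - j')) k l m = tau j k l m - tau j' k l m.
  by rewrite /dtauf /dtri /triS /tau /triangle !mxE; ring.
rewrite /formsR /forms !mem_cat => /or4P[||| ].
- move=> /mapP[[k l] _ ->] /=; rewrite dsqE.
  have -> : j *m (j - j') + (j - j') *m j' = j *m j - j' *m j'.
    by rewrite mulmxBr mulmxBl addrA subrK.
  by rewrite jj jj' subrr mxE.
- by move=> /mapP[k _ ->]; rewrite !mxE j0 j0' subrr.
- move=> /mapP[kl klin ->]; apply/eqP; rewrite subr_eq0; apply/eqP.
  apply: func; move: klin; rewrite /pairs9 !inE;
  by do 8?[case/predU1P => [->|] //]; move=> /eqP->.
- rewrite !inE => /or4P[] /eqP->; rewrite ?dspl ?s1 ?s1' ?s2 ?s2' ?s3 ?s3' ?subrr//.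
  rewrite /ddtau !dta; transitivity (dtau j o0 o1 o2 o3 - dtau j' o0 o1 o2 o3).
    by rewrite /dtau; ring.
  by rewrite t t' subrr.
Qed.
End Ring.

(** * Linear algebra over the Eisenstein integers *)

(* [(a, b)] stands for a + b w, where w is a primitive cube root of unity. *)
Definition eis : Type := (Z * Z)%type.
Definition eis0 : eis := (Z0, Z0).
Definition eis1 : eis := (Zpos 1, Z0).
Definition eis_add (x y : eis) : eis := (Z.add x.1 y.1, Z.add x.2 y.2).
Definition eis_opp (x : eis) : eis := (Z.opp x.1, Z.opp x.2).
Definition eis_mul (x y : eis) : eis :=
  (Z.sub (Z.mul x.1 y.1) (Z.mul x.2 y.2),
   Z.sub (Z.add (Z.mul x.1 y.2) (Z.mul x.2 y.1)) (Z.mul x.2 y.2)).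
Definition eis_conj (x : eis) : eis := (Z.sub x.1 x.2, Z.opp x.2).
Definition eis_eqb (x y : eis) : bool := Z.eqb x.1 y.1 && Z.eqb x.2 y.2.

Fixpoint row_add (r s : seq eis) : seq eis :=
  match r, s with
  | [::], _ => s
  | _, [::] => r
  | a :: r', b :: s' => eis_add a b :: row_add r' s'
  end.
Definition row_scale (c : eis) (r : seq eis) := map (eis_mul c) r.
Definition row_opp (r : seq eis) := map eis_opp r.

Definition row_content (r : seq eis) : Z :=
  foldr (fun x g => Z.gcd x.1 (Z.gcd x.2 g)) Z0 r.

(** The exactness of the division is tested, and the row is kept when the test fails, so that
    soundness requires no property of the gcd. *)
Definition row_primitive (r : seq eis) : seq eis :=
  let g := row_content r in
  let r' := [seq (Z.div x.1 g, Z.div x.2 g) | x <- r] in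
  if ~~ Z.eqb g Z0 && all2 eis_eqb (row_scale (g, Z0) r') r then r' else r.

Fixpoint find_pivot (c : nat) (seen rows : seq (seq eis)) :=
  match rows with
  | [::] => None
  | r :: rows' =>
      if eis_eqb (nth eis0 r c) eis0 then find_pivot c (r :: seen) rows'
      else Some (r, seen ++ rows')
  end.

Definition row_reduce (c : nat) (p r : seq eis) : seq eis :=
  row_primitive (row_add (row_scale (nth eis0 p c) r)
                         (row_scale (eis_opp (nth eis0 r c)) p)).

(* Gauss-Jordan elimination without divisions on the columns c, ..., c + n - 1;
   [done] contains the previous pivot rows. *)
Fixpoint gauss (n c : nat) (done rows : seq (seq eis)) : seq (seq eis) :=
  match n with
  | 0 => done
  | n'.+1 =>
      match find_pivot c [::] rows with
      | None => [::]
      | Some (p, rows') =>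
          (* The conjugate turns the pivot into its norm, a rational integer, before the common
             content is removed. *)
          let p' := row_primitive (row_scale (eis_conj (nth eis0 p c)) p) in
          gauss n' c.+1 (p' :: map (row_reduce c p') done)
                (map (row_reduce c p') rows')
      end
  end.

Definition unit_row (c : nat) (r : seq eis) : bool :=
  ~~ eis_eqb (nth eis0 r c) eis0
  && all (fun i => (i == c) || eis_eqb (nth eis0 r i) eis0) (iota 0 (size r)).

(** A certificate: only the resulting rows are inspected. Soundness rests on the fact that a vector
    annihilated by the initial rows is annihilated by all the rows produced. *)
Definition full_rank (n : nat) (rows : seq (seq eis)) : bool :=
  let rows' := gauss n 0 [::] rows in
  all (fun c => has (unit_row c) rows') (iota 0 n).

Section Evaluation.
Variables (F : numFieldType) (w : F).
Hypothesis wE : w ^+ 2 = - 1 - w.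

Definition zev (a : Z) : F := (int_of_Z a)%:~R.
Definition eev (x : eis) : F := zev x.1 + zev x.2 * w.

Lemma zevD a b : zev (Z.add a b) = zev a + zev b.
Proof. by rewrite /zev -[Z.add a b]/(a + b) rmorphD /= intrD. Qed.
Lemma zevM a b : zev (Z.mul a b) = zev a * zev b.
Proof. by rewrite /zev -[Z.mul a b]/(a * b) rmorphM /= intrM. Qed.
Lemma zevN a : zev (Z.opp a) = - zev a.
Proof. by rewrite /zev -[Z.opp a]/(- a) rmorphN /= intrN. Qed.
Lemma zevB a b : zev (Z.sub a b) = zev a - zev b.
Proof. by rewrite -Z.add_opp_r zevD zevN. Qed.
Lemma zev_eq0 a : (zev a == 0) = Z.eqb a Z0.
Proof.
rewrite /zev intr_eq0; apply/eqP/idP => [|/Z.eqb_eq->//].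
by move=> e; apply/Z.eqb_eq; rewrite -[a]int_of_ZK e.
Qed.

Lemma eevD x y : eev (eis_add x y) = eev x + eev y.
Proof. by rewrite /eev /= !zevD; ring. Qed.
Lemma eevN x : eev (eis_opp x) = - eev x.
Proof. by rewrite /eev /= !zevN; ring. Qed.
Lemma eevM x y : eev (eis_mul x y) = eev x * eev y.
Proof.
rewrite /eev /= !zevB !zevD !zevM; ring: wE.
Qed.
Lemma eev0 : eev eis0 = 0.
Proof. by rewrite /eev /zev /= mul0r addr0. Qed.
Lemma eev1 : eev eis1 = 1.
Proof. by rewrite /eev /zev /= mul0r addr0. Qed.

Lemma eis_eqbP x y : eis_eqb x y -> x = y.
Proof. by case: x y => [a b] [c d] /andP[/Z.eqb_eq/= -> /Z.eqb_eq/= ->]. Qed.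

(** The norm a^2 - ab + b^2 of a + bw must vanish, and its double is a^2 + b^2 + (a - b)^2. *)
Lemma eev_eq0 x : eev x = 0 -> eis_eqb x eis0.
Proof.
move=> x0; have : eev (eis_mul x (eis_conj x)) = 0 by rewrite eevM x0 mul0r.
case: x {x0} => a b; rewrite /eis_mul /eis_conj /eis_eqb /= /eev /=.
set n := Z.sub _ _; set m := Z.sub _ _.
have -> : m = Z0 by rewrite /m; lia.
rewrite [zev Z0]/zev /= mul0r addr0 => /eqP; rewrite zev_eq0 => /Z.eqb_eq n0.
have n0' : Z.add (Z.add (Z.mul a a) (Z.mul b b)) (Z.mul (Z.sub a b) (Z.sub a b)) = Z0.
  by move: n0; rewrite /n; lia.
have [/Z.eqb_eq-> /Z.eqb_eq->] : a = Z0 /\ b = Z0 by split; nia.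
by [].
Qed.

Variable x : nat -> F.

Fixpoint row_eval (k : nat) (r : seq eis) : F :=
  if r is a :: r' then eev a * x k + row_eval k.+1 r' else 0.

Lemma row_evalD k r s : row_eval k (row_add r s) = row_eval k r + row_eval k s.
Proof.
elim: r s k => [|a r IH] [|b s] k /=; rewrite ?add0r ?addr0//.
by rewrite eevD IH; ring.
Qed.
Lemma row_evalZ k c r : row_eval k (row_scale c r) = eev c * row_eval k r.
Proof.
elim: r k => [|a r IH] k /=; first by rewrite mulr0.
by rewrite eevM IH; ring.
Qed.
Lemma row_evalN k r : row_eval k (row_opp r) = - row_eval k r.
Proof.
elim: r k => [|a r IH] k /=; first by rewrite oppr0.
by rewrite eevN IH; ring.
Qed.

Lemma row_eval_primitive k r : row_eval k r = 0 -> row_eval k (row_primitive r) = 0.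
Proof.
rewrite /row_primitive; case: ifP => // /andP[g0 e] r0.
move: (row_content r) g0 e => g g0; set r' := [seq _ | _ <- _] => e.
have e' : row_scale (g, Z0) r' = r.
  move: (row_scale _ _) e => s; elim: s (r) => [|a s IH] [|b q] //= /andP[ab sq].
  by rewrite (eis_eqbP ab) (IH q).
have := row_evalZ k (g, Z0) r'; rewrite e' r0 => /esym/eqP.
rewrite mulf_eq0 => /orP[|/eqP//].
by rewrite /eev /= [zev Z0]/zev /= mul0r addr0 zev_eq0 (negbTE g0).
Qed.

Lemma row_eval_gauss n c done rows :
  (forall r, r \in done -> row_eval 0 r = 0) -> (forall r, r \in rows -> row_eval 0 r = 0) ->
  forall r, r \in gauss n c done rows -> row_eval 0 r = 0.
Proof.
have pivP c0 rows0 seen p rows' : find_pivot c0 seen rows0 = Some (p, rows') ->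
    p \in rows0 /\ {subset rows' <= seen ++ rows0}.
  elim: rows0 seen => [//|r rs IH] seen /=; case: ifP => _.
    move=> /IH[pin sub]; split; first by rewrite inE pin orbT.
    by move=> q /sub; rewrite !mem_cat !inE => /orP[/orP[]|] ->; rewrite ?orbT.
  move=> [<- <-]; split; first by rewrite inE eqxx.
  by move=> q; rewrite !mem_cat inE => /orP[->//|->]; rewrite !orbT.
elim: n c done rows => [//|n IH] c done rows d0 r0 /=.
case E: (find_pivot c [::] rows) => [[p rows']|//].
have [pin sub] := pivP _ _ _ _ _ E.
set p' := row_primitive _.
have p0 : row_eval 0 p' = 0 by apply: row_eval_primitive; rewrite row_evalZ r0 ?mulr0.
have red r : row_eval 0 r = 0 -> row_eval 0 (row_reduce c p' r) = 0.
  by move=> e; apply: row_eval_primitive; rewrite row_evalD !row_evalZ e p0 !mulr0 addr0.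
apply: IH.
- move=> r; rewrite inE => /orP[/eqP->//|/mapP[s sd ->]].
  by apply: red; apply: d0.
- move=> r /mapP[s sd ->]; apply: red; apply: r0; exact: (sub _ sd).
Qed.

Lemma row_eval_nth k r : row_eval k r = \sum_(i < size r) eev (nth eis0 r i) * x (k + i)%N.
Proof.
elim: r k => [|a r IH] k /=; first by rewrite big_ord0.
rewrite big_ord_recl /= addn0 IH; congr (_ + _); apply: eq_bigr => i _.
by rewrite /bump /= addSnnS.
Qed.

Lemma full_rank_kernel n rows : full_rank n rows ->
  (forall r, r \in rows -> row_eval 0 r = 0) -> forall i, (i < n)%N -> x i = 0.
Proof.
move=> /allP fr r0 i ni.
have iin : i \in iota 0 n by rewrite mem_iota.
have /hasP[r rin /andP[ri0 /allP ru]] := fr i iin.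
have := @row_eval_gauss n 0 [::] rows (fun r e => ltac:(by [])) r0 r rin.
rewrite row_eval_nth => s0.
have isz : (i < size r)%N.
  by rewrite ltnNge; apply: contra ri0 => ?; rewrite nth_default.
move: s0; rewrite (bigD1 (Ordinal isz)) //= big1 ?addr0 => [/eqP|l li].
  by rewrite mulf_eq0 => /orP[/eqP/eev_eq0|/eqP//]; rewrite (negbTE ri0).
have := ru l; rewrite mem_iota add0n ltn_ord => /(_ isT).
move=> /orP[/eqP e|/eis_eqbP->]; last by rewrite eev0 mul0r.
by move: li; rewrite -(inj_eq val_inj) /= e eqxx.
Qed.
End Evaluation.

(* A matrix of the affine Fourier families of order 6, with sixth roots of unity
   as entries, for which the kernels of rows1 and rows2 are trivial. *)
Definition exponents : seq (seq nat) :=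
  [:: [:: 0; 0; 0; 0; 0; 0]; [:: 0; 1; 3; 3; 4; 0]; [:: 0; 2; 4; 0; 2; 4];
      [:: 0; 3; 1; 3; 0; 4]; [:: 0; 4; 2; 0; 4; 2]; [:: 0; 5; 5; 3; 2; 2]]%N.
Definition expo (i k : 'I_6) : nat := nth 0%N (nth [::] exponents i) k.
Definition zeta_pow (n : nat) : eis :=
  nth eis0 [:: (Zpos 1, Z0); (Zpos 1, Zpos 1); (Z0, Zpos 1);
    (Zneg 1, Z0); (Zneg 1, Zneg 1); (Z0, Zneg 1)] (n %% 6)%N.
(** Adding 6 - b keeps the exponent a natural number; this is the quotient of the two powers as long
    as b is at most 6. *)
Definition zquot (a b : nat) : eis := zeta_pow (a + (6 - b))%N.

Definition j0 (k l : 'I_6) : eis :=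
  if (k == l :> nat) then eis0 else
  eis_add (zquot (expo o0 l) (expo o0 k))
    (eis_add (zquot (expo o1 l) (expo o1 k)) (zquot (expo o2 l) (expo o2 k))).
Definition basis (k l : 'I_6) : seq eis := ncons (6 * k + l) eis0 [:: eis1].
(** The matrix [j0] occurs twice because the two reduced matrices j and j' coincide when the matrix
    is Hadamard. *)
Definition rows1 : seq (seq eis) :=
  forms eis_add eis_mul row_add row_opp row_scale [::] eis1 j0 j0 basis.

Definition row_sum (f : 'I_6 -> seq eis) : seq eis :=
  foldr (fun m => row_add (f m)) [::] ords6.
Definition row_sub (r s : seq eis) := row_add r (row_opp s).
Definition block_pairs : seq ('I_6 * 'I_6) :=
  [seq ij : 'I_6 * 'I_6 <- [seq (i, j) | i <- ords6, j <- ords6] |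
    ((ij.1 : nat) != (ij.2 : nat)) && ((ij.1 < 3) == (ij.2 < 3))%N].
(** The unknown is theta in the variation h theta of h, entry by entry. The rows linearize the 12 +
    9 equations, then fix the border (entry (0, 0) twice) and the four parameters: 37 rows for 36
    unknowns. *)
Definition rows2 : seq (seq eis) :=
  [seq row_sum (fun k => row_scale (zquot (expo ij.1 k) (expo ij.2 k))
                 (row_sub (basis ij.1 k) (basis ij.2 k)))
     | ij : 'I_6 * 'I_6 <- block_pairs]
  ++ [seq row_sum (fun i => row_scale
          (eis_add (zquot (expo i kl.2) (expo i kl.1))
                   (zquot (expo i kl.1) (expo i kl.2)))
          (row_sub (basis i kl.2) (basis i kl.1))) | kl : 'I_6 * 'I_6 <- pairs9]
  ++ [seq basis o0 k | k <- ords6] ++ [seq basis i o0 | i <- ords6]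
  ++ [:: basis o1 o1; basis o1 o2; basis o1 o3; basis o2 o1].

Lemma full_rank1 : full_rank 36 rows1. Proof. by vm_compute. Qed.
Lemma full_rank2 : full_rank 36 rows2. Proof. by vm_compute. Qed.

(** * The two kernels at the base matrix *)

Section BasePoint.
Variables (F : numFieldType) (w : F).
Hypothesis wE : w ^+ 2 = - 1 - w.
Local Notation eev := (eev w).

(** Here 1 + w = - w^2 is a primitive sixth root of unity. *)
Definition h0 (i k : 'I_6) : F := (1 + w) ^+ expo i k.

Lemma zeta6 : (1 + w) ^+ 6 = 1.
Proof. by ring: wE. Qed.

Lemma zeta_neq0 : 1 + w != 0.
Proof.
by apply/eqP => z0; move/eqP: zeta6; rewrite z0 expr0n eq_sym oner_eq0.
Qed.

Lemma h0_neq0 i k : h0 i k != 0.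
Proof. by rewrite expf_neq0// zeta_neq0. Qed.

Lemma eev_zeta_pow n : eev (zeta_pow n) = (1 + w) ^+ n.
Proof.
rewrite {2}(divn_eq n 6) exprD mulnC exprM zeta6 expr1n mul1r /zeta_pow.
have := ltn_pmod n (isT : (0 < 6)%N); move: (n %% 6)%N => m.
have z1 : zev F (Zpos 1) = 1 by []. have z1N : zev F (Zneg 1) = - 1 by [].
have z0 : zev F Z0 = 0 by [].
case: m => [|[|[|[|[|[|//]]]]]] _; rewrite /eev /= ?z0 ?z1 ?z1N; ring: wE.
Qed.

Lemma eev_zquot a b : (b <= 6)%N -> eev (zquot a b) = (1 + w) ^+ a / (1 + w) ^+ b.
Proof.
move=> b6; rewrite eev_zeta_pow exprD; congr (_ * _).
have zb : (1 + w) ^+ b != 0 by rewrite expf_neq0 ?zeta_neq0.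
by apply: (mulIf zb); rewrite mulVf// -exprD subnK// zeta6.
Qed.

Lemma expo_le i k : (expo i k <= 6)%N.
Proof.
by elim/ord6_ind: i; elim/ord6_ind: k.
Qed.

Variable x : 'M[F]_6.
Let X (n : nat) : F := x (inord (n %/ 6)) (inord (n %% 6)).

Lemma row_eval_basis k l : row_eval w X 0 (basis k l) = x k l.
Proof.
have lb n m : row_eval w X m (ncons n eis0 [:: eis1]) = X (m + n)%N.
  elim: n m => [|n IH] m /=; first by rewrite eev1 mul1r addr0 addn0.
  by rewrite eev0 mul0r add0r IH addSnnS.
rewrite /basis lb add0n /X mulnC divnMDl// modnMDl divn_small// modn_small//.
by rewrite addn0 !inord_val.
Qed.

Lemma x_eq0 : (forall i, (i < 36)%N -> X i = 0) -> x = 0.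
Proof.
move=> X0; apply/matrixP => k l; rewrite mxE -row_eval_basis.
rewrite row_eval_nth; apply: big1 => i _; rewrite add0n X0 ?mulr0//.
case: i => i /=; rewrite /basis size_ncons /=.
by have := ltn_ord k; have := ltn_ord l; lia.
Qed.

Definition gram0 : 'M[F]_6 := \matrix_(k, l) eev (j0 k l).

Lemma base_forms_kernel :
  (forall y, y \in formsR 1 gram0 gram0 x -> y = 0) -> x = 0.
Proof.
move=> fx; apply: x_eq0; apply: (full_rank_kernel wE full_rank1) => r rin.
pose RM r y := row_eval w X 0 r = y.
have rel : List.Forall2 RM rows1 (formsR 1 gram0 gram0 x).
  apply: (@forms_rel _ _ _ _ _ _ _ _ _ _ _ _ _ _ _ _ (fun e s => eev e = s)) => //.
  - by move=> a _ b _ <- <-; rewrite eevD.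
  - by move=> a _ b _ <- <-; rewrite eevM.
  - by move=> a _ b _ <- <-; rewrite /RM row_evalD.
  - by move=> a _ <-; rewrite /RM row_evalN.
  - by move=> a _ b _ <- <-; rewrite /RM row_evalZ.
  - exact: eev1.
  - by move=> k l; rewrite mxE.
  - by move=> k l; rewrite mxE.
  - exact: row_eval_basis.
move: rin; elim: rel fx => [//|a b s t ab _ IH] fx.
rewrite inE => /orP[/eqP->|]; first by rewrite ab; apply: fx; rewrite inE eqxx.
by apply: IH => y yt; apply: fx; rewrite inE yt orbT.
Qed.

Lemma base_tangent_kernel :
  (forall i k, i = o0 \/ k = o0 -> x i k = 0) ->
  (forall i j : 'I_6, i != j -> (i < 3)%N = (j < 3)%N ->
     \sum_k h0 i k / h0 j k * (x i k - x j k) = 0) ->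
  (forall k l : 'I_6, (k < 2)%N -> (k < l)%N ->
     \sum_i (h0 i l / h0 i k + h0 i k / h0 i l) * (x i l - x i k) = 0) ->
  x o1 o1 = 0 -> x o1 o2 = 0 -> x o1 o3 = 0 -> x o2 o1 = 0 -> x = 0.
Proof.
move=> x0 xr xc x11 x12 x13 x21; apply: x_eq0.
have sumE f : row_eval w X 0 (row_sum f) = \sum_i row_eval w X 0 (f i).
  by rewrite sum6 /row_sum /= !row_evalD /= addr0 !addrA.
apply: (full_rank_kernel wE full_rank2) => r.
rewrite /rows2 !mem_cat => /or4P[| | |/orP[|]].
- move=> /mapP[[i j]]; rewrite mem_filter => /andP[/andP[ij /eqP b] _] ->.
  rewrite sumE -[RHS](xr i j)//; apply: eq_bigr => k _.
  by rewrite row_evalZ// /row_sub row_evalD row_evalN !row_eval_basis eev_zquot ?expo_le.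
- move=> /mapP[[k l] kl ->]; rewrite sumE.
  rewrite -[RHS](xc k l).
  + apply: eq_bigr => i _.
    by rewrite row_evalZ// /row_sub row_evalD row_evalN !row_eval_basis eevD !eev_zquot ?expo_le.
  + by move: kl; rewrite !inE; do 8?[case/predU1P => [[-> _] //|]]; move=> /eqP[-> _].
  + by move: kl; rewrite !inE; do 8?[case/predU1P => [[-> ->] //|]]; move=> /eqP[-> ->].
- by move=> /mapP[k _ ->]; rewrite row_eval_basis x0//; left.
- by move=> /mapP[k _ ->]; rewrite row_eval_basis x0//; right.
- by rewrite !inE => /or4P[] /eqP->; rewrite row_eval_basis.
Qed.

End BasePoint.

Lemma Forall2_nth (T U : Type) (P : T -> U -> Prop) x y s t :
  List.Forall2 P s t -> forall i, (i < size s)%N -> P (nth x s i) (nth y t i).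
Proof. by elim=> [//|a b s' t' ab _ IH] [|i] //= /IH. Qed.

(** * Triviality of a kernel as an open condition *)

Section CoefficientMatrix.
Variable F : fieldType.
Implicit Types (j x : 'M[F]_6).

(** The variable x_kl is replaced by the indicator function of (k, l), so that a form becomes the
    table of its coefficients. *)
Definition coefs (D2 : F) (j j' : 'I_6 -> 'I_6 -> F) : seq ('I_6 -> 'I_6 -> F) :=
  forms +%R *%R (fun u v a b => u a b + v a b) (fun u a b => - u a b)
    (fun c u a b => c * u a b) (fun _ _ => 0) D2 j j'
    (fun k l a b => ((a == k) && (b == l))%:R).

Definition coef_mx D2 (j j' : 'M[F]_6) : 'M[F]_(55, #|{: 'I_6 * 'I_6}|) :=
  \matrix_(t, u) nth (fun _ _ => 0) (coefs D2 j j') t (enum_val u).1 (enum_val u).2.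

Definition vec36 x : 'cV[F]_#|{: 'I_6 * 'I_6}| :=
  \col_u x (enum_val u).1 (enum_val u).2.

Lemma vec36_eq0 x : vec36 x = 0 -> x = 0.
Proof.
move=> /colP x0; apply/matrixP => k l.
by have := x0 (enum_rank (k, l)); rewrite !mxE enum_rankK.
Qed.

Lemma coef_mxP D2 j j' (x : 'M[F]_6) :
  coef_mx D2 j j' *m vec36 x = 0 <-> forall y, y \in formsR D2 j j' x -> y = 0.
Proof.
pose RM (u : 'I_6 -> 'I_6 -> F) y := \sum_a \sum_b u a b * x a b = y.
have rel : List.Forall2 RM (coefs D2 j j') (formsR D2 j j' x).
  apply: (@forms_rel _ _ _ _ _ _ _ _ _ _ _ _ _ _ _ _ eq) => //.
  - by move=> a _ b _ <- <-.
  - by move=> a _ b _ <- <-.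
  - move=> a _ b _ <- <-; rewrite /RM -big_split; apply: eq_bigr => k _ /=.
    by rewrite -big_split; apply: eq_bigr => l _; rewrite mulrDl.
  - move=> a _ <-; rewrite /RM -sumrN; apply: eq_bigr => k _ /=.
    by rewrite -sumrN; apply: eq_bigr => l _; rewrite mulNr.
  - move=> a _ b _ <- <-; rewrite /RM mulr_sumr; apply: eq_bigr => k _ /=.
    by rewrite mulr_sumr; apply: eq_bigr => l _; rewrite mulrA.
  - by rewrite /RM big1// => k _; rewrite big1// => l _; rewrite mul0r.
  - move=> k l; rewrite /RM (bigD1 k)//= (bigD1 l)//= !eqxx mul1r !big1 ?addr0//.
    + by move=> a ak; rewrite big1// => b _; rewrite (negbTE ak) mul0r.
    + by move=> b bl; rewrite (negbTE bl) mul0r.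
have relE t d : (t < 55)%N ->
    nth d (formsR D2 j j' x) t = (coef_mx D2 j j' *m vec36 x) (inord t) 0.
  move=> t55; rewrite mxE (reindex (@enum_rank _)) /=; last first.
    by exists enum_val => u _; [exact: enum_rankK|exact: enum_valK].
  under eq_bigr do rewrite !mxE enum_rankK inordK//.
  rewrite -(pair_bigA _ (fun a b => nth (fun _ _ => 0) (coefs D2 j j') t a b * x a b)) /=.
  by rewrite -(Forall2_nth (fun _ _ => 0) d rel t55).
split=> [B0 y|f0].
  move=> /(nthP 0)[t]; rewrite -[size _]/55%N => t55 <-.
  by rewrite relE// B0 mxE.
apply/colP => t; rewrite [RHS]mxE -[t]inord_val -(relE t 0)//.
by apply: f0; apply: mem_nth; exact: ltn_ord.
Qed.

Lemma kernel_left_inverse m n (M : 'M[F]_(m, n)) :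
  (forall v : 'cV_n, M *m v = 0 -> v = 0) -> exists L, L *m M = 1%:M.
Proof.
move=> M0; apply/row_fullP; rewrite /row_full -mxrank_tr.
rewrite -/(row_free M^T) -kermx_eq0; apply/rowV0P => u /sub_kermxP uM.
have : u^T = 0 by apply: M0; rewrite -[M]trmxK -trmx_mul uM trmx0.
by move=> /(congr1 trmx); rewrite trmxK trmx0.
Qed.

(** For fixed [L] the determinant is a polynomial in the entries of [M]: this is the source of the
    Zariski-open condition. *)
Lemma minor_kernel m n (M : 'M[F]_(m, n)) L :
  \det (L *m M) != 0 -> forall v : 'cV_n, M *m v = 0 -> v = 0.
Proof.
move=> dLM v Mv; have uLM : L *m M \in unitmx by rewrite unitmxE unitfE.
by rewrite -[v](mulKmx uLM) -mulmxA Mv !mulmx0.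
Qed.
End CoefficientMatrix.

(** * From the two halves to the whole Hadamard matrix *)

Definition up (i : 'I_3) : 'I_6 := @lshift 3 3 i.
Definition lo (i : 'I_3) : 'I_6 := @rshift 3 3 i.

Lemma sum_uplo (V : nmodType) (f : 'I_6 -> V) :
  \sum_i f i = \sum_i f (up i) + \sum_i f (lo i).
Proof. by rewrite (@big_split_ord _ _ _ 3 3). Qed.

Section Core.
Variable F : fieldType.
Variable H : 'I_6 -> 'I_6 -> F.
Hypothesis H0 : forall i k, H i k != 0.

Definition gram_up := gram3 (fun i => H (up i)) - 3%:R%:M.
Definition gram_lo := gram3 (fun i => H (lo i)) - 3%:R%:M.

Lemma gram_upD_lo k l : k != l ->
  (gram_up - - gram_lo) k l = \sum_i H i l / H i k.
Proof. by move=> kl; rewrite !mxE (negbTE kl) !subr0 opprK sum_uplo. Qed.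

Hypothesis block_orth : forall i j : 'I_6, i != j -> (i < 3)%N = (j < 3)%N ->
  \sum_k H i k / H j k = 0.
Hypothesis col_sym : forall k l : 'I_6, (k < 2)%N -> (k < l)%N ->
  \sum_i H i l / H i k = \sum_i H i k / H i l.

Lemma even_eqs_up : even_eqs 1 gram_up.
Proof.
apply: even_eqs_gram3 => // i i' ii; apply: block_orth.
  by rewrite (inj_eq (@lshift_inj 3 3)).
by rewrite /= !ltn_ord.
Qed.

Lemma even_eqs_lo : even_eqs 1 (- gram_lo).
Proof.
apply: even_eqsN; apply: even_eqs_gram3 => // i i' ii; apply: block_orth.
  by rewrite (inj_eq (@rshift_inj 3 3)).
by [].
Qed.

(** The difference j - j', rescaled by [D], is annihilated by the 55 forms, hence is zero; off the
    diagonal its entries are [D] times the inner products of the columns. *)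
Lemma columns_orthogonal D : D != 0 ->
  (forall x, coef_mx (D ^+ 2) (D *: gram_up) (D *: - gram_lo) *m vec36 x = 0 -> x = 0) ->
  forall k l, k != l -> \sum_i H i l / H i k = 0.
Proof.
move=> D0 ker k l kl.
have : D *: gram_up - D *: - gram_lo = 0.
  apply: ker; apply/coef_mxP.
  apply: even_eqs_forms.
  - exact/even_eqsZ/even_eqs_up.
  - exact/even_eqsZ/even_eqs_lo.
  - move=> k' l' k2 kl'; have kl0 : k' != l' by rewrite -(inj_eq val_inj) ltn_eqF.
    rewrite -scalerBr [LHS]mxE [RHS]mxE; congr (_ * _).
    by rewrite !gram_upD_lo// 1?eq_sym// col_sym.
rewrite -scalerBr => /eqP; rewrite scaler_eq0 (negbTE D0) /= => /eqP/matrixP/(_ k l).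
by rewrite gram_upD_lo// mxE.
Qed.

Lemma rows_orthogonal : (6%:R : F) != 0 ->
  (forall k l, k != l -> \sum_i H i l / H i k = 0) ->
  forall i j, i != j -> \sum_k H i k / H j k = 0.
Proof.
move=> six0 ort i j ij.
pose P : 'M[F]_6 := \matrix_(i, k) H i k.
pose Q : 'M[F]_6 := \matrix_(k, i) (H i k)^-1.
have QP : (6%:R^-1 *: Q) *m P = 1%:M.
  apply/matrixP => k l; rewrite -scalemxAl !mxE.
  under eq_bigr do rewrite !mxE mulrC.
  case: eqVneq => [->|kl]; last by rewrite ort ?mulr0.
  under eq_bigr do rewrite divff//.
  by rewrite sumr_const card_ord mulVf.
have := mulmx1C QP; rewrite -scalemxAr => /matrixP/(_ i j).
rewrite !mxE (negbTE ij); under eq_bigr do rewrite !mxE.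
by move=> /eqP; rewrite mulf_eq0 invr_eq0 (negbTE six0) /= => /eqP.
Qed.
End Core.

Import Order.TTheory.
Import numFieldNormedType.Exports.
Local Open Scope classical_set_scope.
Local Open Scope ring_scope.
Local Open Scope complex_scope.
Local Open Scope sesquilinear_scope.

(** * Polynomial functions on configurations *)

Section PolynomialFunctions.
Variables (R : realType) (n : nat).
Local Notation C := R[i].
Local Notation cfg := (config R n).
Local Notation N := (ncoord n).
Implicit Types (f g : cfg -> C) (x v : cfg).

Definition coord_of (x : cfg) (l : 'I_N) : C := config_coord x 0 l.

Definition cfg_of (y : 'rV[C]_N) : cfg :=
  (fun i => \matrix_(a, c) y 0 (enum_rank (true, i, (a, c))),
   fun i => \matrix_(a, c) y 0 (enum_rank (false, i, (a, c)))).

Lemma cfg_ofK y : config_coord (cfg_of y) = y.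
Proof.
apply/rowP => k; rewrite mxE.
case E: (enum_val k) => [[b i] [a c]]; rewrite -(enum_valK k) E.
by case: b {E} => /=; rewrite mxE.
Qed.

Lemma config_coordK x : cfg_of (config_coord x) = x.
Proof.
case: x => p q; congr pair; apply/funext => i; apply/matrixP => a c;
  by rewrite !mxE enum_rankK.
Qed.

Lemma config_coord_inj : injective (@config_coord R n).
Proof. exact: (can_inj config_coordK). Qed.

(* D x v is the derivative of f at x along v *)
Definition dpoly f (D : cfg -> cfg -> C) : Prop :=
  exists p : mpoly N C, (forall x, f x = meval (coord_of x) p) /\
    forall x v, D x v = \sum_l coord_of v l * meval (coord_of x) (mderiv l p).

Definition polyfun f : Prop := exists D, dpoly f D.

Lemma dpoly_ext f g D D' : dpoly f D -> f =1 g -> (forall x v, D x v = D' x v) ->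
  dpoly g D'.
Proof. by move=> [p [fp Dp]] fg DD; exists p; split=> [x|x v]; rewrite -?fg -?DD. Qed.

Lemma dpoly_cst c : dpoly (fun=> c) (fun _ _ => 0).
Proof.
exists (mpolyC N c); split=> [x|x v]; first by rewrite mevalC.
by rewrite big1// => l _; rewrite mderivC meval0 mulr0.
Qed.

Lemma dpoly_coord (b : bool) i a c :
  dpoly (fun x => (if b then x.1 i else x.2 i) a c)
        (fun _ v => (if b then v.1 i else v.2 i) a c).
Proof.
have cE x : coord_of x (enum_rank (b, i, (a, c))) = (if b then x.1 i else x.2 i) a c.
  by rewrite /coord_of mxE enum_rankK.
set l0 := enum_rank _ in cE *.
exists (mpolyX C (mnm1 l0)); split=> [x|x v]; first by rewrite mevalXU cE.
rewrite (bigD1 l0)//= big1 ?addr0 => [|l ll0]; last first.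
  by rewrite mderivX mnm1E eq_sym (negbTE ll0) scale0r meval0 mulr0.
rewrite mderivX mnm1E eqxx scale1r mevalX big1 ?mulr1 ?cE// => i' _.
by rewrite mnmBE subnn expr0.
Qed.

Lemma dpolyD f g D D' : dpoly f D -> dpoly g D' ->
  dpoly (fun x => f x + g x) (fun x v => D x v + D' x v).
Proof.
move=> [p [fp Dp]] [q [gq Dq]]; exists (p + q); split=> [x|x v].
  by rewrite mevalD fp gq.
rewrite Dp Dq -big_split; apply: eq_bigr => l _.
by rewrite mderivD mevalD mulrDr.
Qed.

Lemma dpolyN f D : dpoly f D -> dpoly (fun x => - f x) (fun x v => - D x v).
Proof.
move=> [p [fp Dp]]; exists (- p); split=> [x|x v]; first by rewrite mevalN fp.
rewrite Dp -sumrN; apply: eq_bigr => l _.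
by rewrite mderivN mevalN mulrN.
Qed.

Lemma dpolyB f g D D' : dpoly f D -> dpoly g D' ->
  dpoly (fun x => f x - g x) (fun x v => D x v - D' x v).
Proof. by move=> ? ?; apply: dpolyD => //; apply: dpolyN. Qed.

Lemma dpolyM f g D D' : dpoly f D -> dpoly g D' ->
  dpoly (fun x => f x * g x) (fun x v => D x v * g x + f x * D' x v).
Proof.
move=> [p [fp Dp]] [q [gq Dq]]; exists (p * q); split=> [x|x v].
  by rewrite mevalM fp gq.
rewrite Dp Dq mulr_suml mulr_sumr -big_split; apply: eq_bigr => l _ /=.
by rewrite mderivM mevalD !mevalM -fp -gq; ring.
Qed.

Lemma dpoly_sum (I : Type) (r : seq I) (P : pred I) (f : I -> cfg -> C) D :
  (forall i, dpoly (f i) (D i)) ->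
  dpoly (fun x => \sum_(i <- r | P i) f i x) (fun x v => \sum_(i <- r | P i) D i x v).
Proof.
move=> fD; elim: r => [|i r IH].
  by apply: (dpoly_ext (dpoly_cst 0)) => [x|x v]; rewrite big_nil.
case Pi: (P i).
  by apply: (dpoly_ext (dpolyD (fD i) IH)) => [x|x v]; rewrite big_cons Pi.
by apply: (dpoly_ext IH) => [x|x v]; rewrite big_cons Pi.
Qed.

Lemma polyfun_cst c : polyfun (fun=> c).
Proof. by eexists; exact: dpoly_cst. Qed.
Lemma polyfunD f g : polyfun f -> polyfun g -> polyfun (fun x => f x + g x).
Proof. by move=> [D fD] [D' gD]; eexists; exact: dpolyD fD gD. Qed.
Lemma polyfunN f : polyfun f -> polyfun (fun x => - f x).
Proof. by move=> [D fD]; eexists; exact: dpolyN fD. Qed.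
Lemma polyfunM f g : polyfun f -> polyfun g -> polyfun (fun x => f x * g x).
Proof. by move=> [D fD] [D' gD]; eexists; exact: dpolyM fD gD. Qed.
Lemma polyfun_sum (I : Type) (r : seq I) (P : pred I) (f : I -> cfg -> C) :
  (forall i, polyfun (f i)) -> polyfun (fun x => \sum_(i <- r | P i) f i x).
Proof.
move=> fD; have /boolp.choice[D fD'] := fD.
by eexists; exact: (dpoly_sum r P fD').
Qed.
Lemma polyfun_prod (I : Type) (r : seq I) (P : pred I) (f : I -> cfg -> C) :
  (forall i, polyfun (f i)) -> polyfun (fun x => \prod_(i <- r | P i) f i x).
Proof.
move=> fD; elim: r => [|i r IH].
  have [D cD] := polyfun_cst 1; exists D; apply: (dpoly_ext cD) => // x.
  by rewrite big_nil.
case Pi: (P i).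
  have [D cD] := polyfunM (fD i) IH; exists D; apply: (dpoly_ext cD) => // x.
  by rewrite big_cons Pi.
by have [D cD] := IH; exists D; apply: (dpoly_ext cD) => // x; rewrite big_cons Pi.
Qed.
Lemma polyfun_det m (M : cfg -> 'M[C]_m) :
  (forall i j, polyfun (fun x => M x i j)) -> polyfun (fun x => \det (M x)).
Proof.
move=> Mp; rewrite /determinant; apply: polyfun_sum => s.
by apply: polyfunM; [exact: polyfun_cst|apply: polyfun_prod => i].
Qed.

Definition mdpoly a b (M : cfg -> 'M[C]_(a, b)) (DM : cfg -> cfg -> 'M[C]_(a, b)) :=
  forall i j, dpoly (fun x => M x i j) (fun x v => DM x v i j).

Lemma mdpoly_p i : mdpoly (fun x => x.1 i) (fun _ v => v.1 i).
Proof. by move=> a c; apply: (dpoly_coord true). Qed.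
Lemma mdpoly_q i : mdpoly (fun x => x.2 i) (fun _ v => v.2 i).
Proof. by move=> a c; apply: (dpoly_coord false). Qed.
Lemma mdpoly_mul a b c (M : cfg -> 'M[C]_(a, b)) DM (M' : cfg -> 'M[C]_(b, c)) DM' :
  mdpoly M DM -> mdpoly M' DM' ->
  mdpoly (fun x => M x *m M' x) (fun x v => DM x v *m M' x + M x *m DM' x v).
Proof.
move=> Mp Mp' i j; apply: (dpoly_ext (dpoly_sum _ _ (fun k => dpolyM (Mp i k) (Mp' k j)))).
  by move=> x; rewrite mxE.
by move=> x v; rewrite !mxE -big_split.
Qed.
Lemma mdpoly_sum a b (I : finType) (P : pred I) (M : I -> cfg -> 'M[C]_(a, b)) DM :
  (forall t, mdpoly (M t) (DM t)) ->
  mdpoly (fun x => \sum_(t | P t) M t x) (fun x v => \sum_(t | P t) DM t x v).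
Proof.
move=> Mp i j; apply: (dpoly_ext (dpoly_sum _ _ (fun t => Mp t i j))) => [x|x v];
  by rewrite summxE.
Qed.

(** Row freeness of the Jacobian is restated as the absence of linear relations between the
    differentials. Such relations can be tested on well-chosen tangent vectors, without computing
    partial derivatives. *)
Lemma smooth_point_criterion (Z : set cfg) (T : finType) (f : T -> cfg -> C)
    (D : T -> cfg -> cfg -> C) h x :
  (forall t, dpoly (f t) (D t)) -> polyfun h -> Z x -> h x != 0 ->
  (forall y, h y != 0 -> (Z y <-> forall t, f t y = 0)) ->
  (forall c : T -> C, (forall v, \sum_t c t * D t x v = 0) -> forall t, c t = 0) ->
  smooth_point (@config_coord R n @` Z) (config_coord x).
Proof.
move=> /boolp.choice[p pE] [_ [q [hq _]]] Zx hx Zf cD; split; first by exists x.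
exists #|T|, (fun k => p (enum_val k)), q; split.
- by rewrite (_ : meval _ q = h x)//; exact/esym/hq.
- move=> y; rewrite -[y]cfg_ofK (_ : meval _ q = h (cfg_of y)); last exact/esym/hq.
  move=> hy; split.
    move=> [z Zz /config_coord_inj zy] k; rewrite zy in Zz.
    rewrite -[LHS]((pE (enum_val k)).1 (cfg_of y)).
    exact: ((Zf _ hy).1 Zz).
  move=> py; exists (cfg_of y) => //; apply: (Zf _ hy).2 => t.
  by rewrite (pE t).1 -(enum_rankK t) py.
- rewrite -kermx_eq0; apply/rowV0P => u /sub_kermxP uA.
  apply/rowP => k; rewrite mxE -[k]enum_valK.
  apply: (cD (fun t => u 0 (enum_rank t))) => v.
  transitivity ((u *m (\matrix_(k < #|T|, l < N)
      meval (config_coord x 0) (mderiv l (p (enum_val k)))) *m (config_coord v)^T) 0 0);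
    last by rewrite uA mul0mx mxE.
  rewrite mxE; under [RHS]eq_bigr do rewrite mxE mulr_suml.
  rewrite exchange_big (reindex (@enum_val T predT)) /=; last first.
    by exists enum_rank => t _; [exact: enum_valK|exact: enum_rankK].
  apply: eq_bigr => k' _; rewrite enum_valK (pE _).2 mulr_sumr.
  by apply: eq_bigr => l _; rewrite !mxE /coord_of !mxE; ring.
Qed.
End PolynomialFunctions.

(** * Equations of the variety near a base point *)

Lemma mul_delta_mulE (F : pzRingType) m n p (M : 'M[F]_(m, n)) (M' : 'M[F]_(n, p)) j k l :
  (M *m delta_mx j j *m M') k l = M k j * M' j l.
Proof.
rewrite mxE (bigD1 j)//= big1 ?addr0 => [|i ij].
  rewrite mxE (bigD1 j)//= big1 ?addr0 => [|i ij].
    by rewrite mxE !eqxx mulr1.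
  by rewrite mxE (negbTE ij) mulr0.
rewrite mxE big1 ?mul0r// => i' _.
by rewrite mxE (negbTE ij) andbF mulr0.
Qed.

Lemma delta_mulE (F : pzRingType) n p (M : 'M[F]_(n, p)) k l :
  (delta_mx k k *m M) k l = M k l.
Proof. by rewrite -(mul1mx (delta_mx k k)) mul_delta_mulE mxE eqxx mul1r. Qed.

Lemma mul_deltaE (F : pzRingType) m n (M : 'M[F]_(m, n)) k l :
  (M *m delta_mx l l) k l = M k l.
Proof. by rewrite -(mulmx1 (M *m _)) mul_delta_mulE mxE eqxx mulr1. Qed.

Lemma mxtrace_delta_mul (F : pzRingType) n (M : 'M[F]_n) i :
  \tr (delta_mx i i *m M) = M i i.
Proof.
rewrite /mxtrace (bigD1 i)//= big1 ?addr0 ?delta_mulE// => k ki.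
by rewrite mxE big1// => l _; rewrite mxE (negbTE ki) mul0r.
Qed.

(** * Rank one projectors and frames *)

Section RankOne.
Variables (R : realType) (n : nat).
Local Notation C := R[i].
Implicit Types P : 'M[C]_n.

Lemma rank1_factor P : rank1_projector P ->
  exists (u : 'cV[C]_n) (v : 'rV[C]_n), P = u *m v /\ v *m u = 1%:M.
Proof.
move=> [PP rP].
have [u [v Puv]] : exists (u : 'cV[C]_n) (v : 'rV[C]_n), u *m v = P.
  have := mulmx_base P; move: (col_base P) (row_base P); rewrite rP => u v e.
  by exists u, v.
exists u, v; split=> //; rewrite -Puv in PP rP.
apply/eqP; rewrite [v *m u]mx11_scalar; set a := (v *m u) 0 0.
(* Idempotence of u v says that multiplication by the scalar a = v u fixes u v. *)
have : (a - 1) *: (u *m v) = 0.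
  rewrite scalerBl scale1r -[in RHS](subrr (u *m v)) -[in X in _ = X - _]PP.
  by rewrite mulmxA -(mulmxA u v u) [v *m u]mx11_scalar -/a mul_mx_scalar -scalemxAl.
move=> /eqP; rewrite scaler_eq0 subr_eq0 => /orP[/eqP->//|/eqP uv0].
by rewrite uv0 mxrank0 in rP.
Qed.

Lemma rank1_sandwich P (M : 'M[C]_n) : rank1_projector P ->
  P *m M *m P = \tr (P *m M) *: P.
Proof.
move=> /rank1_factor[u [v [-> vu]]].
rewrite -(mulmxA u v M) mxtrace_mulC !mulmxA -(mulmxA u) -(mulmxA u (v *m M)).
rewrite [v *m M *m u]mx11_scalar mxtrace_scalar mulr1n.
by rewrite mul_mx_scalar -scalemxAl.
Qed.
End RankOne.

Section Frame.
Variables (R : realType) (n : nat).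
Local Notation C := R[i].

Lemma frame_projectors (U V : 'M[C]_n) : V *m U = 1%:M ->
  let P j := U *m delta_mx j j *m V in
  (forall j, rank1_projector (P j)) /\ (forall i j, i != j -> P i *m P j = 0).
Proof.
move=> VU P; have PP i j : P i *m P j = U *m (delta_mx i i *m delta_mx j j) *m V.
  by rewrite /P !mulmxA -(mulmxA _ V U) VU mulmx1.
split=> [j|i j ij]; last by rewrite PP mul_delta_mx_0// mulmx0 mul0mx.
split; first by rewrite PP mul_delta_mx.
have uU : U \in unitmx by case/mulmx1_unit: VU.
have uV : V \in unitmx by case/mulmx1_unit: VU.
rewrite /P mxrankMfree ?row_free_unit//.
by rewrite -mxrank_tr trmx_mul mxrankMfree ?row_free_unit ?unitmx_tr// mxrank_tr mxrank_delta.
Qed.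

Lemma projectors_frame (P : 'I_n -> 'M[C]_n) :
  (forall j, rank1_projector (P j)) -> (forall i j, i != j -> P i *m P j = 0) ->
  exists U V : 'M[C]_n, V *m U = 1%:M /\ forall j, P j = U *m delta_mx j j *m V.
Proof.
move=> rP oP; have /boolp.choice[u /boolp.choice[v uvP]] := fun j => rank1_factor (rP j).
pose U : 'M[C]_n := \matrix_(k, j) u j k 0; pose V : 'M[C]_n := \matrix_(j, l) v j 0 l.
exists U, V; split; last first.
  move=> j; apply/matrixP => k l; rewrite mul_delta_mulE (uvP j).1 !mxE.
  by rewrite big_ord1.
apply/matrixP => i j; transitivity ((v i *m u j) 0 0).
  by rewrite !mxE; apply: eq_bigr => k _; rewrite !mxE.
case: (eqVneq i j) => [<-|ij]; first by rewrite (uvP i).2 !mxE !eqxx.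
(* Between v_i and u_j, the product P_i P_j = 0 reduces to v_i u_j. *)
have : v i *m (P i *m P j) *m u j = 0 by rewrite oP// mulmx0 mul0mx.
rewrite (uvP i).1 (uvP j).1 !mulmxA (uvP i).2 mul1mx -mulmxA (uvP j).2 mulmx1.
by move=> ->; rewrite !mxE (negbTE ij).
Qed.

Lemma projectors_sum (P : 'I_n -> 'M[C]_n) :
  (forall j, rank1_projector (P j)) -> (forall i j, i != j -> P i *m P j = 0) ->
  \sum_j P j = 1%:M.
Proof.
move=> rP oP; have [U [V [VU PE]]] := projectors_frame rP oP.
rewrite -(mulmx1C VU) -[U in RHS]mulmx1 mx1_sum_delta mulmx_sumr mulmx_suml.
by apply: eq_bigr => j _; exact: PE.
Qed.
End Frame.

(** * The 393 equations hold on the variety *)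

Section Equations.
Variable R : realType.
Local Notation C := R[i].
Local Notation cfg := (config R 6).
Implicit Types x v : cfg.

(** The families have 150, 36, 6, 180, 12 and 9 members. Indices in ['I_5] stand for those different
    from a given one, through [lift]. *)
Definition eq_index : finType :=
  ('I_6 * 'I_5 * 'I_5 + ('I_6 * 'I_6 + ('I_6 + ('I_6 * 'I_6 * 'I_5 +
    (bool * 'I_3 * 'I_2 + ('I_5 + 'I_4))))))%type.

Definition block_index (b : bool) : 'I_3 -> 'I_6 := if b then up else lo.
Definition row_pair (t : bool * 'I_3 * 'I_2) : 'I_6 * 'I_6 :=
  (block_index t.1.1 t.1.2, block_index t.1.1 (lift t.1.2 t.2)).
Definition col_pair (t : 'I_5 + 'I_4) : 'I_6 * 'I_6 :=
  match t with
  | inl l => (o0, @rshift 1 5 l)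
  | inr l => (o1, @rshift 2 4 l)
  end.

Definition Wm x (k j l : 'I_6) : 'M[C]_6 := x.1 k *m x.2 j *m x.1 l.
Definition dWm x v (k j l : 'I_6) : 'M[C]_6 :=
  (v.1 k *m x.2 j + x.1 k *m v.2 j) *m x.1 l + x.1 k *m x.2 j *m v.1 l.
Definition Qm x : 'M[C]_6 := \sum_j x.2 j.
Definition Sm x (i j : 'I_6) : 'M[C]_6 := x.1 i *m Qm x *m x.1 j.
Definition dSm x v (i j : 'I_6) : 'M[C]_6 :=
  (v.1 i *m Qm x + x.1 i *m Qm v) *m x.1 j + x.1 i *m Qm x *m v.1 j.
Definition Vm x (k l : 'I_6) : 'M[C]_6 := x.1 o0 *m x.2 k *m x.2 l *m x.1 o0.
Definition dVm x v (k l : 'I_6) : 'M[C]_6 :=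
  ((v.1 o0 *m x.2 k + x.1 o0 *m v.2 k) *m x.2 l + x.1 o0 *m x.2 k *m v.2 l) *m x.1 o0
  + x.1 o0 *m x.2 k *m x.2 l *m v.1 o0.

(* In order: p_i has rank 1; p_i p_j = 0 and p_i p_i = p_i; Tr (p_0 q_j) = 1/6;
   q_j has rank 1 and Tr (p_l q_j) = 1/6; the rows of the Hadamard matrix within
   one half are orthogonal; nine of the antisymmetric relations between its
   columns.  When p_i has rank 1, one entry of a product p_i M p_j carries all of
   it. *)
Definition eqf (t : eq_index) x : C :=
  match t with
  | inl (i, k', l') => let k := lift i k' in let l := lift i l' in
      x.1 i k l * x.1 i i i - x.1 i k i * x.1 i i l
  | inr (inl (i, j)) => (x.1 i *m x.1 j) i j - (i == j)%:R * x.1 i i i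
  | inr (inr (inl j)) => 6%:R * Wm x o0 j o0 o0 o0 - x.1 o0 o0 o0
  | inr (inr (inr (inl (j, k, l')))) => let l := lift o0 l' in
      6%:R * (Wm x k j l k l * Wm x l j o0 l o0) - x.1 l l l * Wm x k j o0 k o0
  | inr (inr (inr (inr (inl t)))) =>
      Sm x (row_pair t).1 (row_pair t).2 (row_pair t).1 (row_pair t).2
  | inr (inr (inr (inr (inr t)))) =>
      Vm x (col_pair t).1 (col_pair t).2 o0 o0 - Vm x (col_pair t).2 (col_pair t).1 o0 o0
  end.

Definition eqD (t : eq_index) x v : C :=
  match t with
  | inl (i, k', l') => let k := lift i k' in let l := lift i l' in
      v.1 i k l * x.1 i i i + x.1 i k l * v.1 i i i
      - (v.1 i k i * x.1 i i l + x.1 i k i * v.1 i i l)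
  | inr (inl (i, j)) => (v.1 i *m x.1 j + x.1 i *m v.1 j) i j - (i == j)%:R * v.1 i i i
  | inr (inr (inl j)) => 6%:R * dWm x v o0 j o0 o0 o0 - v.1 o0 o0 o0
  | inr (inr (inr (inl (j, k, l')))) => let l := lift o0 l' in
      6%:R * (dWm x v k j l k l * Wm x l j o0 l o0 + Wm x k j l k l * dWm x v l j o0 l o0)
      - (v.1 l l l * Wm x k j o0 k o0 + x.1 l l l * dWm x v k j o0 k o0)
  | inr (inr (inr (inr (inl t)))) =>
      dSm x v (row_pair t).1 (row_pair t).2 (row_pair t).1 (row_pair t).2
  | inr (inr (inr (inr (inr t)))) =>
      dVm x v (col_pair t).1 (col_pair t).2 o0 o0 - dVm x v (col_pair t).2 (col_pair t).1 o0 o0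
  end.

Lemma dpolyZ f D (c : C) : dpoly f D ->
  dpoly (fun x : cfg => c * f x) (fun x v => c * D x v).
Proof.
move=> fD; apply: (dpoly_ext (dpolyM (dpoly_cst _ c) fD)) => // x v.
by rewrite mul0r add0r.
Qed.

Lemma dpoly_Wm k j l : mdpoly (fun x => Wm x k j l) (fun x v => dWm x v k j l).
Proof.
have H := mdpoly_mul (@mdpoly_p R 6 k) (@mdpoly_q R 6 j).
exact: (mdpoly_mul H (@mdpoly_p R 6 l)).
Qed.

Lemma dpoly_Qm : mdpoly Qm (fun _ => Qm).
Proof. exact: (@mdpoly_sum R 6 6 6 _ predT (fun j x => x.2 j) (fun j _ v => v.2 j) (@mdpoly_q R 6)). Qed.

Lemma dpoly_Sm i j : mdpoly (fun x => Sm x i j) (fun x v => dSm x v i j).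
Proof.
have H := mdpoly_mul (@mdpoly_p R 6 i) dpoly_Qm.
exact: (mdpoly_mul H (@mdpoly_p R 6 j)).
Qed.

Lemma dpoly_Vm k l : mdpoly (fun x => Vm x k l) (fun x v => dVm x v k l).
Proof.
have H := mdpoly_mul (mdpoly_mul (@mdpoly_p R 6 o0) (@mdpoly_q R 6 k)) (@mdpoly_q R 6 l).
exact: (mdpoly_mul H (@mdpoly_p R 6 o0)).
Qed.

Lemma dpoly_eqf t : dpoly (eqf t) (eqD t).
Proof.
case: t => [[[i k] l]|[[i j]|[j|[[[j k] l]|[t|t]]]]] /=.
- by apply: dpolyB; apply: dpolyM; apply: mdpoly_p.
- apply: dpolyB; last by apply: dpolyZ; apply: mdpoly_p.
  exact: (mdpoly_mul (@mdpoly_p R 6 i) (@mdpoly_p R 6 j) i j).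
- by apply: dpolyB; [apply: dpolyZ; apply: dpoly_Wm|apply: mdpoly_p].
- apply: dpolyB; last by apply: dpolyM; [apply: mdpoly_p|apply: dpoly_Wm].
  by apply: dpolyZ; apply: dpolyM; apply: dpoly_Wm.
- exact: dpoly_Sm.
- by apply: dpolyB; apply: dpoly_Vm.
Qed.

(** The quadratic relations all come from P M P = Tr (P M) P for a rank one projector P; the last
    two families use that the q_j sum to 1 and are mutually orthogonal. *)
Lemma Xbar_eqf x : Xbar R 6 x -> forall t, eqf t x = 0.
Proof.
move=> [r1 op oq tpq].
have rp i := (r1 i).1. have rq j := (r1 j).2.
have sw P (M : 'M[C]_6) k l : rank1_projector P -> (P *m M *m P) k l = \tr (P *m M) * P k l.
  by move=> rP; rewrite rank1_sandwich// mxE.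
have six0 : (6%:R : C) != 0 by rewrite pnatr_eq0.
case=> [[[i k] l]|[[i j]|[j|[[[j k] l]|[t|t]]]]] /=.
- have key a b : x.1 i a i * x.1 i i b = x.1 i i i * x.1 i a b.
    rewrite -mul_delta_mulE sw// -[in LHS](mulmx1 (x.1 i *m _)).
    by rewrite -mulmxA mxtrace_mulC mulmx1 mxtrace_delta_mul.
  by rewrite key mulrC subrr.
- case: eqVneq => [->|ij]; last by rewrite op// mxE mul0r subrr.
  by rewrite (rp j).1 mul1r subrr.
- by rewrite /Wm sw// tpq mulrA divff// mul1r subrr.
- set l0 := lift _ _; rewrite /Wm -mul_delta_mulE.
  (* The middle is contracted by p_l E_ll p_l = (p_l)_ll p_l and q_j p_l q_j = q_j / 6. *)
  have -> : x.1 k *m x.2 j *m x.1 l0 *m delta_mx l0 l0 *m (x.1 l0 *m x.2 j *m x.1 o0) =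
      (x.1 l0 l0 l0 / 6%:R) *: (x.1 k *m x.2 j *m x.1 o0).
    have pdp : x.1 l0 *m delta_mx l0 l0 *m x.1 l0 = x.1 l0 l0 l0 *: x.1 l0.
      by rewrite rank1_sandwich// mxtrace_mulC mxtrace_delta_mul.
    have qpq : x.2 j *m x.1 l0 *m x.2 j = 6%:R^-1 *: x.2 j.
      by rewrite rank1_sandwich// mxtrace_mulC tpq.
    transitivity (x.1 k *m (x.2 j *m (x.1 l0 *m delta_mx l0 l0 *m x.1 l0) *m x.2 j) *m x.1 o0).
      by rewrite !mulmxA.
    by rewrite pdp -scalemxAr -scalemxAl qpq scalerA -scalemxAr -scalemxAl.
  by rewrite mxE mulrA (mulrC _ (_ / _)) divfK// subrr.
- rewrite /Sm /Qm projectors_sum// mulmx1 op ?mxE//.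
  case: t => [[b i] i']; rewrite /row_pair /=.
  have ii : i != lift i i' by rewrite neq_lift.
  case: b => /=; first by rewrite (inj_eq (@lshift_inj 3 3)).
  by rewrite (inj_eq (@rshift_inj 3 3)).
- have kl : (col_pair t).1 != (col_pair t).2 by case: t => t; rewrite -(inj_eq val_inj).
  have lk : (col_pair t).2 != (col_pair t).1 by rewrite eq_sym.
  rewrite /Vm -!(mulmxA (x.1 o0) (x.2 _)) (oq _ _ kl) (oq _ _ lk).
  by rewrite mulmx0 mul0mx subrr.
Qed.
End Equations.

(** * The equations imply membership on an open set *)

Section Converse.
Variable R : realType.
Local Notation C := R[i].
Local Notation cfg := (config R 6).
Implicit Types x v : cfg.

Definition Gm (b : bool) x (k l : 'I_6) : C := \sum_(i < 3)
  (x.1 o0 *m x.2 k *m x.1 (block_index b i) *m x.2 l *m x.1 o0) o0 o0.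

(* D_0 times gram_up and - gram_lo of the matrix H below, where D_0 = (p_0)_00 *)
Definition jhat x : 'M[C]_6 :=
  \matrix_(k, l) (36%:R * Gm true x k l - 3%:R * (x.1 o0 o0 o0 * (k == l)%:R)).
Definition jhat' x : 'M[C]_6 :=
  \matrix_(k, l) - (36%:R * Gm false x k l - 3%:R * (x.1 o0 o0 o0 * (k == l)%:R)).

(* On [hpoly L != 0] the linearized even equations have a trivial kernel. *)
Definition hpoly (L : 'M[C]_(#|{: 'I_6 * 'I_6}|, 55)) x : C :=
  \prod_i x.1 i i i * \prod_j \prod_l Wm x l j o0 l o0 *
  \det (L *m coef_mx (x.1 o0 o0 o0 ^+ 2) (jhat x) (jhat' x)).

Lemma mul_delta2E m n (U : 'M[C]_(m, n)) (Q : 'M[C]_n) (V : 'M[C]_(n, m)) a b k l :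
  (U *m delta_mx k k *m Q *m delta_mx l l *m V) a b = U a k * Q k l * V l b.
Proof. by rewrite !mul_delta_mulE. Qed.

Lemma block_indexP (i : 'I_6) : exists i', i = block_index (i < 3)%N i'.
Proof.
by elim/ord6_ind: i; [exists (@Ordinal 3 0 isT)|exists (@Ordinal 3 1 isT)
  |exists (@Ordinal 3 2 isT)|exists (@Ordinal 3 0 isT)|exists (@Ordinal 3 1 isT)
  |exists (@Ordinal 3 2 isT)]; apply: val_inj.
Qed.

Lemma col_pairP (k l : 'I_6) : (k < 2)%N -> (k < l)%N ->
  exists t, k = (col_pair t).1 /\ l = (col_pair t).2.
Proof.
case: l => -[|l] l6; first by rewrite ltn0.
case: k => -[|[|k]] k6 //= _.
  by move=> _; exists (inl (Ordinal (l6 : l < 5)%N)); split; apply: val_inj.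
case: l l6 => [|l] l6 // _.
by exists (inr (Ordinal (l6 : l < 4)%N)); split; apply: val_inj.
Qed.

(** In the frame of the p_i, the projector q_j has a matrix Q_j. The trace equations and the fourth
    family force (Q_j)_kl = H_kj / (6 H_lj), the last 21 equations and the trivial kernel make H
    Hadamard, and H then diagonalises the q_j. *)
Lemma Xbar_of_eqf L x : hpoly L x != 0 -> (forall t, eqf t x = 0) -> Xbar R 6 x.
Proof.
rewrite !mulf_eq0 !negb_or => /andP[/andP[/prodf_neq0/= D0 /prodf_neq0/= W0] ker] eq0.
have six0 : (6%:R : C) != 0 by rewrite pnatr_eq0.
have {}D0 i : x.1 i i i != 0 by exact: D0.
have {}W0 j l : Wm x l j o0 l o0 != 0.
  by have /prodf_neq0/= := W0 j isT; exact.
(* Column i of p_i and its normalised row i: the minors through the entry (i, i) say that p_i is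
   their product. *)
pose U : 'M[C]_6 := \matrix_(k, i) x.1 i k i.
pose V : 'M[C]_6 := \matrix_(i, l) (x.1 i i l / x.1 i i i).
have pE i : x.1 i = U *m delta_mx i i *m V.
  apply/matrixP => k l; rewrite mul_delta_mulE !mxE.
  have [->|ki] := eqVneq i k; first by rewrite mulrCA divff// mulr1.
  have [->|li] := eqVneq i l; first by rewrite divff// mulr1.
  have [k' k'E _] := unlift_some ki; have [l' l'E _] := unlift_some li.
  have := eq0 (inl (i, k', l')); rewrite /= -k'E -l'E => /eqP; rewrite subr_eq0 => /eqP e.
  by rewrite mulrA -e mulfK.
have VU : V *m U = 1%:M.
  apply/matrixP => i j; apply: (mulfI (D0 i)).
  have := eq0 (inr (inl (i, j))) => /= /eqP; rewrite subr_eq0 => /eqP e.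
  rewrite [X in _ = _ * X]mxE [RHS]mulrC -e !mxE mulr_sumr; apply: eq_bigr => m _; rewrite !mxE.
  by rewrite mulrA mulrCA divff// mulr1.
have [rp op] := frame_projectors VU.
have UV := mulmx1C VU.
have Vkk k : V k k = 1 by rewrite mxE divff.
have Ukk k : U k k = x.1 k k k by rewrite mxE.
clearbody U V.
have [Q qE] : exists Q : 'I_6 -> 'M[C]_6, forall j, x.2 j = U *m Q j *m V.
  exists (fun j => V *m x.2 j *m U) => j.
  by rewrite !mulmxA UV mul1mx -mulmxA UV mulmx1.
have UMV (M N : 'M[C]_6) : U *m M *m V *m (U *m N *m V) = U *m (M *m N) *m V.
  by rewrite !mulmxA -(mulmxA (U *m M)) VU mulmx1.
have pqp k j l : x.1 k *m x.2 j *m x.1 l = U *m delta_mx k k *m Q j *m delta_mx l l *m V.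
  by rewrite !pE qE !UMV !mulmxA.
have WE k j l a b : Wm x k j l a b = U a k * Q j k l * V l b.
  by rewrite /Wm pqp mul_delta2E.
have Q00 j : Q j o0 o0 = 6%:R^-1.
  have := eq0 (inr (inr (inl j))) => /= /eqP; rewrite subr_eq0 WE Vkk Ukk mulr1 => /eqP e.
  apply: (mulfI six0); rewrite mulfV//; apply: (mulfI (D0 o0)).
  by rewrite mulr1 -[RHS]e mulrCA.
have Q0 j l : Q j l o0 != 0.
  by apply: contra_neq (W0 j l) => e; rewrite WE e mulr0 mul0r.
pose H i k := 6%:R * Q k i o0.
have H0 i k : H i k != 0 by rewrite mulf_neq0.
have H0k k : H o0 k = 1 by rewrite /H Q00 mulfV.
have QE j k l : Q j k l = H k j / (6%:R * H l j).
  apply: (mulIf (mulf_neq0 six0 (H0 l j))); rewrite divfK ?mulf_neq0//.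
  rewrite /H; have [<-|l0] := eqVneq o0 l; first by rewrite Q00 mulfV// mulr1 mulrC.
  have [l' l'E _] := unlift_some l0.
  have := eq0 (inr (inr (inr (inl (j, k, l'))))) => /= /eqP; rewrite -l'E.
  rewrite subr_eq0 !WE !Vkk !Ukk !mulr1 => /eqP e.
  apply: (mulfI (mulf_neq0 (D0 l) (D0 k))).
  transitivity (6%:R * (6%:R * (x.1 k k k * Q j k l * (x.1 l l l * Q j l o0)))); first by ring.
  by rewrite e; ring.
clearbody H.
have SmE i j : Sm x i j i j = x.1 i i i * \sum_k Q k i j.
  rewrite /Sm /Qm mulmx_sumr mulmx_suml summxE mulr_sumr; apply: eq_bigr => k _.
  by rewrite WE Ukk Vkk mulr1.
have VmE k l : Vm x k l o0 o0 = x.1 o0 o0 o0 * (36%:R^-1 * \sum_i H i l / H i k).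
  have -> : Vm x k l = U *m delta_mx o0 o0 *m (Q k *m Q l) *m delta_mx o0 o0 *m V.
    by rewrite /Vm !pE !qE !UMV !mulmxA.
  rewrite mul_delta2E Ukk Vkk mulr1 mxE; congr (_ * _); rewrite mulr_sumr.
  by apply: eq_bigr => i _; rewrite !QE !H0k; field; rewrite H0.
have block_orth (i j : 'I_6) : i != j -> (i < 3)%N = (j < 3)%N -> \sum_k H i k / H j k = 0.
  move=> ij ij3; have [i' iE] := block_indexP i; have [j' jE] := block_indexP j.
  rewrite -ij3 in jE; have ij' : i' != j'.
    by apply: contra_neq ij => e; rewrite iE jE e.
  have [l' l'E _] := unlift_some ij'.
  have := eq0 (inr (inr (inr (inr (inl ((i < 3)%N, i', l')))))) => /=.
  rewrite /row_pair /= -l'E -iE -jE SmE => /eqP; rewrite mulf_eq0 (negbTE (D0 i)) /= => /eqP e.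
  transitivity (6%:R * \sum_k Q k i j); last by rewrite e mulr0.
  rewrite mulr_sumr; apply: eq_bigr => k _.
  by rewrite QE; field; rewrite H0.
have col_sym (k l : 'I_6) : (k < 2)%N -> (k < l)%N ->
    \sum_i H i l / H i k = \sum_i H i k / H i l.
  move=> k2 kl; have [t [-> ->]] := col_pairP k2 kl.
  have := eq0 (inr (inr (inr (inr (inr t))))) => /= /eqP; rewrite subr_eq0 !VmE.
  move=> /eqP/(mulfI (D0 o0))/(mulfI _); apply; rewrite ?invr_eq0 ?pnatr_eq0//.
have GE b k l : 36%:R * Gm b x k l = x.1 o0 o0 o0 *
    \sum_(i < 3) H (block_index b i) l / H (block_index b i) k.
  rewrite /Gm !mulr_sumr; apply: eq_bigr => i _; set i' := block_index b i.
  have -> : x.1 o0 *m x.2 k *m x.1 i' *m x.2 l *m x.1 o0 =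
      U *m delta_mx o0 o0 *m (Q k *m delta_mx i' i' *m Q l) *m delta_mx o0 o0 *m V.
    by rewrite !pE !qE !UMV !mulmxA.
  by rewrite mul_delta2E Ukk Vkk mulr1 mul_delta_mulE !QE !H0k; field; rewrite H0.
have colo : forall k l, k != l -> \sum_i H i l / H i k = 0.
  (* The denominator is (p_0)_00, because the polynomial [Gm] contains this factor. *)
  apply: (columns_orthogonal H0 block_orth col_sym (D0 o0)).
  have -> : x.1 o0 o0 o0 *: gram_up H = jhat x.
    apply/matrixP => k l; rewrite !mxE GE; set s := \sum_(i < 3) _.
    by rewrite -mulr_natr; ring.
  have -> : x.1 o0 o0 o0 *: - gram_lo H = jhat' x.
    apply/matrixP => k l; rewrite !mxE GE; set s := \sum_(i < 3) _.
    by rewrite -mulr_natr; ring.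
  move=> y /(minor_kernel ker); exact: vec36_eq0.
pose K : 'M[C]_6 := \matrix_(i, k) H i k.
pose K' : 'M[C]_6 := \matrix_(k, i) (6%:R * H i k)^-1.
have K'K : K' *m K = 1%:M.
  apply/matrixP => k l; rewrite !mxE.
  transitivity (6%:R^-1 * \sum_i H i l / H i k).
    by rewrite mulr_sumr; apply: eq_bigr => i _; rewrite !mxE; field; rewrite H0.
  case: eqVneq => [->|kl]; last by rewrite colo ?mulr0.
  under eq_bigr do rewrite divff//.
  by rewrite sumr_const card_ord mulVf.
have qK j : x.2 j = (U *m K) *m delta_mx j j *m (K' *m V).
  rewrite qE; have -> : Q j = K *m delta_mx j j *m K'.
    by apply/matrixP => k l; rewrite QE mul_delta_mulE [K _ _]mxE [K' _ _]mxE.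
  by rewrite !mulmxA.
have VK : K' *m V *m (U *m K) = 1%:M.
  by rewrite mulmxA -(mulmxA K') VU mulmx1.
have [rq oq] := frame_projectors VK.
split.
- by move=> i; split; rewrite ?pE ?qK.
- by move=> i j ij; rewrite !pE op.
- by move=> i j ij; rewrite !qK oq.
- move=> i j; rewrite pE qE UMV mxtrace_mulC (mulmxA V U) VU mul1mx mxtrace_delta_mul QE.
  by field; rewrite H0.
Qed.
End Converse.

(** With as many forms as unknowns, a trivial common kernel amounts to linear independence of the
    forms. *)
Lemma square_kernel (F : fieldType) (T : finType) (m n : nat)
    (f : T -> 'M[F]_(m, n) -> F) :
  (forall t a u v, f t (a *: u + v) = a * f t u + f t v) -> #|T| = (m * n)%N ->
  (forall u, (forall t, f t u = 0) -> u = 0) ->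
  forall c : T -> F, (forall u, \sum_t c t * f t u = 0) -> forall t, c t = 0.
Proof.
move=> flin cT f0 c c0.
have f00 t : f t 0 = 0.
  by have := flin t 1 0 0; rewrite scaler0 addr0 mul1r => /eqP; rewrite -subr_eq subrr => /eqP.
have fsum t u : f t (vec_mx u) = \sum_i u 0 i * f t (vec_mx (delta_mx 0 i)).
  rewrite [u in LHS]row_sum_delta linear_sum /=.
  elim: index_enum => [|i s IH]; first by rewrite !big_nil.
  by rewrite !big_cons linearZ flin IH.
pose M : 'M[F]_(m * n, #|T|) := \matrix_(i, t) f (enum_val t) (vec_mx (delta_mx 0 i)).
have uM u : u *m M = \row_t f (enum_val t) (vec_mx u).
  by apply/rowP => t; rewrite !mxE fsum; apply: eq_bigr => i _; rewrite mxE.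
have : row_free M.
  rewrite -kermx_eq0; apply/rowV0P => u /sub_kermxP; rewrite uM => /rowP u0.
  rewrite -[u]vec_mxK (f0 (vec_mx u)) ?linear0// => t.
  by have := u0 (enum_rank t); rewrite !mxE enum_rankK.
rewrite /row_free -[X in _ == X]cT => Mfull.
pose cv : 'cV[F]_#|T| := \col_t c (enum_val t).
have Mc : M *m cv = 0.
  apply/colP => i; rewrite !mxE -[RHS](c0 (vec_mx (delta_mx 0 i))).
  rewrite [RHS](reindex (@enum_val T predT)) /=; last first.
    by exists enum_rank => t _; [exact: enum_valK|exact: enum_rankK].
  by apply: eq_bigr => t _; rewrite !mxE mulrC.
have [B BM] := row_fullP Mfull.
move=> t; have : cv = 0 by rewrite -[cv]mul1mx -BM -mulmxA Mc mulmx0.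
by move=> /colP/(_ (enum_rank t)); rewrite !mxE enum_rankK.
Qed.

Section HPoly.
Variable R : realType.
Local Notation C := R[i].
Local Notation cfg := (config R 6).

Lemma polyfun_Gm b k l : polyfun (fun x : cfg => Gm b x k l).
Proof.
apply: polyfun_sum => i; set i' := block_index b i.
have H := mdpoly_mul (mdpoly_mul (mdpoly_mul (mdpoly_mul (@mdpoly_p R 6 o0)
  (@mdpoly_q R 6 k)) (@mdpoly_p R 6 i')) (@mdpoly_q R 6 l)) (@mdpoly_p R 6 o0).
by eexists; exact: H.
Qed.

Lemma polyfun_p (i a b : 'I_6) : polyfun (fun x : cfg => x.1 i a b).
Proof. by eexists; exact: mdpoly_p. Qed.

Lemma polyfun_ext (f g : cfg -> C) : polyfun f -> f =1 g -> polyfun g.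
Proof. by move=> [D fD] fg; exists D; exact: (dpoly_ext fD fg). Qed.

(** Another instance of [forms], over functions of the configuration: the relation records both the
    value at a point and polynomiality. *)
Lemma polyfun_coef_mx t u : polyfun (fun x : cfg =>
  coef_mx (x.1 o0 o0 o0 ^+ 2) (jhat x) (jhat' x) t u).
Proof.
have pj k l : polyfun (fun x : cfg => jhat x k l).
  apply: (@polyfun_ext (fun x => 36%:R * Gm true x k l +
      - (3%:R * (x.1 o0 o0 o0 * (k == l)%:R)))); last by move=> x; rewrite mxE.
  apply: polyfunD; first by apply: polyfunM; [exact: polyfun_cst|exact: polyfun_Gm].
  apply: polyfunN; apply: polyfunM; first exact: polyfun_cst.
  by apply: polyfunM; [exact: polyfun_p|exact: polyfun_cst].
have pj' k l : polyfun (fun x : cfg => jhat' x k l).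
  apply: (@polyfun_ext (fun x => - (36%:R * Gm false x k l +
      - (3%:R * (x.1 o0 o0 o0 * (k == l)%:R))))); last by move=> x; rewrite mxE.
  apply: polyfunN; apply: polyfunD; first by apply: polyfunM; [exact: polyfun_cst|exact: polyfun_Gm].
  apply: polyfunN; apply: polyfunM; first exact: polyfun_cst.
  by apply: polyfunM; [exact: polyfun_p|exact: polyfun_cst].
pose M := cfg -> 'I_6 -> 'I_6 -> C.
pose fs : seq M := forms (fun (f g : cfg -> C) x => f x + g x) (fun f g x => f x * g x)
  (fun (u v : M) x a b => u x a b + v x a b) (fun u x a b => - u x a b)
  (fun c u x a b => c x * u x a b) (fun _ _ _ => 0) (fun x : cfg => x.1 o0 o0 o0 ^+ 2)
  (fun k l (x : cfg) => jhat x k l) (fun k l (x : cfg) => jhat' x k l)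
  (fun k l _ a b => ((a == k) && (b == l))%:R).
have fsE (x : cfg) : List.Forall2 (fun (F : M) (m : 'I_6 -> 'I_6 -> C) => F x = m /\
      forall a b, polyfun (fun y => F y a b))
    fs (coefs (x.1 o0 o0 o0 ^+ 2) (jhat x) (jhat' x)).
  apply: (@forms_rel _ _ _ _ _ _ _ _ _ _ _ _ _ _ _ _
    (fun (f : cfg -> C) s => f x = s /\ polyfun f)) => //.
  - by move=> f _ g _ [<- pf] [<- pg]; split=> //; exact: polyfunD.
  - by move=> f _ g _ [<- pf] [<- pg]; split=> //; exact: polyfunM.
  - by move=> f _ g _ [<- pf] [<- pg]; split=> // a b; apply: polyfunD.
  - by move=> f _ [<- pf]; split=> // a b; apply: polyfunN.
  - by move=> f _ g _ [<- pf] [<- pg]; split=> // a b; apply: polyfunM.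
  - by split=> // a b; exact: polyfun_cst.
  - split=> //; apply: polyfunM; exact: polyfun_p.
  - by split=> // a b; exact: polyfun_cst.
have t55 : (t < size fs)%N by exact: (ltn_ord t).
have [_ pt] := Forall2_nth (fun _ _ _ => 0) (fun _ _ => 0) (fsE 0) t55.
apply: (polyfun_ext (pt (enum_val u).1 (enum_val u).2)) => x.
have [xt _] := Forall2_nth (fun _ _ _ => 0) (fun _ _ => 0) (fsE x) t55.
by rewrite xt mxE.
Qed.

Lemma polyfun_hpoly L : polyfun (@hpoly R L).
Proof.
apply: polyfunM; last first.
  apply: polyfun_det => i j.
  apply: (@polyfun_ext (fun x => \sum_k L i k * coef_mx (x.1 o0 o0 o0 ^+ 2) (jhat x) (jhat' x) k j)).
    by apply: polyfun_sum => k; apply: polyfunM; [exact: polyfun_cst|exact: polyfun_coef_mx].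
  by move=> x; rewrite mxE.
apply: polyfunM; first by apply: polyfun_prod => i; exact: polyfun_p.
apply: polyfun_prod => j; apply: polyfun_prod => l.
by eexists; exact: dpoly_Wm.
Qed.
End HPoly.

Lemma sum_sumType (V : nmodType) (A B : finType) (F : A + B -> V) :
  \sum_t F t = \sum_a F (inl a) + \sum_b F (inr b).
Proof. exact: big_sumType. Qed.

(** * Independence of the differentials at a Hadamard matrix *)

Section Smooth.
Variable R : realType.
Local Notation C := R[i].
Local Notation cfg := (config R 6).
Variable h : 'I_6 -> 'I_6 -> C.

Definition hcfg : cfg :=
  (fun i => delta_mx i i, fun j => \matrix_(k, l) (h k j / (6%:R * h l j))).

Hypothesis h_neq0 : forall i k, h i k != 0.
Hypothesis h_row : forall k, h o0 k = 1.
Hypothesis h_orth : forall k l, k != l -> \sum_i h i l / h i k = 0.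

Let six0 : (6%:R : C) != 0. Proof. by rewrite pnatr_eq0. Qed.

Lemma Xbar_hcfg : Xbar R 6 hcfg.
Proof.
have VU : (1%:M : 'M[C]_6) *m 1%:M = 1%:M by rewrite mulmx1.
have [rp op] := frame_projectors VU.
have pE i : delta_mx i i = 1%:M *m delta_mx i i *m 1%:M :> 'M[C]_6 by rewrite mul1mx mulmx1.
pose K : 'M[C]_6 := \matrix_(i, k) h i k.
pose K' : 'M[C]_6 := \matrix_(k, i) (6%:R * h i k)^-1.
have K'K : K' *m K = 1%:M.
  apply/matrixP => k l; rewrite !mxE.
  transitivity (6%:R^-1 * \sum_i h i l / h i k).
    by rewrite mulr_sumr; apply: eq_bigr => i _; rewrite !mxE; field; rewrite h_neq0.
  case: eqVneq => [->|kl]; last by rewrite h_orth ?mulr0.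
  under eq_bigr do rewrite divff//.
  by rewrite sumr_const card_ord mulVf.
have [rq oq] := frame_projectors K'K.
have qE j : hcfg.2 j = K *m delta_mx j j *m K'.
  by apply/matrixP => k l; rewrite mul_delta_mulE !mxE.
split.
- by move=> i; split; rewrite ?qE// /= pE.
- by move=> i j ij; rewrite /= (pE i) (pE j) op.
- by move=> i j ij; rewrite !qE oq.
- by move=> i j; rewrite mxtrace_delta_mul mxE; field; rewrite h_neq0.
Qed.

Definition dq_of (M : 'I_6 -> 'M[C]_6) : cfg := (fun _ => 0, M).

Lemma eqD_dq t M : eqD t hcfg (dq_of M) =
  match t with
  | inl _ | inr (inl _) => 0
  | inr (inr (inl j)) => 6%:R * M j o0 o0
  | inr (inr (inr (inl (j, k, l')))) => let l := lift o0 l' in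
      6%:R * (M j k l * hcfg.2 j l o0 + hcfg.2 j k l * M j l o0) - M j k o0
  | inr (inr (inr (inr (inl t)))) => \sum_k M k (row_pair t).1 (row_pair t).2
  | inr (inr (inr (inr (inr t)))) => let k := (col_pair t).1 in let l := (col_pair t).2 in
      (M k *m hcfg.2 l + hcfg.2 k *m M l) o0 o0 - (M l *m hcfg.2 k + hcfg.2 l *m M k) o0 o0
  end.
Proof.
have dWE j k l : dWm hcfg (dq_of M) k j l k l = M j k l.
  by rewrite /dWm mul0mx mulmx0 add0r addr0 mul_deltaE delta_mulE.
have WE j k l : Wm hcfg k j l k l = hcfg.2 j k l.
  by rewrite /Wm mul_deltaE delta_mulE.
have dVE k l : dVm hcfg (dq_of M) k l o0 o0 = (M k *m hcfg.2 l + hcfg.2 k *m M l) o0 o0.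
  rewrite /dVm !mul0mx mulmx0 add0r addr0 -[X in _ + X]mulmxA -[X in X + _]mulmxA.
  by rewrite -mulmxDr mul_deltaE delta_mulE.
case: t => [[[i k] l]|[[i j]|[j|[[[j k] l]|[t|t]]]]] /=.
- by rewrite !mxE; ring.
- by rewrite mul0mx mulmx0 !mxE; ring.
- by rewrite dWE mxE subr0.
- have z a b : (0 : 'M[C]_6) a b = 0 by rewrite mxE.
  have e a : (delta_mx a a : 'M[C]_6) a a = 1 by rewrite mxE !eqxx.
  move: (Wm hcfg) (dWm hcfg (dq_of M)) WE dWE => W dW WE dWE.
  by rewrite !dWE !WE z e mul0r add0r mul1r.
- rewrite /dSm mul0mx mulmx0 add0r addr0 mul_deltaE delta_mulE /Qm /=.
  by rewrite summxE.
- by move: (dVm hcfg (dq_of M)) dVE => dV dVE; rewrite !dVE.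
Qed.

(** To first order, the equations other than the minors see p_i only through its row i and its
    column i. *)
Lemma eqD_dp_off (v : cfg) t : v.2 = (fun _ => 0) -> (forall i k, v.1 i i k = 0 /\ v.1 i k i = 0) ->
  eqD t hcfg v = if t is inl (i, k', l') then v.1 i (lift i k') (lift i l') else 0.
Proof.
move=> v2 v1.
have Dl i j (M : 'M[C]_6) : (v.1 i *m M *m hcfg.1 j) i j = 0.
  by rewrite mul_deltaE mxE big1// => m _; rewrite (v1 i m).1 mul0r.
have Dr i j (M : 'M[C]_6) : (hcfg.1 i *m M *m v.1 j) i j = 0.
  by rewrite -mulmxA delta_mulE mxE big1// => m _; rewrite (v1 j m).2 mulr0.
have dW j k l : dWm hcfg v k j l k l = 0.
  by rewrite /dWm v2 mulmx0 addr0 mxE Dl Dr addr0.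
have dV k l : dVm hcfg v k l o0 o0 = 0.
  rewrite /dVm v2 !mulmx0 !addr0 mxE -(mulmxA (v.1 o0)) Dl.
  by rewrite -(mulmxA (hcfg.1 o0)) Dr addr0.
case: t => [[[i k] l]|[[i j]|[j|[[[j k] l]|[t|t]]]]] /=.
- rewrite (v1 i i).1 (v1 i (lift i k)).2 (v1 i (lift i l)).1 !mxE !eqxx.
  by rewrite !mulr0 mul0r mulr1 !addr0 subr0.
- rewrite (v1 i _).1 mulr0 subr0 mxE mul_deltaE.
  by rewrite (v1 i j).1 delta_mulE (v1 j i).2 addr0.
- by rewrite dW (v1 _ _).1 mulr0 subr0.
- by move: (Wm hcfg) (dWm hcfg v) dW => W dWv dW; rewrite !dW (v1 _ _).1 !mulr0 !mul0r !addr0 mulr0 subr0.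
- rewrite /dSm; have -> : Qm v = 0 by rewrite /Qm v2 big1.
  by rewrite mulmx0 addr0 mxE Dl Dr addr0.
- by move: (dVm hcfg v) dV => dVv dV; rewrite !dV subr0.
Qed.

Lemma eqD_dp i j i' j' :
  eqD (inr (inl (i', j'))) hcfg (fun a => (a == i)%:R *: delta_mx i j, fun _ => 0) =
  ((i' == i) && (j' == j))%:R.
Proof.
rewrite /= mxE mul_deltaE delta_mulE !mxE.
have [->|ii] := eqVneq i' i; last by rewrite !(mul0r, mulr0) addr0 subr0.
case: (eqVneq j' j) => [e'|jj]; case: (eqVneq i j) => [e|ij];
  rewrite ?e' ?e; rewrite ?(eqxx, mul1r, mulr0, mul0r, subr0, addr0, addrK)//.
- by rewrite eq_sym (negbTE ij) mul0r addr0.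
- by rewrite [j == _]eq_sym (negbTE jj) mul0r subr0.
Qed.

Definition ext (th : 'M[C]_5) : 'M[C]_6 := \matrix_(i, k)
  if unlift o0 i is Some i' then if unlift o0 k is Some k' then th i' k' else 0 else 0.

Lemma ext_linear a u v i k : ext (a *: u + v) i k = a * ext u i k + ext v i k.
Proof.
rewrite !mxE; case: unlift => [i'|]; last by rewrite mulr0 addr0.
by case: unlift => [k'|]; rewrite ?mxE// mulr0 addr0.
Qed.

Lemma ext0 th i k : i = o0 \/ k = o0 -> ext th i k = 0.
Proof.
have e : o0 = ord0 by apply: val_inj.
rewrite mxE => -[->|->]; first by rewrite unlift_none.
by case: unlift => // i'; rewrite unlift_none.
Qed.

Lemma ext_eq0 th : ext th = 0 -> th = 0.
Proof.
move=> /matrixP e; apply/matrixP => i k.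
by have := e (lift o0 i) (lift o0 k); rewrite !mxE !liftK.
Qed.

Definition param (s : 'I_4) : 'I_6 * 'I_6 :=
  nth (o0, o0) [:: (o1, o1); (o1, o2); (o1, o3); (o2, o1)] s.

Lemma row_pairP (i j : 'I_6) : i != j -> (i < 3)%N = (j < 3)%N ->
  exists t, i = (row_pair t).1 /\ j = (row_pair t).2.
Proof.
move=> ij ij3; have [i' iE] := block_indexP i; have [j' jE] := block_indexP j.
rewrite -ij3 in jE; have ij' : i' != j' by apply: contra_neq ij => e; rewrite iE jE e.
have [l' l'E _] := unlift_some ij'.
by exists ((i < 3)%N, i', l'); rewrite /row_pair /= -l'E -iE -jE.
Qed.

(** A linear relation [c] between the differentials is eliminated family by family, in an order for
    which some tangent vector isolates each equation among those that remain. *)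
Lemma smooth_hcfg L :
  (forall th : 'M[C]_6, (forall i k, i = o0 \/ k = o0 -> th i k = 0) ->
    (forall i j : 'I_6, i != j -> (i < 3)%N = (j < 3)%N ->
       \sum_k h i k / h j k * (th i k - th j k) = 0) ->
    (forall k l : 'I_6, (k < 2)%N -> (k < l)%N ->
       \sum_i (h i l / h i k + h i k / h i l) * (th i l - th i k) = 0) ->
    th o1 o1 = 0 -> th o1 o2 = 0 -> th o1 o3 = 0 -> th o2 o1 = 0 -> th = 0) ->
  hpoly L hcfg != 0 -> Xsm R 6 hcfg.
Proof.
move=> ker hL; split; first exact: Xbar_hcfg.
apply: (smooth_point_criterion (@dpoly_eqf R) (polyfun_hpoly L) Xbar_hcfg hL).
  by move=> y hy; split; [exact: Xbar_eqf|exact: Xbar_of_eqf hy].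
move=> c c0.
have single t v : (forall t', t' != t -> c t' * eqD t' hcfg v = 0) -> eqD t hcfg v != 0 -> c t = 0.
  move=> z nz; have := c0 v; rewrite (bigD1 t)//= big1 ?addr0 => [/eqP|t' tt']; last exact: z.
  by rewrite mulf_eq0 (negbTE nz) orbF => /eqP.
have c1 i k l : c (inl (i, k, l)) = 0.
  pose v : cfg := (fun a => (a == i)%:R *: delta_mx (lift i k) (lift i l), fun _ => 0).
  have vE := @eqD_dp_off v _ erefl.
  have v0 i' k' : v.1 i' i' k' = 0 /\ v.1 i' k' i' = 0.
    rewrite /v /= !mxE; have [->|] := eqVneq i' i; last by rewrite !mul0r.
    by rewrite !(negbTE (neq_lift _ _)) /= andbF !mulr0.
  have vt t : eqD t hcfg v = (t == inl (i, k, l))%:R.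
    rewrite vE//; case: t => [[[i' k'] l']|//]; rewrite !mxE.
    rewrite (inj_eq inl_inj) !xpair_eqE.
    case: eqVneq => [->|] /=; last by rewrite mul0r.
    by rewrite !(inj_eq lift_inj) mul1r.
  apply: (single _ v) => [t tt|]; last by rewrite vt eqxx oner_eq0.
  by rewrite vt (negbTE tt) mulr0.
have qE j k l : hcfg.2 j k l = h k j / (6%:R * h l j) by rewrite mxE.
(* The p_i are fixed and h varies by h theta, with theta zero on the border. All other families
   vanish on these vectors, and the 12 + 9 forms in 25 unknowns become a square system when the four
   parameters are added. *)
have c2 : (forall t, c (inr (inr (inr (inr t)))) = 0).
  pose T : finType := ((bool * 'I_3 * 'I_2 + ('I_5 + 'I_4)) + 'I_4)%type.
  pose f (t : T) (th : 'M[C]_5) : C := match t with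
    | inl (inl t) => let i := (row_pair t).1 in let j := (row_pair t).2 in
        \sum_k h i k / h j k * (ext th i k - ext th j k)
    | inl (inr t) => let k := (col_pair t).1 in let l := (col_pair t).2 in
        \sum_i (h i l / h i k + h i k / h i l) * (ext th i l - ext th i k)
    | inr s => ext th (param s).1 (param s).2
    end.
  have flin t a u v : f t (a *: u + v) = a * f t u + f t v.
    case: t => [[t|t]|s] /=; last by rewrite ext_linear.
      rewrite mulr_sumr -big_split; apply: eq_bigr => k _.
      by rewrite !ext_linear /=; ring.
    rewrite mulr_sumr -big_split; apply: eq_bigr => k _.
    by rewrite !ext_linear /=; ring.
  have cT : #|T| = (5 * 5)%N.
    by rewrite !card_sum !card_prod card_bool !card_ord.
  have f0 u : (forall t, f t u = 0) -> u = 0.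
    move=> fu; apply: ext_eq0; apply: ker.
    - exact: ext0.
    - by move=> i j ij ij3; have [t [-> ->]] := row_pairP ij ij3; exact: (fu (inl (inl t))).
    - by move=> k l k2 kl; have [t [-> ->]] := col_pairP k2 kl; exact: (fu (inl (inr t))).
    - exact: (fu (inr (@Ordinal 4 0 isT))).
    - exact: (fu (inr (@Ordinal 4 1 isT))).
    - exact: (fu (inr (@Ordinal 4 2 isT))).
    - exact: (fu (inr (@Ordinal 4 3 isT))).
  (* The parameters get the coefficient 0; 6 and 36 are the denominators in the differentials of
     [Sm] and [Vm]. *)
  pose c' (t : T) : C := match t with
    | inl (inl t) => c (inr (inr (inr (inr (inl t))))) / 6%:R
    | inl (inr t) => c (inr (inr (inr (inr (inr t))))) / 36%:R
    | inr _ => 0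
    end.
  have c'0 : forall t, c' t = 0.
    apply: (square_kernel flin cT f0) => th.
    pose M j : 'M[C]_6 := \matrix_(k, l) ((ext th k j - ext th l j) * hcfg.2 j k l).
    have ME j k l : M j k l = (ext th k j - ext th l j) * hcfg.2 j k l by rewrite [LHS]mxE.
    have := c0 (dq_of M).
    rewrite [X in X = _ -> _]sum_sumType [X in X + _]big1 ?add0r => [|t _]; last first.
      by rewrite eqD_dq mulr0.
    rewrite [X in X = _ -> _]sum_sumType [X in X + _]big1 ?add0r => [|t _]; last first.
      by rewrite eqD_dq mulr0.
    rewrite [X in X = _ -> _]sum_sumType [X in X + _]big1 ?add0r => [|j _]; last first.
      by rewrite eqD_dq mxE subrr mul0r !mulr0.
    rewrite [X in X = _ -> _]sum_sumType [X in X + _]big1 ?add0r => [|[[j k] l] _]; last first.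
      rewrite eqD_dq /= !ME !qE !h_row (@ext0 th o0 j); last by left.
      by field; rewrite !h_neq0.
    move=> e; apply: etrans e; rewrite [LHS]sum_sumType [X in _ + X]big1 ?addr0; last by move=> s _; rewrite mul0r.
    rewrite [LHS]sum_sumType [RHS]sum_sumType; congr (_ + _); apply: eq_bigr => t _; rewrite eqD_dq.
      rewrite /= !mulr_sumr; apply: eq_bigr => k _; rewrite !ME !qE.
      by field; rewrite !h_neq0.
    rewrite /= -mulrA; congr (_ * _).
    set k := (col_pair t).1; set l := (col_pair t).2.
    rewrite !mxE -!big_split -sumrB mulr_sumr; apply: eq_bigr => i _ /=.
    rewrite !ME !qE !h_row !(@ext0 th o0 _); [|by left..].
    by field; rewrite !h_neq0.
  move=> t; case: t => t.
    have /eqP := c'0 (inl (inl t)).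
    by rewrite mulf_eq0 invr_eq0 pnatr_eq0 orbF => /eqP.
  have /eqP := c'0 (inl (inr t)).
  by rewrite mulf_eq0 invr_eq0 pnatr_eq0 orbF => /eqP.
have q0 j k : hcfg.2 j k o0 != 0.
  by rewrite qE h_row mulr1 mulf_neq0 ?invr_eq0.
pose E (j k l : 'I_6) := dq_of (fun j' => (j' == j)%:R *: delta_mx k l).
have EvE j k l a b d : (E j k l).2 a b d = [&& a == j, b == k & d == l]%:R.
  by rewrite !mxE -natrM mulnb.
(* Among the equations still present, the entry (k, l) of q_j with l nonzero occurs to first order
   in only one. *)
have c3 j k l' : c (inr (inr (inr (inl (j, k, l'))))) = 0.
  have vE := EvE j k (lift o0 l'); pose v := E j k (lift o0 l').
  apply: (single _ v) => [t tt|]; rewrite eqD_dq.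
    case: t tt => [t|[t|[j1|[[[j1 k1] l1]|t]]]] tt /=; rewrite ?mulr0 ?c2 ?mul0r//.
      by rewrite vE (negbTE (neq_lift _ _)) !andbF !mulr0.
    rewrite !vE (negbTE (neq_lift _ _)) !andbF (inj_eq lift_inj).
    suff -> : [&& j1 == j, k1 == k & l1 == l'] = false by rewrite mul0r mulr0 addr0 mulr0 subr0 mulr0.
    apply: contra_neqF tt => /and3P[/eqP-> /eqP-> /eqP->//].
  rewrite /= !vE (negbTE (neq_lift _ _)) !andbF !eqxx mulr0 addr0 subr0 mul1r.
  by rewrite mulf_neq0//; exact: q0.
have c4 j : c (inr (inr (inl j))) = 0.
  pose v := E j o0 o0.
  apply: (single _ v) => [t tt|]; rewrite eqD_dq.
    case: t tt => [t|[t|[j1 tt|[[[j1 k1] l1]|t]]]] /=; rewrite ?mulr0 ?c2 ?c3 ?mul0r//.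
    suff -> : (j1 == j) = false by rewrite scale0r mxE !mulr0.
    by apply: contra_neqF tt => /eqP->.
  by rewrite eqxx scale1r mxE mulr1.
have c5 i j : c (inr (inl (i, j))) = 0.
  pose v : cfg := (fun a => (a == i)%:R *: delta_mx i j, fun _ => 0).
  apply: (single _ v) => [t tt|]; last by rewrite eqD_dp !eqxx oner_eq0.
  case: t tt => [[[i' k] l]|[[i' j'] tt|[j'|[[[j' k] l]|t]]]]; rewrite ?c1 ?c2 ?c3 ?c4 ?mul0r//.
  rewrite eqD_dp; move: tt; rewrite (inj_eq inr_inj) (inj_eq inl_inj) xpair_eqE => /negbTE->.
  by rewrite mulr0.
by move=> [[[i k] l]|[[i j]|[j|[[[j k] l]|t]]]].
Qed.
End Smooth.

(** * The open condition holds at the base matrix *)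

Definition eis_col (k l : 'I_6) : eis :=
  foldr (fun i z => eis_add (zquot (expo i l) (expo i k)) z) eis0 ords6.

Section BaseHadamard.
Variables (F : numFieldType) (w : F).
Hypothesis wE : w ^+ 2 = - 1 - w.
Local Notation h0 := (h0 w).
Local Notation eev := (eev w).

Lemma h0_row k : h0 o0 k = 1.
Proof. by elim/ord6_ind: k; rewrite /h0 /expo /= expr0. Qed.
Lemma h0_col i : h0 i o0 = 1.
Proof. by elim/ord6_ind: i; rewrite /h0 /expo /= expr0. Qed.

Lemma h0_orth k l : k != l -> \sum_i h0 i l / h0 i k = 0.
Proof.
move=> kl; transitivity (eev (eis_col k l)).
  rewrite sum6 /eis_col /= !eevD // !eev_zquot ?expo_le// eev0 addr0 !addrA.
  by [].
have : (k != l) ==> eis_eqb (eis_col k l) eis0.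
  by move: k l {kl}; elim/ord6_ind; elim/ord6_ind; vm_compute.
by rewrite kl => /eis_eqbP->; rewrite eev0.
Qed.

Lemma gram0E k l : gram0 w k l = (gram_up h0) k l.
Proof.
rewrite !mxE sum3 /j0.
have [e|kl] := eqVneq k l; last first.
  rewrite (inj_eq val_inj) (negbTE kl).
  rewrite !eevD// !eev_zquot ?expo_le// subr0 addrA.
  by congr (h0 _ _ / h0 _ _ + h0 _ _ / h0 _ _ + h0 _ _ / h0 _ _); apply: val_inj.
by rewrite e eqxx eev0 !divff ?h0_neq0// mulr1n; ring.
Qed.

End BaseHadamard.

Section BasePoly.
Variable R : realType.
Local Notation C := R[i].

Lemma jhat_hcfg (h : 'I_6 -> 'I_6 -> C) : (forall i k, h i k != 0) ->
  (forall k, h o0 k = 1) -> jhat (hcfg h) = gram_up h /\ jhat' (hcfg h) = - gram_lo h.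
Proof.
move=> hn hr.
have GE b k l : 36%:R * Gm b (hcfg h) k l =
    \sum_(i < 3) h (block_index b i) l / h (block_index b i) k.
  rewrite mulr_sumr; apply: eq_bigr => i _; set i' := block_index b i.
  rewrite mul_deltaE -2!mulmxA delta_mulE mulmxA mul_delta_mulE !mxE !hr.
  by field; rewrite hn.
split; apply/matrixP => k l; rewrite !mxE GE; set s := \sum_(i < 3) _;
  by rewrite !eqxx mul1r -mulr_natr; ring.
Qed.

(** Taking for [L] a left inverse of the coefficient matrix at the base point makes the determinant
    in [hpoly] equal to 1 there. *)
Lemma base_hpoly (w : C) : w ^+ 2 = - 1 - w -> exists L, hpoly L (hcfg (h0 w)) != 0.
Proof.
move=> wE; have hn := h0_neq0 wE; have hr := h0_row w.
have [j1 j2] := jhat_hcfg hn hr.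
have up0 : gram_up (h0 w) = gram0 w by apply/matrixP => k l; rewrite gram0E.
have lo0 : - gram_lo (h0 w) = gram0 w.
  rewrite -up0; apply/matrixP => k l; apply/eqP; rewrite eq_sym -subr_eq0.
  have [->|kl] := eqVneq k l; last first.
    have := gram_upD_lo (h0 w) kl; rewrite (h0_orth wE kl) mxE [X in _ + X]mxE => ->//.
  by rewrite !mxE !sum3 !divff// eqxx mulr1n; apply/eqP; ring.
have [|L LM] := @kernel_left_inverse _ _ _ (coef_mx 1 (gram0 w) (gram0 w)).
  move=> v; pose x : 'M[C]_6 := \matrix_(k, l) v (enum_rank (k, l)) 0.
  have -> : v = vec36 x.
    by apply/colP => u; rewrite !mxE -surjective_pairing enum_valK.
  move=> /coef_mxP/(base_forms_kernel wE)->.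
  by apply/colP => u; rewrite !mxE.
exists L; rewrite /hpoly j1 j2 up0 lo0 [hcfg _]lock /= -lock.
have D0 i : (hcfg (h0 w)).1 i i i = 1 by rewrite mxE !eqxx.
rewrite D0 expr1n LM det1 mulr1 mulf_neq0//.
  by apply/prodf_neq0 => i _; rewrite D0 oner_eq0.
apply/prodf_neq0 => j _; apply/prodf_neq0 => l _.
rewrite /Wm mul_deltaE delta_mulE mxE hr mulf_neq0 ?hn//.
Qed.
End BasePoly.

(** * Smooth functions and a quadratic implicit function theorem *)

Section SmoothFunctions.
Variables (R : realType) (d' : nat).
Local Notation d := d'.+1.
Variable U : set 'rV[R]_d.
Hypothesis Uo : open U.
Implicit Types f g : 'rV[R]_d -> R.

(* Unlike C_k, asks for the continuity of f at each order, which makes the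
   induction for products go through. *)
Fixpoint smooth_to (k : nat) f : Prop :=
  (forall t, U t -> {for t, continuous f}) /\
  if k is k'.+1 then (forall t v, U t -> derivable f t v) /\
    (forall v, smooth_to k' (fun t => 'D_v f t)) else True.

Lemma smooth_to_C_k k f : smooth_to k f -> C_k k U f.
Proof.
elim: k f => [|k IH] f /= [cf]; first by [].
by move=> [df Df]; split=> // v; apply: IH.
Qed.

Lemma smooth_to_cont k f : smooth_to k f -> forall t, U t -> {for t, continuous f}.
Proof. by case: k => [|k] []. Qed.

Lemma smooth_toS k f : smooth_to k.+1 f -> smooth_to k f.
Proof.
elim: k f => [|k IH] f /= [cf [df Df]]; first by [].
by split=> //; split=> // v; apply: IH.
Qed.

Lemma near_open (P : set 'rV[R]_d) t : U t -> U `<=` P -> \forall b \near t, P b.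
Proof. by move=> Ut UP; exact: (filterS UP (open_nbhs_nbhs (conj Uo Ut))). Qed.

Lemma smooth_to_ext k f g : {in U, f =1 g} -> smooth_to k f -> smooth_to k g.
Proof.
have fgn f1 g1 t : {in U, f1 =1 g1} -> U t -> \forall b \near t, f1 b = g1 b.
  by move=> fg Ut; apply: near_open => // b Ub; apply: fg; rewrite inE.
have cont f1 g1 : {in U, f1 =1 g1} -> (forall t, U t -> {for t, continuous f1}) ->
    forall t, U t -> {for t, continuous g1}.
  move=> fg cf t Ut; rewrite /prop_for /continuous_at -(fg t) ?inE//.
  exact: cvg_trans (near_eq_cvg (fgn _ _ _ fg Ut)) (cf t Ut).
elim: k f g => [|k IH] f g fg.
  by move=> [cf _]; split=> //; exact: cont cf.
move=> [cf [df Df]]; split; first exact: cont cf.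
split=> [t v Ut|v]; first exact: near_eq_derivable (fgn _ _ _ fg Ut) (df t v Ut).
apply: IH (Df v) => t; rewrite inE => Ut.
exact: near_eq_derive (fgn _ _ _ fg Ut).
Qed.

Lemma smooth_to_cst k c : smooth_to k (fun=> c).
Proof.
elim: k c => [|k IH] c; split; try by move=> *; apply: cst_continuous.
  by [].
split=> [t v _|v]; first exact: derivable_cst.
apply: smooth_to_ext (IH 0) => t _; by rewrite derive_cst.
Qed.

Lemma smooth_toD k f g : smooth_to k f -> smooth_to k g ->
  smooth_to k (fun t => f t + g t).
Proof.
have cD f1 g1 : (forall t, U t -> {for t, continuous f1}) ->
    (forall t, U t -> {for t, continuous g1}) ->
    forall t, U t -> {for t, continuous (fun t => f1 t + g1 t)}.
  by move=> cf cg t Ut; exact: (continuousD (cf t Ut) (cg t Ut)).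
elim: k f g => [|k IH] f g [cf sf] [cg sg]; first by split=> //; exact: cD.
case: sf sg => df Df [dg Dg]; split; first exact: cD.
split=> [t v Ut|v]; first by apply: derivableD; [exact: df|exact: dg].
apply: smooth_to_ext (IH _ _ (Df v) (Dg v)) => t; rewrite inE => Ut.
by rewrite -deriveD//; [exact: df|exact: dg].
Qed.

Lemma smooth_toM k f g : smooth_to k f -> smooth_to k g ->
  smooth_to k (fun t => f t * g t).
Proof.
have cM f1 g1 : (forall t, U t -> {for t, continuous f1}) ->
    (forall t, U t -> {for t, continuous g1}) ->
    forall t, U t -> {for t, continuous (fun t => f1 t * g1 t)}.
  by move=> cf cg t Ut; exact: (continuousM (cf t Ut) (cg t Ut)).
elim: k f g => [|k IH] f g sf' sg'; have [cf sf] := sf'; have [cg sg] := sg'.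
  by split=> //; exact: cM.
case: sf sg => df Df [dg Dg]; split; first exact: cM.
split=> [t v Ut|v]; first by apply: derivableM; [exact: df|exact: dg].
have := smooth_toD (IH _ _ (smooth_toS sf') (Dg v)) (IH _ _ (smooth_toS sg') (Df v)).
apply: smooth_to_ext => t; rewrite inE => Ut.
by rewrite deriveM//; [exact: df|exact: dg].
Qed.

Lemma smooth_toV k f : (forall t, U t -> f t != 0) -> smooth_to k f ->
  smooth_to k (fun t => (f t)^-1).
Proof.
move=> f0.
have cV f1 : (forall t, U t -> f1 t != 0) -> (forall t, U t -> {for t, continuous f1}) ->
    forall t, U t -> {for t, continuous (fun t => (f1 t)^-1)}.
  by move=> nz cf t Ut; exact: (continuousV (nz t Ut) (cf t Ut)).
elim: k => [|k IH] sf'; have [cf sf] := sf'; first by split=> //; exact: cV.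
case: sf => df Df; split; first exact: cV.
split=> [t v Ut|v]; first by apply: derivableV; [exact: f0|exact: df].
have sV := IH (smooth_toS sf').
have := smooth_toM (smooth_toM (smooth_to_cst k (-1)) (smooth_toM sV sV)) (Df v).
apply: smooth_to_ext => t; rewrite inE => Ut.
rewrite deriveV//; [|exact: f0|exact: df].
by rewrite mulN1r -expr2 exprVn.
Qed.

Lemma smooth_to_sum k (I : Type) (r : seq I) (P : pred I) (f : I -> 'rV[R]_d -> R) :
  (forall i, smooth_to k (f i)) -> smooth_to k (fun t => \sum_(i <- r | P i) f i t).
Proof.
move=> sf; elim: r => [|i r IH].
  by apply: smooth_to_ext (smooth_to_cst k 0) => t _; rewrite big_nil.
case Pi: (P i); last by apply: smooth_to_ext IH => t _; rewrite big_cons Pi.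
by apply: smooth_to_ext (smooth_toD (sf i) IH) => t _; rewrite big_cons Pi.
Qed.

Lemma smooth_to_prod k (I : Type) (r : seq I) (P : pred I) (f : I -> 'rV[R]_d -> R) :
  (forall i, smooth_to k (f i)) -> smooth_to k (fun t => \prod_(i <- r | P i) f i t).
Proof.
move=> sf; elim: r => [|i r IH].
  by apply: smooth_to_ext (smooth_to_cst k 1) => t _; rewrite big_nil.
case Pi: (P i); last by apply: smooth_to_ext IH => t _; rewrite big_cons Pi.
by apply: smooth_to_ext (smooth_toM (sf i) IH) => t _; rewrite big_cons Pi.
Qed.

Lemma smooth_to_det k m (A : 'rV[R]_d -> 'M[R]_m) :
  (forall i j, smooth_to k (fun t => A t i j)) -> smooth_to k (fun t => \det (A t)).
Proof.
move=> sA; apply: smooth_to_sum => s; apply: smooth_toM; first exact: smooth_to_cst.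
by apply: smooth_to_prod => i; exact: sA.
Qed.

(** Cofactor formula: determinants are polynomial, and the inverse of a non-vanishing smooth
    function is smooth. *)
Lemma smooth_to_invmx k m (A : 'rV[R]_d -> 'M[R]_m) :
  (forall t, U t -> A t \in unitmx) -> (forall i j, smooth_to k (fun t => A t i j)) ->
  forall i j, smooth_to k (fun t => invmx (A t) i j).
Proof.
move=> uA sA i j.
have sadj : smooth_to k (fun t => (\adj (A t)) i j).
  apply: (@smooth_to_ext _ (fun t => (-1) ^+ (j + i) * \det (row' j (col' i (A t))))).
    by move=> t _; rewrite mxE.
  apply: smooth_toM; first exact: smooth_to_cst.
  apply: smooth_to_det => a b.
  by apply: smooth_to_ext (sA (lift j a) (lift i b)) => t _; rewrite !mxE.
have sdet : smooth_to k (fun t => (\det (A t))^-1).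
  by apply: smooth_toV (smooth_to_det sA) => t /uA; rewrite unitmxE unitfE.
apply: smooth_to_ext (smooth_toM sdet sadj) => t; rewrite inE => /uA uAt.
by rewrite /invmx uAt [RHS]mxE.
Qed.
End SmoothFunctions.

(** Completeness is what the Banach fixed point theorem requires in [sol_ex]. *)
HB.instance Definition _ (R : realType) (m n : nat) :=
  Uniform_isComplete.Build 'M[R]_(m, n) (@mx_complete R m n).

Section Norm.
Variable R : realType.

Lemma ler_term (I : finType) (F : I -> R) i : (forall i, 0 <= F i) -> F i <= \sum_i F i.
Proof. by move=> F0; rewrite (bigD1 i)//= lerDl sumr_ge0. Qed.

Lemma norm_rV_coord n (v : 'rV[R]_n) i : `|v 0 i| <= `|v|.
Proof.
rewrite -[leRHS]/(mx_norm v) mx_normrE.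
exact: (le_bigmax _ (fun ij : 'I_1 * 'I_n => `|v ij.1 ij.2|) (0, i)).
Qed.

Lemma norm_rV_le n (v : 'rV[R]_n) c : 0 <= c -> (forall i, `|v 0 i| <= c) -> `|v| <= c.
Proof.
move=> c0 vc; rewrite -[leLHS]/(mx_norm v) mx_normrE; apply/bigmax_leP; split=> // -[i j] _.
by rewrite ord1.
Qed.

Lemma mulmx_bound m n (A : 'M[R]_(m, n)) e : 0 <= e -> (forall i j, `|A i j| <= e) ->
  forall v : 'rV_m, `|v *m A| <= m%:R * e * `|v|.
Proof.
move=> e0 Ae v; apply: norm_rV_le => [|j]; first by rewrite !mulr_ge0.
rewrite mxE; apply: le_trans (ler_norm_sum _ _ _) _.
apply: (@le_trans _ _ (\sum_(i < m) e * `|v|)).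
  by apply: ler_sum => i _; rewrite normrM mulrC ler_pM// norm_rV_coord.
by rewrite sumr_const card_ord -(mulrA m%:R) mulr_natl.
Qed.
End Norm.

(** * Implicit functions for quadratic maps *)

Section QuadraticIFT.
Variables (R : realType) (N d' : nat).
Local Notation d := d'.+1.
Variables (Psi : 'rV[R]_N -> 'rV[R]_N) (M : 'rV[R]_N -> 'M[R]_N).
Variables (m0 : 'I_N -> 'I_N -> R) (b : 'I_N -> 'I_N -> 'I_N -> R).
Hypothesis ME : forall x i j, M x i j = m0 i j + \sum_l b i j l * x 0 l.
(** For a quadratic map the increment is exactly given by the differential at the midpoint; this
    replaces Taylor estimates. *)
Hypothesis PsiM : forall x y, Psi x - Psi y = (x - y) *m M (2^-1 *: (x + y)).
Variables (P : 'M[R]_(d, N)) (x0 : 'rV[R]_N) (t0 : 'rV[R]_d).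
Hypothesis Mx0 : M x0 \in unitmx.

Let A := invmx (M x0).

Lemma M_lip : exists2 c, 0 <= c & forall x y (v : 'rV_N), `|v *m (M x - M y)| <= c * `|x - y| * `|v|.
Proof.
pose c := \sum_i \sum_j \sum_l `|b i j l|.
have c0 : 0 <= c by do 3 apply: sumr_ge0 => ? _.
exists (N%:R * c) => [|x y v]; first by rewrite mulr_ge0.
rewrite -(mulrA N%:R); apply: mulmx_bound => [|i j]; first by rewrite mulr_ge0.
rewrite mxE [(- M y) i j]mxE !ME opprD addrACA subrr add0r -sumrB.
apply: le_trans (ler_norm_sum _ _ _) _.
apply: (@le_trans _ _ (\sum_l `|b i j l| * `|x - y|)).
  apply: ler_sum => l _; rewrite -mulrBr normrM ler_wpM2l//.
  by have := norm_rV_coord (x - y) l; rewrite !mxE.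
rewrite -mulr_suml ler_wpM2r//.
apply: le_trans (ler_term (F := fun j => \sum_l `|b i j l|) j _) _ => [j'|].
  by apply: sumr_ge0.
apply: (ler_term (F := fun i => \sum_j \sum_l `|b i j l|)) => i'.
by do 2 apply: sumr_ge0 => ? _.
Qed.

(** As [M x0] times [A] is the identity and [M] is Lipschitz, [M m] times [A] stays within 1/2 of
    the identity; 1/2 is the contraction constant of [sol_ex]. *)
Lemma near_inverse : exists2 r, 0 < r & forall m, `|m - x0| <= r ->
  forall v : 'rV_N, `|v - v *m M m *m A| <= 2^-1 * `|v|.
Proof.
have [c c0 Mc] := M_lip.
have [a a0 Aa] : exists2 a, 0 <= a & forall v : 'rV_N, `|v *m A| <= a * `|v|.
  pose a := \sum_i \sum_j `|A i j|.
  have a0 : 0 <= a by do 2 apply: sumr_ge0 => ? _.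
  exists (N%:R * a) => [|v]; first by rewrite mulr_ge0.
  apply: mulmx_bound => // i j.
  apply: le_trans (ler_term (F := fun j => `|A i j|) j _) _ => //.
  by apply: (ler_term (F := fun i => \sum_j `|A i j|)) => i'; apply: sumr_ge0.
have K0 : 0 < 2 * (a * c + 1) by rewrite mulr_gt0// ltr_wpDl// mulr_ge0.
(* Adding 1 keeps the denominator positive when a * c = 0. *)
exists (2 * (a * c + 1))^-1 => [|m mr v]; first by rewrite invr_gt0.
have -> : v - v *m M m *m A = v *m (M x0 - M m) *m A.
  by rewrite mulmxBr mulmxBl -(mulmxA _ (M x0)) mulmxV// mulmx1.
apply: le_trans (Aa _) _.
apply: (@le_trans _ _ (a * (c * `|x0 - m| * `|v|))); first by rewrite ler_wpM2l.
rewrite !mulrA ler_wpM2r// distrC.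
apply: (@le_trans _ _ (a * c * (2 * (a * c + 1))^-1)); first by rewrite ler_wpM2l ?mulr_ge0.
rewrite ler_pdivrMr// mulrA mulVf ?mul1r ?lerDl ?pnatr_eq0//.
Qed.

Let rr : {r | 0 < r & forall m, `|m - x0| <= r -> forall v : 'rV_N, `|v - v *m M m *m A| <= 2^-1 * `|v|}.
Proof. by apply: cid2; exact: near_inverse. Qed.
Let r := let: exist2 r _ _ := rr in r.
Let r0 : 0 < r. Proof. by rewrite /r; case: rr. Qed.
Let nearA m : `|m - x0| <= r -> forall v : 'rV_N, `|v - v *m M m *m A| <= 2^-1 * `|v|.
Proof. by rewrite /r; case: rr => r' _; apply. Qed.

Lemma mid_ball y z : `|y - x0| <= r -> `|z - x0| <= r -> `|2^-1 *: (y + z) - x0| <= r.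
Proof.
move=> yr zr; have -> : 2^-1 *: (y + z) - x0 = 2^-1 *: ((y - x0) + (z - x0)).
  by apply/rowP => i; rewrite !mxE; field.
rewrite normrZ ger0_norm ?invr_ge0// ler_pdivrMl//.
apply: le_trans (ler_normD _ _) _; lra.
Qed.

Lemma M_unit y : `|y - x0| <= r -> M y \in unitmx.
Proof.
move=> yr; rewrite -row_free_unit -kermx_eq0; apply/rowV0P => u /sub_kermxP uM.
have := nearA yr u; rewrite uM mul0mx subr0 => h; apply/eqP; rewrite -normr_eq0.
by rewrite eq_le normr_ge0 andbT; lra.
Qed.

(** For s = t this is uniqueness of the solution in the ball; in general it is Lipschitz dependence
    on the parameter. *)
Lemma sol_dist y z s t : `|y - x0| <= r -> `|z - x0| <= r ->
  Psi y = Psi x0 + (s - t0) *m P -> Psi z = Psi x0 + (t - t0) *m P ->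
  (y - z) *m M (2^-1 *: (y + z)) = (s - t) *m P /\ `|y - z| <= 2 * `|(s - t) *m P *m A|.
Proof.
move=> yr zr Py Pz.
have e : (y - z) *m M (2^-1 *: (y + z)) = (s - t) *m P.
  by rewrite -PsiM Py Pz opprD addrACA subrr add0r -mulmxBl opprB addrA subrK.
split=> //; have := nearA (mid_ball yr zr) (y - z); rewrite e => h.
have := ler_normD ((y - z) - (s - t) *m P *m A) ((s - t) *m P *m A).
rewrite subrK; lra.
Qed.

(** The bound r / 2 and the contraction factor 1/2 together make the iteration preserve the closed
    ball of radius r. *)
Let U := [set t : 'rV[R]_d | `|(t - t0) *m P *m A| < r / 2].

(** Newton iteration with the inverse Jacobian frozen at [x0]. *)
Lemma sol_ex t : U t -> exists y, `|y - x0| <= r /\ Psi y = Psi x0 + (t - t0) *m P.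
Proof.
move=> Ut; pose T y := y - (Psi y - (Psi x0 + (t - t0) *m P)) *m A.
pose B := [set y : 'rV[R]_N | `|y - x0| <= r].
have TT y z : B y -> B z -> `|T y - T z| <= 2^-1 * `|y - z|.
  move=> yr zr; have := nearA (mid_ball yr zr) (y - z); rewrite -PsiM.
  congr (`|_| <= _); rewrite /T !mulmxBl; apply/rowP => i; rewrite !mxE; ring.
have Tx0 : T x0 - x0 = (t - t0) *m P *m A.
  by rewrite /T opprD addrA subrr sub0r mulNmx opprK addrC addKr.
have TB : set_fun B B T.
  move=> y yB; rewrite /B /=.
  have x0B : B x0 by rewrite /B /= subrr normr0 ltW.
  have := ler_normD (T y - T x0) (T x0 - x0); rewrite addrA subrK Tx0.
  have := TT _ _ yB x0B; move: yB Ut; rewrite /B /U /= => yB Ut; lra.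
have [y yB Ty] : exists2 p, B p & p = T p.
  apply: (@banach_fixed_point R 'rV[R]_N B (mkfun TB)).
  - exists (2^-1)%:nng; split; first by rewrite /=; lra.
    by move=> [y z] [/= yB zB]; exact: TT.
  - rewrite (_ : B = closed_ball x0 r); first exact: closed_ball_closed.
    by rewrite closed_ballE//; apply/seteqP; split=> z; rewrite /B /closed_ball_ /= distrC.
  - by exists x0; rewrite /B /= subrr normr0 ltW.
exists y; split=> //; move: Ty; rewrite /T => /eqP.
rewrite -subr_eq0 opprB addrC subrK => /eqP e.
have uA : A \in unitmx by rewrite unitmx_inv.
by apply/eqP; rewrite -subr_eq0; apply/eqP; rewrite -[LHS](mulmxK uA) e mul0mx.
Qed.

(** Smoothness is bootstrapped: the derivative v P M(Y)^-1 of Y is as smooth as Y itself. *)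
Theorem quadratic_ift : exists (V : set 'rV[R]_d) (Y : 'rV[R]_d -> 'rV[R]_N),
  [/\ open V, V t0, Y t0 = x0,
    forall t, V t -> Psi (Y t) = Psi x0 + (t - t0) *m P /\ M (Y t) \in unitmx
  & (forall k l, smooth_to V k (fun t => Y t 0 l)) /\
    forall t v l, V t -> 'D_v (fun t => Y t 0 l) t = (v *m P *m invmx (M (Y t))) 0 l].
Proof.
have [Y YP] : exists Y, forall t, U t -> `|Y t - x0| <= r /\ Psi (Y t) = Psi x0 + (t - t0) *m P.
  suff : forall t, exists y, U t -> `|y - x0| <= r /\ Psi y = Psi x0 + (t - t0) *m P.
    by move=> /boolp.choice[Y YP]; exists Y.
  move=> t; have [Ut|nUt] := pselect (U t); last by exists 0.
  by have [y yP] := sol_ex Ut; exists y.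
have [a a0 aP] : exists2 a, 0 < a & forall v : 'rV_d, `|v *m P *m A| <= a * `|v|.
  pose e := \sum_i \sum_j `|(P *m A) i j|.
  have e0 : 0 <= e by do 2 apply: sumr_ge0 => ? _.
  exists (d%:R * e + 1) => [|v]; first by rewrite ltr_wpDl// mulr_ge0.
  apply: (@le_trans _ _ (d%:R * e * `|v|)); last by rewrite ler_wpM2r// lerDl.
  rewrite -mulmxA; apply: mulmx_bound => // i j.
  apply: le_trans (ler_term (F := fun j => `|(P *m A) i j|) j _) _ => //.
  by apply: (ler_term (F := fun i => \sum_j `|(P *m A) i j|)) => i'; apply: sumr_ge0.
have Uball t : U t -> exists2 e, 0 < e & forall s, `|s - t| < e -> U s.
  move=> Ut; exists ((r / 2 - `|(t - t0) *m P *m A|) / a).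
    by rewrite divr_gt0// subr_gt0; exact: Ut.
  move=> s; rewrite ltr_pdivlMr// mulrC => st.
  have := ler_normD ((s - t) *m P *m A) ((t - t0) *m P *m A).
  rewrite -mulmxDl -mulmxDl addrA subrK; have := aP (s - t).
  move: st; rewrite /U /=; lra.
have Uo : open U.
  rewrite openE => t /Uball[e e0 eU]; apply: (nbhs_normP t U).2; exists e => // s.
  by rewrite /= distrC; exact: eU.
have Ut0 : U t0 by rewrite /U /= subrr !mul0mx normr0 divr_gt0.
have x0r : `|x0 - x0| <= r by rewrite subrr normr0 ltW.
have Ydist s t : U s -> U t -> (Y s - Y t) *m M (2^-1 *: (Y s + Y t)) = (s - t) *m P /\
    `|Y s - Y t| <= 2 * a * `|s - t|.
  move=> Us Ut; have [Ys Ps] := YP s Us; have [Yt Pt] := YP t Ut.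
  have [e h] := sol_dist Ys Yt Ps Pt; split=> //.
  by have := aP (s - t); lra.
have Yt0 : Y t0 = x0.
  have [Y0 P0] := YP t0 Ut0.
  have Px0 : Psi x0 = Psi x0 + (t0 - t0) *m P by rewrite subrr mul0mx addr0.
  have [_] := sol_dist Y0 x0r P0 Px0; rewrite subrr !mul0mx normr0 mulr0 normr_le0 subr_eq0.
  by move/eqP.
have YM t : U t -> M (Y t) \in unitmx by move=> Ut; apply: M_unit; case: (YP t Ut).
have Ycont l t : U t -> {for t, continuous (fun t => Y t 0 l)}.
  move=> Ut; have [e e0 eU] := Uball t Ut.
  apply: (@cvgrPdist_lt R R _ (nbhs t) _ (fun t => Y t 0 l) (Y t 0 l)).2 => eps eps0.
  apply: (nbhs_normP t _).2.
  exists (Order.min e (eps / (2 * a))) => /=; first by rewrite lt_min e0 divr_gt0// mulr_gt0.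
  move=> s /=; rewrite lt_min => /andP[se]; rewrite ltr_pdivlMr ?mulr_gt0// mulrC distrC => seps.
  have Us : U s by apply: eU; rewrite distrC.
  have [_ st] := Ydist s t Us Ut; rewrite distrC.
  apply: le_lt_trans (le_lt_trans st seps).
  by have := norm_rV_coord (Y s - Y t) l; rewrite !mxE.
have [c c0 Mc] := M_lip.
have Yder t v l : U t -> (fun h => h^-1 *: (((fun t => Y t 0 l) \o shift t) (h *: v) - Y t 0 l)) @ 0^' -->
    (v *m P *m invmx (M (Y t))) 0 l.
  move=> Ut; have [e e0 eU] := Uball t Ut; set Z := invmx (M (Y t)).
  pose z := \sum_i \sum_j `|Z i j|; have z0 : 0 <= z by do 2 apply: sumr_ge0 => ? _.
  have Zz (u : 'rV_N) : `|u *m Z| <= N%:R * z * `|u|.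
    apply: mulmx_bound => // i j.
    apply: le_trans (ler_term (F := fun j => `|Z i j|) j _) _ => //.
    by apply: (ler_term (F := fun i => \sum_j `|Z i j|)) => i'; apply: sumr_ge0.
  pose C := N%:R * z * (c * (2 * a * `|v|) * (2 * a * `|v|)).
  have C0 : 0 <= C by rewrite !mulr_ge0// ltW.
  apply/cvgrPdist_lt => eps eps0; near=> h.
  have h0 : h != 0 by near: h; exact: nbhs_dnbhs_neq.
  have hv : `|h| * `|v| < e.
    have : `|h| < e / (`|v| + 1) by near: h; apply: dnbhs0_lt; rewrite divr_gt0// ltr_wpDl.
    rewrite ltr_pdivlMr ?ltr_wpDl//; apply: le_lt_trans.
    by rewrite ler_wpM2l// lerDl.
  have hC : C * `|h| < eps.
    have : `|h| < eps / (C + 1) by near: h; apply: dnbhs0_lt; rewrite divr_gt0// ltr_wpDl.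
    rewrite ltr_pdivlMr ?ltr_wpDl//; apply: le_lt_trans.
    by rewrite mulrC ler_wpM2l// lerDl.
  have Us : U (h *: v + t) by apply: eU; rewrite addrK normrZ.
  have [eq1 dst] := Ydist _ _ Us Ut; rewrite addrK normrZ in eq1 dst.
  set ys := Y _ in eq1 dst *; set yt := Y t in eq1 dst *.
  (* The difference quotient satisfies q M(m) = v P exactly, m being the midpoint; replacing m by
     Y(t) costs O(h) since [M] is Lipschitz. *)
  pose q := h^-1 *: (ys - yt); set m := _ *: _ in eq1.
  have qM : q *m M m = v *m P.
    by rewrite /q -scalemxAl eq1 -scalemxAl scalerA mulVf// scale1r.
  have qn : `|q| <= 2 * a * `|v|.
    rewrite /q normrZ normfV ler_pdivrMl ?normr_gt0//; apply: le_trans dst _.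
    by rewrite le_eqVlt; apply/orP; left; apply/eqP; ring.
  have qE : v *m P *m Z - q = q *m (M m - M yt) *m Z.
    rewrite mulmxBr mulmxBl qM -(mulmxA q) mulmxV ?mulmx1//; exact: YM.
  have mn : `|m - yt| <= `|h| * (2 * a * `|v|).
    have -> : m - yt = 2^-1 *: (ys - yt) by apply/rowP => i; rewrite !mxE; field.
    rewrite normrZ ger0_norm ?invr_ge0//.
    apply: (@le_trans _ _ `|ys - yt|); first by rewrite ler_piMl// invf_le1// ler1n.
    by apply: le_trans dst _; rewrite le_eqVlt; apply/orP; left; apply/eqP; ring.
  apply: le_lt_trans hC.
  have -> : (v *m P *m Z) 0 l - h^-1 *: (ys 0 l - yt 0 l) = (v *m P *m Z - q) 0 l.
    by rewrite /q !mxE.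
  apply: le_trans (norm_rV_coord _ _) _; rewrite qE; apply: le_trans (Zz _) _.
  rewrite /C -[leRHS]mulrA ler_wpM2l ?mulr_ge0//; apply: le_trans (Mc _ _ _) _.
  rewrite -[leLHS]mulrA -!(mulrA c) ler_wpM2l//.
  apply: le_trans (ler_pM _ _ mn qn) _ => //.
  by rewrite le_eqVlt; apply/orP; left; apply/eqP; ring.
have YD t v l : U t -> derivable (fun t => Y t 0 l) t v /\
    'D_v (fun t => Y t 0 l) t = (v *m P *m invmx (M (Y t))) 0 l.
  move=> Ut; have h := Yder t v l Ut; split; first by apply/cvg_ex; exists ((v *m P *m invmx (M (Y t))) 0 l).
  exact: (cvg_lim _ h).
exists U, Y; split=> //; first by move=> t Ut; split; [exact: (YP t Ut).2|exact: YM].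
split; last by move=> t v l Ut; case: (YD t v l Ut).
have smM k : (forall l, smooth_to U k (fun t => Y t 0 l)) ->
    forall i j, smooth_to U k (fun t => M (Y t) i j).
  move=> sY i j.
  apply: (smooth_to_ext Uo (f := fun t => m0 i j + \sum_l b i j l * Y t 0 l)).
    by move=> t _; rewrite ME.
  apply: smooth_toD => //; first exact: smooth_to_cst.
  apply: smooth_to_sum => // l'; apply: smooth_toM => //; exact: smooth_to_cst.
elim=> [|k IH] l; first by split=> // t Ut; exact: Ycont.
split; first by move=> t Ut; exact: Ycont.
split=> [t v Ut|v]; first by case: (YD t v l Ut).
apply: (smooth_to_ext Uo (f := fun t => \sum_i (v *m P) 0 i * invmx (M (Y t)) i l)).
  by move=> t; rewrite inE => Ut; rewrite (YD t v l Ut).2 [RHS]mxE.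
apply: smooth_to_sum => // i; apply: smooth_toM => //; first exact: smooth_to_cst.
exact: (smooth_to_invmx Uo YM (smM k IH)).
Unshelve. all: by end_near.
Qed.
End QuadraticIFT.

(** * The real equations of a Hadamard matrix *)

Section System.
Variable R : realType.
Local Notation C := R[i].
Local Notation "z ^*" := (Num.conj z) : ring_scope.
Local Notation "z ^*" := (Num.conj z) : complex_scope.
Implicit Types A B : 'M[C]_6.

Definition reim (c : bool) (z : C) : R := if c then complex.Re z else complex.Im z.

Lemma reim_linear c a y z : reim c (a%:C * y + z) = a * reim c y + reim c z.
Proof. by case: c y z => -[y y'] [z z'] /=; rewrite mul0r ?subr0 ?addr0. Qed.
Lemma reim0 c : reim c 0 = 0. Proof. by case: c. Qed.
Lemma reimD c y z : reim c (y + z) = reim c y + reim c z.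
Proof. by have := reim_linear c 1 y z; rewrite !mul1r. Qed.
Lemma reimB c y z : reim c (y - z) = reim c y - reim c z.
Proof. by case: c y z => -[y y'] [z z']. Qed.
Lemma reim_eq0 z : reim true z = 0 -> reim false z = 0 -> z = 0.
Proof. by case: z => a b /= -> ->. Qed.

Lemma conj_linear (a : R) (y z : C) : (a%:C * y + z)^* = a%:C * y^* + z^*.
Proof.
case: y z => [y y'] [z z']; apply/eqP; rewrite eq_complex /=.
by apply/andP; split; apply/eqP; ring.
Qed.

Definition unknown : finType := (bool * ('I_5 * 'I_5))%type.
Definition equation : finType :=
  (('I_5 * 'I_5 + bool * 'I_3 * bool) + (('I_5 + 'I_4) + 'I_4))%type.
Local Notation N := #|unknown|.
Implicit Types (u v x y : 'rV[R]_N) (t : equation).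

Lemma card_equation : N = #|equation|.
Proof. by rewrite !card_sum !card_prod card_bool !card_ord. Qed.

Definition upair (b : bool) (s : 'I_3) : 'I_6 * 'I_6 :=
  let: (i, j) := nth (ord0, ord0) [:: (@Ordinal 3 0 isT, @Ordinal 3 1 isT);
    (@Ordinal 3 0 isT, @Ordinal 3 2 isT); (@Ordinal 3 1 isT, @Ordinal 3 2 isT)] s in
  (block_index b i, block_index b j).

(* |h_ik| = 1; orthogonality of rows within one half; products of columns, of
   which only the imaginary part is used; the last four equations fix the
   parameters and have no quadratic part. *)
Definition sesq t A B : C :=
  match t with
  | inl (inl (i, k)) => A (lift o0 i) (lift o0 k) * (B (lift o0 i) (lift o0 k))^*
  | inl (inr (b, s, _)) => \sum_k A (upair b s).1 k * (B (upair b s).2 k)^*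
  | inr (inl s) => \sum_i A i (col_pair s).2 * (B i (col_pair s).1)^*
  | inr (inr _) => 0
  end.
Definition part t : bool :=
  match t with inl (inl _) => true | inl (inr (_, c)) => c | _ => false end.
Definition bilin t A B : R := reim (part t) (sesq t A B + sesq t B A).
Definition lin t A : R :=
  if t is inr (inr s) then reim false (A (param s).1 (param s).2) else 0.
Definition quad t A : R := reim (part t) (sesq t A A) + lin t A.

Lemma sesq_linear_l t (a : R) A A' B :
  sesq t (a%:C *: A + A') B = a%:C * sesq t A B + sesq t A' B.
Proof.
case: t => [[[i k]|[[b s] c]]|[s|s]] /=; last by rewrite mulr0 addr0.
- by rewrite !mxE; ring.
- by rewrite mulr_sumr -big_split; apply: eq_bigr => k _; rewrite !mxE /=; ring.
- by rewrite mulr_sumr -big_split; apply: eq_bigr => k _; rewrite !mxE /=; ring.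
Qed.

Lemma sesq_linear_r t (a : R) A A' B :
  sesq t B (a%:C *: A + A') = a%:C * sesq t B A + sesq t B A'.
Proof.
case: t => [[[i k]|[[b s] c]]|[s|s]] /=; last by rewrite mulr0 addr0.
- by rewrite !mxE conj_linear; ring.
- rewrite mulr_sumr -big_split; apply: eq_bigr => k _.
  by rewrite !mxE conj_linear /=; ring.
- rewrite mulr_sumr -big_split; apply: eq_bigr => k _.
  by rewrite !mxE conj_linear /=; ring.
Qed.

Lemma bilinC t A B : bilin t A B = bilin t B A.
Proof. by rewrite /bilin addrC. Qed.

Lemma bilin_linear t (a : R) A A' B :
  bilin t (a%:C *: A + A') B = a * bilin t A B + bilin t A' B.
Proof.
rewrite /bilin sesq_linear_l sesq_linear_r -reim_linear; congr (reim _ _); ring.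
Qed.

Lemma lin_linear t (a : R) A A' : lin t (a%:C *: A + A') = a * lin t A + lin t A'.
Proof.
case: t => [t|[t|s]] /=; rewrite ?mulr0 ?addr0//.
by rewrite !mxE; exact: (reim_linear false).
Qed.

(** At the midpoint the cross terms cancel, which gives the exact increment formula assumed by
    [quadratic_ift]. *)
Lemma quadB t A B :
  quad t A - quad t B = bilin t (A - B) ((2^-1)%:C *: (A + B)) + lin t (A - B).
Proof.
have linB : lin t (A - B) = lin t A - lin t B.
  have := lin_linear t (-1) B A; rewrite mulN1r addrC (_ : (-1)%:C = -1) => [|]; last first.
    by rewrite rmorphN1.
  by rewrite scaleN1r addrC [RHS]addrC => <-.
rewrite linB /quad /bilin.
have s0 D : sesq t 0 D = 0 /\ sesq t D 0 = 0.
  have := sesq_linear_l t 1 0 0 D; have := sesq_linear_r t 1 0 0 D.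
  rewrite !scaler0 !addr0 !mul1r => /eqP; rewrite addrC -subr_eq subrr => /eqP <-.
  by move=> /eqP; rewrite addrC -subr_eq subrr => /eqP <-.
have sZ (a : R) D D' : sesq t (a%:C *: D) D' = a%:C * sesq t D D' /\
    sesq t D' (a%:C *: D) = a%:C * sesq t D' D.
  have := sesq_linear_l t a D 0 D'; have := sesq_linear_r t a D 0 D'.
  by rewrite !(s0 _).1 !(s0 _).2 !addr0.
have sN D D' : sesq t (- D) D' = - sesq t D D' /\ sesq t D' (- D) = - sesq t D' D.
  have [] := sZ (-1) D D'; have -> : (-1)%:C = -1 :> C by rewrite rmorphN1.
  by rewrite !scaleN1r !mulN1r.
have sD D D' D'' : sesq t (D + D') D'' = sesq t D D'' + sesq t D' D'' /\
    sesq t D'' (D + D') = sesq t D'' D + sesq t D'' D'.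
  have := sesq_linear_l t 1 D D' D''; have := sesq_linear_r t 1 D D' D''.
  by rewrite !scale1r !mul1r => -> ->.
have -> : sesq t (A - B) (2^-1%:C *: (A + B)) + sesq t (2^-1%:C *: (A + B)) (A - B) =
    sesq t A A - sesq t B B.
  rewrite (sZ _ _ _).1 (sZ _ _ _).2 !(sD _ _ _).1 !(sD _ _ _).2 !(sN _ _).1 !(sN _ _).2.
  have -> : (2^-1)%:C = 2^-1 :> C by rewrite fmorphV rmorph_nat.
  by field.
by rewrite reimB; ring.
Qed.

Definition cz u : 'M[C]_5 :=
  \matrix_(i, k) ((u 0 (enum_rank (true, (i, k))) : R)
                   +i* (u 0 (enum_rank (false, (i, k))) : R)).
Definition ones : 'M[C]_6 := \matrix_(i, k) ((i == o0) || (k == o0))%:R.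
Definition dhmat u : 'M[C]_6 := ext (cz u).
Definition hmat u : 'M[C]_6 := dhmat u + ones.

Lemma dhmat_linear a u v : dhmat (a *: u + v) = a%:C *: dhmat u + dhmat v.
Proof.
apply/matrixP => i k; have -> : (a%:C *: dhmat u + dhmat v) i k = a%:C * ext (cz u) i k + ext (cz v) i k.
  by rewrite [LHS]mxE [X in X + _]mxE.
rewrite -ext_linear.
congr (ext _ _ _); apply/matrixP => i' k'; rewrite !mxE.
by apply/eqP; rewrite eq_complex /=; apply/andP; split; apply/eqP; ring.
Qed.

Lemma hmatB u v : hmat u - hmat v = dhmat (u - v).
Proof.
rewrite /hmat opprD addrACA subrr addr0; have := dhmat_linear (-1) v u.
have -> : (-1)%:C = -1 :> C by rewrite rmorphN1.
by rewrite !scaleN1r => e; rewrite addrC -e addrC.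
Qed.

Lemma hmat_mid u v : hmat (2^-1 *: (u + v)) = (2^-1)%:C *: (hmat u + hmat v).
Proof.
have dhmat0 : dhmat 0 = 0.
  have := dhmat_linear 1 0 0; rewrite scaler0 addr0 scale1r => /eqP.
  by rewrite addrC -subr_eq subrr => /eqP <-.
have -> : 2^-1 *: (u + v) = 2^-1 *: u + (2^-1 *: v + 0) by rewrite addr0 scalerDr.
rewrite /hmat !dhmat_linear dhmat0 addr0 -scalerDr addrACA [in RHS]scalerDr; congr (_ + _).
apply/matrixP => i k; rewrite !mxE fmorphV rmorph_nat.
by field.
Qed.

Definition eq_of (k : 'I_N) : equation := enum_val (cast_ord card_equation k).
Definition Psi u : 'rV[R]_N := \row_k quad (eq_of k) (hmat u).
Definition form k u v : R := bilin (eq_of k) (dhmat v) (hmat u) + lin (eq_of k) (dhmat v).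
(** The Jacobian of [Psi], transposed so as to act on row vectors. *)
Definition Mx u : 'M[R]_N := \matrix_(l, k) form k u (delta_mx 0 l).

Lemma eq_ofP t : exists k, eq_of k = t.
Proof.
exists (cast_ord (esym card_equation) (enum_rank t)).
by rewrite /eq_of cast_ordKV enum_rankK.
Qed.

Lemma linear_rV (n : nat) (f : 'rV[R]_n -> R) (w : 'rV[R]_n) :
  (forall a (w1 w2 : 'rV[R]_n), f (a *: w1 + w2) = a * f w1 + f w2) ->
  f w = \sum_l w 0 l * f (delta_mx 0 l).
Proof.
move=> fl; rewrite [w in LHS]row_sum_delta.
have f0 : f 0 = 0.
  by have := fl 1 0 0; rewrite scaler0 addr0 mul1r => /eqP; rewrite addrC -subr_eq subrr => /eqP <-.
by elim: index_enum => [|l s IH]; rewrite ?big_nil ?f0// !big_cons fl IH.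
Qed.

Lemma mul_Mx u v k : (v *m Mx u) 0 k = form k u v.
Proof.
rewrite mxE (@linear_rV N (form k u) v) => [|a w w'].
  by apply: eq_bigr => l _; rewrite mxE.
by rewrite /form dhmat_linear bilin_linear lin_linear; ring.
Qed.

Lemma PsiB u v : Psi u - Psi v = (u - v) *m Mx (2^-1 *: (u + v)).
Proof.
apply/rowP => k; rewrite mul_Mx !mxE quadB /form hmatB hmat_mid//.
Qed.

Lemma MxE u l k : Mx u l k = form k 0 (delta_mx 0 l) +
  \sum_m bilin (eq_of k) (dhmat (delta_mx 0 l)) (dhmat (delta_mx 0 m)) * u 0 m.
Proof.
rewrite mxE /form; set D := dhmat (delta_mx 0 l).
have -> : hmat u = 1%:C *: dhmat u + hmat 0.
  by rewrite /hmat addrA scale1r -{1}(addr0 u) -{1}(scale1r u) dhmat_linear scale1r.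
have -> : bilin (eq_of k) D (1%:C *: dhmat u + hmat 0) =
    bilin (eq_of k) D (dhmat u) + bilin (eq_of k) D (hmat 0).
  by rewrite bilinC bilin_linear mul1r !(bilinC _ D).
have -> : bilin (eq_of k) D (dhmat u) = \sum_m bilin (eq_of k) D (dhmat (delta_mx 0 m)) * u 0 m.
  rewrite bilinC (@linear_rV N (fun w => bilin (eq_of k) (dhmat w) D)).
    by apply: eq_bigr => m _; rewrite mulrC (bilinC _ D).
  by move=> a v w; rewrite dhmat_linear bilin_linear.
by rewrite -addrA addrC.
Qed.

End System.

(** * The real Jacobian and the complex tangent kernel *)

Section Kernels.
Variable R : realType.
Local Notation C := R[i].
Local Notation "z ^*" := (Num.conj z) : ring_scope.
Local Notation "z ^*" := (Num.conj z) : complex_scope.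
Local Notation N := #|unknown|.
Implicit Types (u v : 'rV[R]_N) (th : 'M[C]_6).
Local Notation I := ('i : C).

(** The condition shared by smoothness of the complex variety ([smooth_hcfg]) and invertibility of
    the real Jacobian. *)
Definition tangent_kernel (h : 'I_6 -> 'I_6 -> C) : Prop := forall th : 'M[C]_6,
  (forall i k, i = o0 \/ k = o0 -> th i k = 0) ->
  (forall i j : 'I_6, i != j -> (i < 3)%N = (j < 3)%N ->
     \sum_k h i k / h j k * (th i k - th j k) = 0) ->
  (forall k l : 'I_6, (k < 2)%N -> (k < l)%N ->
     \sum_i (h i l / h i k + h i k / h i l) * (th i l - th i k) = 0) ->
  th o1 o1 = 0 -> th o1 o2 = 0 -> th o1 o3 = 0 -> th o2 o1 = 0 -> th = 0.

Lemma upairP (i j : 'I_6) : i != j -> (i < 3)%N = (j < 3)%N ->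
  exists b s, upair b s = (i, j) \/ upair b s = (j, i).
Proof.
move=> ij ij3; have [i' iE] := block_indexP i; have [j' jE] := block_indexP j.
rewrite -ij3 in jE; have ij' : i' != j' by apply: contra_neq ij => e; rewrite iE jE e.
move: (i < 3)%N iE jE {ij ij3} => b -> ->; exists b; move: ij'.
have u s i1 j1 : nth (ord0, ord0) [:: (@Ordinal 3 0 isT, @Ordinal 3 1 isT);
    (@Ordinal 3 0 isT, @Ordinal 3 2 isT); (@Ordinal 3 1 isT, @Ordinal 3 2 isT)] s = (i1, j1) ->
    (s < 3)%N -> exists s, upair b s = (block_index b i1, block_index b j1).
  by move=> e s3; exists (Ordinal s3); rewrite /upair /= e.
case: i' => -[|[|[|//]]] pi; case: j' => -[|[|[|//]]] pj //= _.
all: rewrite (bool_irrelevance pi isT) (bool_irrelevance pj isT).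
- by have [s e] := u 0%N _ _ erefl isT; exists s; left.
- by have [s e] := u 1%N _ _ erefl isT; exists s; left.
- by have [s e] := u 0%N _ _ erefl isT; exists s; right.
- by have [s e] := u 2%N _ _ erefl isT; exists s; left.
- by have [s e] := u 1%N _ _ erefl isT; exists s; right.
- by have [s e] := u 2%N _ _ erefl isT; exists s; right.
Qed.

Lemma hmat_border u i k : i = o0 \/ k = o0 -> hmat u i k = 1.
Proof.
move=> ik; rewrite mxE (ext0 _ ik) mxE add0r.
by case: ik => ->; rewrite eqxx ?orbT.
Qed.

Lemma dhmat_surj (A : 'M[C]_6) : (forall i k, i = o0 \/ k = o0 -> A i k = 0) -> exists v, dhmat v = A.
Proof.
move=> A0; exists (\row_l let: (c, (i, k)) := enum_val l in reim c (A (lift o0 i) (lift o0 k))).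
apply/matrixP => i k; rewrite mxE.
have e : o0 = ord0 by apply: val_inj.
case: unliftP => [i' ->|->]; last by rewrite A0//; left.
case: unliftP => [k' ->|->]; last by rewrite A0//; right.
by rewrite !mxE !enum_rankK; case: (A _ _).
Qed.

Lemma dhmat_inj v : dhmat v = 0 -> v = 0.
Proof.
move=> /ext_eq0 /matrixP c0; apply/rowP => l; rewrite mxE -(enum_valK l).
by case: (enum_val l) => c [i k]; have := c0 i k; rewrite !mxE; case: c => -[].
Qed.

Lemma upair_block b s : ((upair b s).1 < 3)%N = ((upair b s).2 < 3)%N.
Proof. by case: s => -[|[|[|//]]] ?; case: b. Qed.
Lemma upair_neq b s : (upair b s).1 != (upair b s).2.
Proof. by case: s => -[|[|[|//]]] ?; case: b. Qed.
Lemma col_pair_lt s : ((col_pair s).1 < 2)%N /\ ((col_pair s).1 < (col_pair s).2)%N.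
Proof. by case: s. Qed.

Lemma conj_sum (T : finType) (F : T -> C) : (\sum_i F i)^* = \sum_i (F i)^*.
Proof. exact: rmorph_sum. Qed.

Lemma dhmat0 : dhmat (0 : 'rV[R]_N) = 0.
Proof.
have := dhmat_linear 1 (0 : 'rV[R]_N) 0; rewrite scaler0 addr0 scale1r => /eqP.
by rewrite addrC -subr_eq subrr => /eqP <-.
Qed.

Variable u : 'rV[R]_N.
Local Notation h := (hmat u).
Hypothesis circ : forall i k, h i k * (h i k)^* = 1.

Lemma hmat_neq0 i k : h i k != 0.
Proof. by apply/eqP => e; have := circ i k; rewrite e mul0r => /eqP; rewrite eq_sym oner_eq0. Qed.

Lemma hmat_inv i k : (h i k)^-1 = (h i k)^*.
Proof. by rewrite -[RHS]mul1r -[X in X * _](mulVf (hmat_neq0 i k)) -mulrA circ mulr1. Qed.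

(** For real theta, the infinitesimal rotation of the phases of the entries: a vector tangent to |h|
    = 1. *)
Definition turn th : 'M[C]_6 := \matrix_(i, k) (I * th i k * h i k).

Lemma conjI : I^* = - I.
Proof. by apply/eqP; rewrite eq_complex /= oppr0 !eqxx. Qed.

Lemma I_neq0 : I != 0.
Proof. by rewrite eq_complex /= oner_eq0 andbF. Qed.

Lemma conjM (y z : C) : (y * z)^* = y^* * z^*. Proof. exact: rmorphM. Qed.
Lemma conjD (y z : C) : (y + z)^* = y^* + z^*. Proof. exact: rmorphD. Qed.
Lemma conjN (z : C) : (- z)^* = - z^*. Proof. exact: rmorphN. Qed.

Lemma turnE th i k : turn th i k = I * th i k * h i k. Proof. by rewrite mxE. Qed.

Lemma sesq_turn t th : (forall i k, (th i k)^* = th i k) ->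
  sesq t (turn th) h + sesq t h (turn th) = match t with
  | inl (inr (b, s, _)) => let: (i, j) := upair b s in
      I * \sum_k h i k / h j k * (th i k - th j k)
  | inr (inl s) => let: (k, l) := col_pair s in
      I * \sum_i h i l / h i k * (th i l - th i k)
  | _ => 0
  end.
Proof.
move=> thr; case: t => [[[i k]|[[b s] c]]|[s|s]] /=.
- by rewrite !turnE !conjM !thr conjI; ring.
- case: (upair b s) => i j /=; rewrite -big_split mulr_sumr; apply: eq_bigr => k _ /=.
  by rewrite !turnE !conjM !thr conjI hmat_inv; ring.
- case: (col_pair s) => k l /=; rewrite -big_split mulr_sumr; apply: eq_bigr => i _ /=.
  by rewrite !turnE !conjM !thr conjI hmat_inv; ring.
- by rewrite addr0.
Qed.

Lemma reim_I z : reim false (I * z) = reim true z.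
Proof. by case: z => a b /=; ring. Qed.

(** Real solutions theta vanish because [turn] sends them into the kernel of the Jacobian. At a
    unimodular h the complex system is stable under conjugation, which reduces complex solutions to
    real ones. *)
Lemma Mx_unit_tangent_kernel : Mx u \in unitmx -> tangent_kernel h.
Proof.
move=> uM.
have real0 th : (forall i k, (th i k)^* = th i k) ->
    (forall i k, i = o0 \/ k = o0 -> th i k = 0) ->
    (forall i j : 'I_6, i != j -> (i < 3)%N = (j < 3)%N ->
       \sum_k h i k / h j k * (th i k - th j k) = 0) ->
    (forall k l : 'I_6, (k < 2)%N -> (k < l)%N ->
       \sum_i (h i l / h i k + h i k / h i l) * (th i l - th i k) = 0) ->
    (forall s, th (param s).1 (param s).2 = 0) -> th = 0.
  move=> thr th0 rows cols par.
  have [i k /th0 e|v vE] := dhmat_surj (A := turn th); first by rewrite turnE e mulr0 mul0r.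
  have v0 : v *m Mx u = 0.
    apply/rowP => k; rewrite mul_Mx mxE /form vE /bilin sesq_turn//.
    case: (eq_of k) => [[[i k']|[[b s] c]]|[s|s]] /=; rewrite ?addr0//.
    - have ij := upair_neq b s; have ij3 := upair_block b s.
      by case: (upair b s) ij ij3 => i j /= ij ij3; rewrite rows// mulr0; case: c.
    - have := col_pair_lt s; case: (col_pair s) => k1 l1 /= [k2 kl].
      rewrite -/(reim false _) reim_I; set w := \sum_i _.
      (* For real theta the column equation is w + conj w = 0, so it is equivalent to the real
         equation Re w = 0. *)
      have : w + w^* = 0.
        rewrite -[RHS](cols k1 l1)// /w conj_sum -big_split; apply: eq_bigr => i _ /=.
        by rewrite !hmat_inv !conjM conjD conjN !thr !conjCK; ring.
      by case: w => a b' /eqP; rewrite eq_complex /= => /andP[/eqP + _]; lra.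
    - rewrite turnE par mulr0 mul0r/=; ring.
  have {}v0 : v = 0 by rewrite -(mulmxK uM v) v0 mul0mx.
  apply/matrixP => i k; have := vE; rewrite v0 dhmat0 => /matrixP/(_ i k).
  rewrite turnE mxE => /esym/eqP; rewrite !mulf_eq0 (negbTE (hmat_neq0 _ _)) orbF.
  by rewrite (negbTE I_neq0) /= => /eqP.
move=> th th0 rows cols p11 p12 p13 p21.
have mE i k : (map_mx Num.conj th) i k = (th i k)^* by rewrite mxE.
have conj_rows th' : th' = map_mx Num.conj th -> forall i j : 'I_6, i != j -> (i < 3)%N = (j < 3)%N ->
     \sum_k h i k / h j k * (th' i k - th' j k) = 0.
  move=> -> i j ij ij3.
  transitivity (- (\sum_k h j k / h i k * (th j k - th i k))^*); last first.
    by rewrite rows ?conjC0 ?oppr0// eq_sym.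
  rewrite conj_sum -sumrN; apply: eq_bigr => k _.
  by rewrite !mE !hmat_inv !conjM conjD conjN !conjCK; ring.
have conj_cols th' : th' = map_mx Num.conj th -> forall k l : 'I_6, (k < 2)%N -> (k < l)%N ->
    \sum_i (h i l / h i k + h i k / h i l) * (th' i l - th' i k) = 0.
  move=> -> k l k2 kl.
  transitivity (\sum_i (h i l / h i k + h i k / h i l) * (th i l - th i k))^*; last first.
    by rewrite cols// conjC0.
  rewrite conj_sum; apply: eq_bigr => i _.
  by rewrite !mE !hmat_inv !conjM !conjD !conjM conjN !conjCK; ring.
pose tc := map_mx Num.conj th.
have comb a : (forall i k, (a * th i k + a^* * tc i k)^* = a * th i k + a^* * tc i k) ->
    a *: th + a^* *: tc = 0.
  have cE i k : (a *: th + a^* *: tc) i k = a * th i k + a^* * tc i k by rewrite !mxE.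
  move=> ar; apply: real0.
  - by move=> i k; rewrite cE.
  - by move=> i k ik; rewrite cE [tc _ _]mxE th0// conjC0 !mulr0 addr0.
  - move=> i j ij ij3; transitivity (a * (\sum_k h i k / h j k * (th i k - th j k)) +
        a^* * (\sum_k h i k / h j k * (tc i k - tc j k))).
      rewrite !mulr_sumr -big_split; apply: eq_bigr => k _ /=; rewrite !cE; ring.
    by rewrite rows// conj_rows// !mulr0 addr0.
  - move=> k l k2 kl; transitivity (a * (\sum_i (h i l / h i k + h i k / h i l) * (th i l - th i k)) +
        a^* * (\sum_i (h i l / h i k + h i k / h i l) * (tc i l - tc i k))).
      rewrite !mulr_sumr -big_split; apply: eq_bigr => i _ /=; rewrite !cE; ring.
    by rewrite cols// conj_cols// !mulr0 addr0.
  - move=> s; rewrite cE [tc _ _]mxE.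
    suff -> : th (param s).1 (param s).2 = 0 by rewrite conjC0 !mulr0 addr0.
    by case: s => -[|[|[|[|//]]]] ?.
(* The factors 1 and i give the real and the imaginary part of theta. *)
have c1 := comb 1; have cI := comb I.
have tcE i k : tc i k = (th i k)^* by rewrite mxE.
have {}c1 : 1 *: th + 1^* *: tc = 0.
  by apply: c1 => i k; rewrite conjC1 !mul1r conjD tcE conjCK addrC.
have {}cI : I *: th + I^* *: tc = 0.
  by apply: cI => i k; rewrite conjD !conjM tcE !conjCK addrC.
have pt a i k : a *: th + a^* *: tc = 0 -> a * th i k + a^* * (th i k)^* = 0.
  by move/matrixP/(_ i k); rewrite !mxE.
apply/matrixP => i k; rewrite mxE; move: (pt I i k cI) (pt 1 i k c1).
move: (th i k) => z; rewrite conjI conjC1 !mul1r.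
move=> e1 e2; have := congr1 ( *%R I) e2; rewrite mulr0 mulrDr => e3.
have : 2%:R * (I * z) = 0.
  transitivity ((I * z + - I * z^*) + (I * z + I * z^*)); first by ring.
  by rewrite e1 e3 addr0.
by move=> /eqP; rewrite !mulf_eq0 (negbTE I_neq0) pnatr_eq0 /= => /eqP.
Qed.

(** Linearized unimodularity says that theta = - i dh / h is real. The parameter equations control
    Im (i theta h) = theta Re h, whence the condition on the real parts. *)
Lemma tangent_kernel_Mx_unit : (forall s, complex.Re (h (param s).1 (param s).2) != 0) ->
  tangent_kernel h -> Mx u \in unitmx.
Proof.
move=> par ker; rewrite -row_free_unit -kermx_eq0; apply/rowV0P => v /sub_kermxP vM.
have fv t : bilin t (dhmat v) h + lin t (dhmat v) = 0.
  by have [k <-] := eq_ofP t; have := mul_Mx u v k; rewrite vM mxE => /esym.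
pose th : 'M[C]_6 := \matrix_(i, k) (- I * dhmat v i k * (h i k)^*).
have II : I * I = -1 by rewrite -expr2 sqr_i.
have tE : turn th = dhmat v.
  apply/matrixP => i k; rewrite turnE [th _ _]mxE.
  by rewrite -[RHS]mul1r -(circ i k); ring: II.
apply: dhmat_inj; rewrite -tE.
suff -> : th = 0 by apply/matrixP => i k; rewrite turnE !mxE mulr0 mul0r.
have border i k : i = o0 \/ k = o0 -> dhmat v i k = 0 by move=> ik; exact: ext0.
have th0 i k : i = o0 \/ k = o0 -> th i k = 0.
  by move=> ik; rewrite mxE border// mulr0 mul0r.
have e0 : o0 = ord0 by apply: val_inj.
have thr i k : (th i k)^* = th i k.
  have [<-|i0] := eqVneq o0 i; first by rewrite th0 ?conjC0//; left.
  have [<-|k0] := eqVneq o0 k; first by rewrite th0 ?conjC0//; right.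
  have [i' iE _] := unlift_some i0; have [k' kE _] := unlift_some k0.
  have := fv (inl (inl (i', k'))); rewrite /= addr0 /bilin /sesq -iE -kE => re0.
  have e : dhmat v i k * (h i k)^* + h i k * (dhmat v i k)^* = 0.
    apply: reim_eq0; first exact: re0.
    by case: (dhmat v i k) (h i k) => a b [c d] /=; ring.
  rewrite mxE !conjM conjN conjI conjCK opprK.
  transitivity (I * (dhmat v i k * (h i k)^* + h i k * (dhmat v i k)^*) - I * dhmat v i k * (h i k)^*).
    by ring.
  by rewrite e mulr0 add0r !mulNr.
have fth t : reim (part t) (sesq t (turn th) h + sesq t h (turn th)) + lin t (turn th) = 0.
  by rewrite tE; exact: fv.
have rows b s : let: (i, j) := upair b s in \sum_k h i k / h j k * (th i k - th j k) = 0.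
  have := fth (inl (inr (b, s, true))); have := fth (inl (inr (b, s, false))).
  rewrite !sesq_turn// /= !addr0; case: (upair b s) => i j; set w := \sum_k _ => e1 e2.
  by have /eqP := reim_eq0 e2 e1; rewrite mulf_eq0 (negbTE I_neq0) => /eqP.
apply: ker => //.
- move=> i j ij ij3; have [b [s [e|e]]] := upairP ij ij3; have := rows b s; rewrite e//.
  move=> r; transitivity (- (\sum_k h j k / h i k * (th j k - th i k))^*); last first.
    by rewrite r ?conjC0 ?oppr0.
  rewrite conj_sum -sumrN; apply: eq_bigr => k _.
  by rewrite !hmat_inv !conjM conjD conjN !conjCK !thr; ring.
- move=> k l k2 kl; have [s [kE lE]] := col_pairP k2 kl.
  have := fth (inr (inl s)); rewrite sesq_turn// [lin _ _]/= addr0.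
  case: (col_pair s) kE lE => k1 l1 /= <- <-; rewrite -/(reim false _) reim_I.
  set w := \sum_i _ => re0; transitivity (w + w^*).
    rewrite /w conj_sum -big_split; apply: eq_bigr => i _ /=.
    by rewrite !hmat_inv !conjM conjD conjN !thr !conjCK; ring.
  by move: re0; case: (w) => a b /= ->; apply/eqP; rewrite eq_complex /= addr0 subrr !eqxx.
all: suff pz s : th (param s).1 (param s).2 = 0.
all: try exact: (pz (@Ordinal 4 0 isT)).
all: try exact: (pz (@Ordinal 4 1 isT)).
all: try exact: (pz (@Ordinal 4 2 isT)).
all: try exact: (pz (@Ordinal 4 3 isT)).
all: have := fth (inr (inr s)); rewrite sesq_turn// reim0 add0r /lin turnE -mulrA reim_I.
all: move: (thr (param s).1 (param s).2) (par s).
all: case: (th _ _) => a b; case: (h _ _) => c d /eqP; rewrite eq_complex /=.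
all: move=> /andP[_ /eqP bb] c0 /eqP; have -> : b = 0 by lra.
all: by rewrite mul0r subr0 mulf_eq0 (negbTE c0) orbF => /eqP->.
Qed.


End Kernels.

Section BaseValues.
Variable R : realType.
Local Notation C := R[i].
Local Notation "z ^*" := (Num.conj z) : ring_scope.
Local Notation "z ^*" := (Num.conj z) : complex_scope.
Local Notation N := #|unknown|.

Definition w3 : C := (- 2^-1) +i* (Num.sqrt 3 / 2).

Lemma w3E : w3 ^+ 2 = - 1 - w3.
Proof.
have s3 : Num.sqrt 3 ^+ 2 = 3 :> R by rewrite sqr_sqrtr.
apply/eqP; rewrite expr2 eq_complex /=; apply/andP; split; apply/eqP; last by field.
by field: s3.
Qed.

Lemma h0_circ i k : h0 w3 i k * (h0 w3 i k)^* = 1.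
Proof.
have c1 : (1 + w3) * (1 + w3)^* = 1.
  have s3 : Num.sqrt 3 ^+ 2 = 3 :> R by rewrite sqr_sqrtr.
  by apply/eqP; rewrite eq_complex /=; apply/andP; split; apply/eqP; field: s3.
by rewrite /h0 rmorphXn /= -exprMn c1 expr1n.
Qed.

(** The exponents of the four entries are 1, 3, 3, 2, with real parts 1/2, -1, -1, -1/2. *)
Lemma h0_param s : complex.Re (h0 w3 (param s).1 (param s).2) != 0.
Proof.
have s3 : Num.sqrt 3 * Num.sqrt 3 = 3 :> R by rewrite -expr2 sqr_sqrtr.
by case: s => -[|[|[|[|//]]]] ?; rewrite /h0 /expo /=; apply/eqP; nra.
Qed.

Lemma base_point : exists u0 : 'rV[R]_N, forall i k, hmat u0 i k = h0 w3 i k.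
Proof.
pose A : 'M[C]_6 := \matrix_(i, k) (h0 w3 i k) - ones R.
have [i k ik|u0 u0E] := dhmat_surj (A := A).
  rewrite !mxE; case: ik => ->; rewrite ?h0_row ?h0_col eqxx ?orbT subrr//.
by exists u0 => i k; rewrite /hmat u0E subrK mxE.
Qed.
End BaseValues.

Section Family.
Variable R : realType.
Local Notation C := R[i].
Local Notation "z ^*" := (Num.conj z) : ring_scope.
Local Notation "z ^*" := (Num.conj z) : complex_scope.
Local Notation N := #|unknown|.
Local Notation h0 := (h0 (w3 R)).

Definition csmooth (V : set 'rV[R]_4) (f : 'rV[R]_4 -> C) : Prop :=
  forall c k, smooth_to V k (fun t => reim c (f t)).

Theorem hadamard_family : exists (V : set 'rV[R]_4) (H : 'rV[R]_4 -> 'M[C]_6) (t0 : 'rV[R]_4),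
  [/\ open V, V t0, (forall i k, H t0 i k = h0 i k), (forall i k, csmooth V (fun t => H t i k))
    & forall t, V t -> [/\ (forall k, H t o0 k = 1 /\ H t k o0 = 1),
        (forall i k, H t i k * (H t i k)^* = 1),
        (forall i j : 'I_6, i != j -> (i < 3)%N = (j < 3)%N -> \sum_k H t i k / H t j k = 0) /\
        (forall k l : 'I_6, (k < 2)%N -> (k < l)%N ->
           \sum_i H t i l / H t i k = \sum_i H t i k / H t i l),
        tangent_kernel (H t)
      & forall s, complex.Im (H t (param s).1 (param s).2) = t 0 s]].
Proof.
have [u0 u0E] := base_point R.
have c0 i k : hmat u0 i k * (hmat u0 i k)^* = 1 by rewrite u0E h0_circ.
have uM : Mx u0 \in unitmx.
  apply: tangent_kernel_Mx_unit => //; first by move=> s; rewrite u0E h0_param.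
  have -> : fun_of_matrix (hmat u0) = h0 by apply/funext => i; apply/funext => k.
  exact: base_tangent_kernel (w3E R).
(* Only the right-hand sides of the four parameter equations move; the others keep their value at
   the base matrix. *)
pose P : 'M[R]_(4, N) := \matrix_(s, k) (eq_of k == inr (inr s))%:R.
pose t0 : 'rV[R]_4 := \row_s complex.Im (h0 (param s).1 (param s).2).
have [V [Y [Vo Vt0 Y0 YP [Ys _]]]] := quadratic_ift (@MxE R) (@PsiB R) P t0 uM.
exists V, (fun t => hmat (Y t)), t0; split=> //.
- by move=> i k; rewrite Y0.
- move=> i k c n; have [ik|ik] := boolP ((i == o0) || (k == o0)).
    apply: (smooth_to_ext Vo (f := fun=> reim c 1)); last exact: smooth_to_cst.
    by move=> t _; rewrite hmat_border//; case/orP: ik => /eqP; [left|right].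
  move: ik; rewrite negb_or => /andP[i0 k0].
  have [i' iE _] := unlift_some (h := o0) (i := i) (ltac:(by rewrite eq_sym)).
  have [k' kE _] := unlift_some (h := o0) (i := k) (ltac:(by rewrite eq_sym)).
  apply: (smooth_to_ext Vo _ (Ys n (enum_rank (c, (i', k'))))) => t _.
  rewrite iE kE !mxE !liftK !mxE eq_sym (negbTE (neq_lift _ _)) eq_sym (negbTE (neq_lift _ _)) addr0.
  by case: c.
move=> t Vt; have [YE YM] := YP t Vt.
have qE q : quad q (hmat (Y t)) = quad q (hmat u0) + \sum_s (t 0 s - t0 0 s) * (q == inr (inr s))%:R.
  have [k <-] := eq_ofP q; move: YE => /rowP/(_ k); rewrite !mxE => ->.
  by congr (_ + _); apply: eq_bigr => s _; rewrite !mxE.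
have qE0 q : quad (inl q) (hmat (Y t)) = quad (inl q) (hmat u0).
  by rewrite qE big1 ?addr0// => s _; rewrite mulr0.
have e0 : o0 = ord0 by apply: val_inj.
have circ i k : hmat (Y t) i k * (hmat (Y t) i k)^* = 1.
  have [<-|i0] := eqVneq o0 i; first by rewrite hmat_border ?conjC1 ?mulr1//; left.
  have [<-|k0] := eqVneq o0 k; first by rewrite hmat_border ?conjC1 ?mulr1//; right.
  have [i' iE _] := unlift_some i0; have [k' kE _] := unlift_some k0.
  have := qE0 (inl (i', k')); rewrite /quad /sesq -iE -kE c0 /= !addr0.
  by case: (hmat (Y t) i k) => a b /= e; apply/eqP; rewrite eq_complex /= e eqxx /=; apply/eqP; ring.
have row_orth0 i j : i != j -> \sum_k h0 i k / h0 j k = 0.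
  apply: rows_orthogonal; first exact: h0_neq0 (w3E R).
    by rewrite pnatr_eq0.
  exact: h0_orth (w3E R).
have upair_orth b s : \sum_k hmat (Y t) (upair b s).1 k / hmat (Y t) (upair b s).2 k = 0.
  have s0 : sesq (inl (inr (b, s, true))) (hmat u0) (hmat u0) = 0.
    apply: etrans (row_orth0 _ _ (upair_neq b s)).
    by apply: eq_bigr => k _; rewrite -!u0E (hmat_inv c0).
  have sE c : reim c (sesq (inl (inr (b, s, c))) (hmat (Y t)) (hmat (Y t))) = 0.
    by have := qE0 (inr (b, s, c)); rewrite /quad /= !addr0 => ->; rewrite [X in reim _ X]s0 reim0.
  apply: etrans (reim_eq0 (sE true) (sE false)); apply: eq_bigr => k _.
  by rewrite (hmat_inv circ).
split.
- by move=> k; split; rewrite hmat_border//; [left|right].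
- exact: circ.
- split.
    move=> i j ij ij3; have [b [s [e|e]]] := upairP ij ij3; have := upair_orth b s; rewrite e//=.
    move=> r; transitivity ((\sum_k hmat (Y t) j k / hmat (Y t) i k)^*); last by rewrite r conjC0.
    rewrite conj_sum; apply: eq_bigr => k _.
    by rewrite !(hmat_inv circ) conjM conjCK mulrC.
  move=> k l k2 kl; have [s [-> ->]] := col_pairP k2 kl.
  (* For unimodular entries, exchanging the two columns conjugates the sum, so symmetry is the
     vanishing of its imaginary part. *)
  have im0 : complex.Im (\sum_i hmat (Y t) i (col_pair s).2 / hmat (Y t) i (col_pair s).1) = 0.
    have := qE (inr (inl s)); rewrite big1 ?addr0 => [|s' _]; last by rewrite mulr0.
    rewrite /quad /= !addr0; under eq_bigr do rewrite -(hmat_inv circ).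
    move=> ->; under eq_bigr do rewrite -(hmat_inv c0) !u0E.
    rewrite h0_orth//; first exact: w3E.
    by have := (col_pair_lt s).2; rewrite eq_sym -(inj_eq val_inj) => /ltn_eqF/negbT; rewrite eq_sym.
  have -> : \sum_i hmat (Y t) i (col_pair s).1 / hmat (Y t) i (col_pair s).2 =
      (\sum_i hmat (Y t) i (col_pair s).2 / hmat (Y t) i (col_pair s).1)^*.
    rewrite conj_sum; apply: eq_bigr => i _.
    by rewrite !(hmat_inv circ) conjM conjCK mulrC.
  by move: im0; case: (\sum_i _) => a b /= ->; apply/eqP; rewrite eq_complex /= oppr0 !eqxx.
- exact: Mx_unit_tangent_kernel.
- move=> s; have := qE (inr (inr s)); rewrite /quad /= ?add0r u0E => ->.
  rewrite (bigD1 s)//= big1 ?addr0 => [|s' ss]; last first.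
    by rewrite (inj_eq inr_inj) (inj_eq inr_inj) eq_sym (negbTE ss) mulr0.
  by rewrite eqxx mulr1 mxE addrC subrK.
Qed.
End Family.

(** * The chart *)

Section ComplexFunctions.
Variables (R : realType) (T : Type) (P : (T -> R) -> Prop).
Local Notation C := R[i].
Hypothesis Pcst : forall c, P (fun=> c).
Hypothesis PD : forall f g, P f -> P g -> P (fun t => f t + g t).
Hypothesis PM : forall f g, P f -> P g -> P (fun t => f t * g t).

(** Here [P] is an algebra of real functions: smooth ones of the parameters, or continuous ones on
    [XR]. *)
Definition complexify (f : T -> C) : Prop := forall c, P (fun t => reim c (f t)).

Lemma complexify_cst z : complexify (fun=> z).
Proof. by move=> c; exact: Pcst. Qed.

Lemma complexifyD f g : complexify f -> complexify g -> complexify (fun t => f t + g t).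
Proof.
move=> cf cg c; rewrite (_ : (fun _ => _) = fun t => reim c (f t) + reim c (g t)); first exact: PD.
by apply/funext => t; rewrite reimD.
Qed.

Lemma complexifyM f g : complexify f -> complexify g -> complexify (fun t => f t * g t).
Proof.
move=> cf cg [].
  rewrite (_ : (fun _ => _) = fun t => reim true (f t) * reim true (g t) +
    (-1) * (reim false (f t) * reim false (g t))).
    by apply: PD; [apply: PM|apply: PM => //; apply: PM].
  by apply/funext => t; case: (f t) (g t) => a b [a' b'] /=; ring.
rewrite (_ : (fun _ => _) = fun t => reim true (f t) * reim false (g t) +
    reim false (f t) * reim true (g t)).
  by apply: PD; apply: PM.
by apply/funext => t; case: (f t) (g t) => a b [a' b'] /=; ring.
Qed.

Lemma complexify_conj f : complexify f -> complexify (fun t => Num.conj (f t)).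
Proof.
move=> cf [].
  rewrite (_ : (fun _ => _) = fun t => reim true (f t)); first exact: cf.
  by apply/funext => t; case: (f t).
rewrite (_ : (fun _ => _) = fun t => (-1) * reim false (f t)); first exact: PM.
by apply/funext => t; case: (f t) => a b /=; ring.
Qed.

Lemma complexify_sum (I : Type) (r : seq I) (f : I -> T -> C) :
  (forall i, complexify (f i)) -> complexify (fun t => \sum_(i <- r) f i t).
Proof.
move=> cf; elim: r => [|i r IH].
  rewrite (_ : (fun _ => _) = fun=> 0); first exact: complexify_cst.
  by apply/funext => t; rewrite big_nil.
rewrite (_ : (fun _ => _) = fun t => f i t + \sum_(j <- r) f j t); first exact: complexifyD.
by apply/funext => t; rewrite big_cons.
Qed.

Lemma complexify_prod (I : Type) (r : seq I) (f : I -> T -> C) :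
  (forall i, complexify (f i)) -> complexify (fun t => \prod_(i <- r) f i t).
Proof.
move=> cf; elim: r => [|i r IH].
  rewrite (_ : (fun _ => _) = fun=> 1); first exact: complexify_cst.
  by apply/funext => t; rewrite big_nil.
rewrite (_ : (fun _ => _) = fun t => f i t * \prod_(j <- r) f j t); first exact: complexifyM.
by apply/funext => t; rewrite big_cons.
Qed.

Lemma complexify_exp f n : complexify f -> complexify (fun t => f t ^+ n).
Proof.
move=> cf; elim: n => [|n IH]; first exact: complexify_cst.
rewrite (_ : (fun _ => _) = fun t => f t * f t ^+ n); first exact: complexifyM.
by apply/funext => t; rewrite exprS.
Qed.

Lemma complexify_polyfun n (F : config R n -> C) (x : T -> config R n) :
  polyfun F -> (forall l, complexify (fun t => coord_of (x t) l)) -> complexify (fun t => F (x t)).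
Proof.
move=> [_ [p [Fp _]]] cx; rewrite (_ : (fun _ => _) = fun t =>
    \sum_(m <- msupp p) mcoeff m p * \prod_i coord_of (x t) i ^+ m i).
  apply: complexify_sum => m; apply: complexifyM; first exact: complexify_cst.
  by apply: complexify_prod => i; apply: complexify_exp.
by apply/funext => t; rewrite Fp mevalE.
Qed.

End ComplexFunctions.

(** * Unitary invariants recovering the parameters *)

Section Invariant.
Variable R : realType.
Local Notation C := R[i].
Local Notation "z ^*" := (Num.conj z) : ring_scope.
Local Notation "z ^*" := (Num.conj z) : complex_scope.

(** Equal to [hcfg h] for unimodular h, but polynomial in real and imaginary parts, and Hermitian
    for every h. *)
Definition ucfg (h : 'M[C]_6) : config R 6 :=
  (fun i => delta_mx i i, fun j => \matrix_(k, l) (6%:R^-1 * (h k j * (h l j)^*))).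

(* Four-cycles of scalar products are invariant under U(n); on ucfg h these ones
   recover the parameters. *)
Definition four_cycle (s : 'I_4) (x : config R 6) : C :=
  \tr (x.1 o0 *m x.2 (param s).2 *m x.1 (param s).1 *m x.2 o0).
Definition psi (x : config R 6) : 'rV[R]_4 :=
  \row_s (- 36%:R * complex.Im (four_cycle s x)).

Lemma psi_conj u x : u \is unitarymx -> psi (conj_config u x) = psi x.
Proof.
move=> uU; apply/rowP => s; rewrite !mxE; congr (_ * complex.Im _).
have uu := unitarymxV uU; rewrite /four_cycle /=.
set u' := u^t* in uu *; set p := x.1 o0; set q := x.2 _; set p' := x.1 _; set q' := x.2 o0.
have m (M N : 'M[C]_6) : u *m M *m u' *m (u *m N *m u') = u *m (M *m N) *m u'.
  by rewrite !mulmxA -(mulmxA _ u' u) uu mulmx1.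
by rewrite !m mxtrace_mulC mulmxA uu mul1mx.
Qed.

(** For k, j the indices [param s], the four-cycle is conj (h_kj) / 36 when h is dephased, hence the
    factor -36 in [psi]. *)
Lemma psi_ucfg (h : 'M[C]_6) s : (forall k, h o0 k = 1 /\ h k o0 = 1) ->
  psi (ucfg h) 0 s = complex.Im (h (param s).1 (param s).2).
Proof.
move=> h1; rewrite mxE /four_cycle /=; set k := (param s).1; set j := (param s).2.
rewrite -!mulmxA mxtrace_delta_mul mulmxA mul_delta_mulE !mxE !(h1 _).1 !(h1 _).2.
case: (h k j) => a b; rewrite !conjC1 !mulr1 !mul1r.
have -> : (6%:R^-1 : C) = (6%:R^-1)%:C by rewrite fmorphV rmorph_nat.
by rewrite /=; field.
Qed.

Lemma ucfg_hcfg (h : 'M[C]_6) : (forall i k, h i k * (h i k)^* = 1) -> ucfg h = hcfg h.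
Proof.
move=> hc; congr pair; apply/funext => j; apply/matrixP => k l; rewrite !mxE.
have h0 i m : h i m != 0.
  by apply/eqP => e; have := hc i m; rewrite e mul0r => /eqP; rewrite eq_sym oner_eq0.
have -> : (h l j)^* = (h l j)^-1 by apply: (mulfI (h0 l j)); rewrite hc divff.
by field; rewrite h0.
Qed.

Lemma ucfg_hermitian (h : 'M[C]_6) i :
  (ucfg h).1 i = ((ucfg h).1 i)^t* /\ (ucfg h).2 i = ((ucfg h).2 i)^t*.
Proof.
split; apply/matrixP => k l; rewrite !mxE; first by rewrite conjC_nat andbC.
by rewrite !rmorphM /= conjCK fmorphV /= conjC_nat [in RHS](mulrC (_^*)).
Qed.
End Invariant.

Section Topology.
Variable R : realType.
Local Notation C := R[i].

Lemma reim_continuous c : continuous (reim c : (R[i])^o -> R).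
Proof.
move=> z; apply: (@cvgrPdist_lt R R _ (nbhs (z : (R[i])^o)) _ (reim c) (reim c z)).2 => e e0.
apply: (nbhs_normP (z : (R[i])^o) _).2.
exists e%:C; first by rewrite /= ltcR.
move=> y /=; rewrite -reimB => h; rewrite -ltcR; apply: le_lt_trans h.
by case: (z - y) c => a b [] /=; rewrite normc_def/= lecR;
  rewrite -(sqrtr_sqr _) ler_wsqrtr// ?lerDl ?lerDr sqr_ge0.
Qed.

Lemma coord_XR_continuous c l :
  continuous (fun x : XR R 6 => reim c (coord_of (val x) l)).
Proof.
move=> x; apply: (@continuous_comp (XR R 6) _ R (fun x : XR R 6 => config_coord (val x) 0 l
   : (R[i])^o) (reim c)); last exact: reim_continuous.
apply: (@continuous_comp (XR R 6) _ _ (fun x : XR R 6 => config_coord (val x))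
   (fun y : 'rV[(R[i])^o]_(ncoord 6) => y 0 l)); last exact: coord_continuous.
apply: (@continuous_comp (XR R 6) (config R 6) _ (fun x : XR R 6 => val x)
   (@config_coord R 6)); last exact: initial_continuous.
exact: initial_continuous.
Qed.

Lemma complexify_continuous_cc (F : config R 6 -> C) : polyfun F ->
  complexify (fun f : XR R 6 -> R => continuous f) (fun x : XR R 6 => F (val x)).
Proof.
move=> pF; apply: (complexify_polyfun _ _ _ pF).
- by move=> a x; exact: cst_continuous.
- by move=> f g cf cg x; exact: continuousD (cf x) (cg x).
- by move=> f g cf cg x; exact: continuousM (cf x) (cg x).
- by move=> l c; exact: coord_XR_continuous.
Qed.

Lemma four_cycle_polyfun s : polyfun (@four_cycle R s).
Proof.
apply: polyfun_sum => i; have H := mdpoly_mul (mdpoly_mul (mdpoly_mul (@mdpoly_p R 6 o0)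
  (@mdpoly_q R 6 (param s).2)) (@mdpoly_p R 6 (param s).1)) (@mdpoly_q R 6 o0).
by eexists; exact: (H i i).
Qed.

Lemma psi_continuous : continuous (fun x : XR R 6 => psi (val x)).
Proof.
move=> x; have FF : Filter (nbhs x) := @nbhs_filter (XR R 6) x.
apply: (@cvgrPdist_le R 'rV[R]_4 _ (nbhs x) _ _ _).2 => e e0.
suff near_x : \forall y \near x, forall s, `|psi (val x) 0 s - psi (val y) 0 s| <= e.
  apply: (filterS _ near_x) => y hy; apply: norm_rV_le => [|s]; first exact: ltW.
  by have := hy s; rewrite !mxE.
apply: (@filter_forall _ _ (fun s y => `|psi (val x) 0 s - psi (val y) 0 s| <= e) _ FF) => s.
have cs : {for x, continuous (fun x : XR R 6 => - 36%:R * reim false (four_cycle s (val x)))}.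
  have cf : continuous (fun x : XR R 6 => reim false (four_cycle s (val x))).
    by have := complexify_continuous_cc (@four_cycle_polyfun s); exact.
  have cM (f g : XR R 6 -> R) : continuous f -> continuous g -> continuous (fun x => f x * g x).
    by move=> c1 c2 y; exact: continuousM (c1 y) (c2 y).
  have c36 : continuous (fun _ : XR R 6 => - 36%:R : R) by move=> y; exact: cst_continuous.
  by have := cM _ _ c36 cf x.
have near_s := (@cvgrPdist_le R R _ (nbhs x) FF _ _).1 cs e e0.
apply: (filterS _ near_s) => y.
by rewrite !mxE.
Qed.

Lemma orbit_classP (x y : XR R 6) : orbit_class x = orbit_class y ->
  exists2 u : 'M[C]_6, u \is unitarymx & val y = conj_config u (val x).
Proof. by move=> /eqmodP/asboolP. Qed.

(** By invariance the preimage of this set in [XR] is the preimage of [W] by [psi], and openness in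
    the quotient is tested on preimages. *)
Lemma open_psi (W : set 'rV[R]_4) : open W ->
  open [set s : MR R 6 | exists2 x : XR R 6, orbit_class x = s & W (psi (val x))].
Proof.
move=> Wo; set O := [set s | _].
have : open (@orbit_class R 6 @^-1` O).
  rewrite (_ : _ @^-1` _ = (fun x : XR R 6 => psi (val x)) @^-1` W).
    by apply: open_comp => // x _; exact: psi_continuous.
  apply/seteqP; split=> x /=; last by move=> Wx; exists x.
  move=> [y yx]; have [u uU ->] := orbit_classP yx; by rewrite psi_conj.
by [].
Qed.
End Topology.

Section Chart.
Variable R : realType.
Local Notation C := R[i].
Local Notation "z ^*" := (Num.conj z) : ring_scope.
Local Notation "z ^*" := (Num.conj z) : complex_scope.

Lemma smooth_to_sub d (U V : set 'rV[R]_d.+1) k f : U `<=` V -> smooth_to V k f -> smooth_to U k f.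
Proof.
move=> UV; elim: k f => [|k IH] f [cf sf].
  by split=> // t Ut; exact: (cf t (UV t Ut)).
case: sf => df Df; split; first by move=> t Ut; exact: (cf t (UV t Ut)).
by split=> [t v Ut|v]; [exact: (df t v (UV t Ut))|exact: (IH _ (Df v))].
Qed.

Lemma csmooth_ucfg_cc V (H : 'rV[R]_4 -> 'M[C]_6) : open V ->
  (forall i k, csmooth V (fun t => H t i k)) ->
  forall l, csmooth V (fun t => coord_of (ucfg (H t)) l).
Proof.
move=> Vo sH l; pose P f := forall k, @smooth_to R 3 V k f.
have Pcst c : P (fun=> c) by move=> k; exact: smooth_to_cst.
have PM f g : P f -> P g -> P (fun t => f t * g t) by move=> sf sg k; exact: smooth_toM.
have PD f g : P f -> P g -> P (fun t => f t + g t) by move=> sf sg k; exact: smooth_toD.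
suff : complexify P (fun t => coord_of (ucfg (H t)) l) by [].
have e t : coord_of (ucfg (H t)) l = let: (b, i, (a, c)) := enum_val l in
    if b then (delta_mx i i : 'M[C]_6) a c else 6%:R^-1 * (H t a i * (H t c i)^*).
  by rewrite /coord_of mxE; case: (enum_val l) => -[[] i] [a c] //=; rewrite mxE.
rewrite (funext e).
case: (enum_val l) => -[[] i] [a c]; first exact: (complexify_cst Pcst).
apply: (complexifyM Pcst PD PM); first exact: (complexify_cst Pcst).
by apply: (complexifyM Pcst PD PM); [|apply: (complexify_conj Pcst PM)]; move=> c' k; exact: sH.
Qed.

Lemma derive_coord (c : R) (t v : 'rV[R]_4) s : 'D_v (fun t : 'rV[R]_4 => c * t 0 s) t = c * v 0 s.
Proof.
apply: cvg_lim => //; apply: cvg_near_cst; near=> h.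
have h0 : h != 0 by near: h; exact: nbhs_dnbhs_neq.
by rewrite /= !mxE -[LHS]/(h^-1 * _); field.
Unshelve. all: by end_near.
Qed.

(** [hadamard_family] only gives the equations in each half and the nine column relations. Where
    [hpoly] does not vanish, these imply orthogonality of all columns, and the points are smooth. *)
Lemma XR_chart : exists (U : set 'rV[R]_4) (phi : 'rV[R]_4 -> XR R 6) (H : 'rV[R]_4 -> 'M[C]_6),
  [/\ open U, U !=set0, (forall i k, csmooth U (fun t => H t i k))
    & forall t, U t -> [/\ val (phi t) = ucfg (H t), (forall k, H t o0 k = 1 /\ H t k o0 = 1)
      & forall s, complex.Im (H t (param s).1 (param s).2) = t 0 s]].
Proof.
have [V [H [t0 [Vo Vt0 H0 Hs HV]]]] := hadamard_family R.
have [L hL] := base_hpoly (w3E R).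
have [f [fE fs]] : exists f : 'rV[R]_4 -> C,
    (forall t, f t = hpoly L (ucfg (H t))) /\ csmooth V f.
  exists (fun t => hpoly L (ucfg (H t))); split=> //.
  pose P g := forall k, @smooth_to R 3 V k g.
  suff : complexify P (fun t => hpoly L (ucfg (H t))) by [].
  apply: complexify_polyfun; last exact: csmooth_ucfg_cc.
  - by move=> c k; exact: smooth_to_cst.
  - by move=> g g' sg sg' k; exact: smooth_toD.
  - by move=> g g' sg sg' k; exact: smooth_toM.
  - exact: polyfun_hpoly.
pose U := [set t | V t /\ f t != 0].
have Uo : open U.
  rewrite openE => t [Vt ft].
  (* One of the real and imaginary parts is non-zero, which reduces openness to a real continuous
     function. *)
  have [c fc] : exists c, reim c (f t) != 0.
    apply: contrapT => nf; case/eqP: ft; apply: reim_eq0; apply/eqP/negPn/negP => n; apply: nf.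
      by exists true. by exists false.
  have ct := smooth_to_cont (fs c 0%N) Vt.
  have n1 : nbhs t [set s | reim c (f s) != 0] by exact: (cvgr_neq0 _ ct fc).
  have sub : V `&` [set s | reim c (f s) != 0] `<=` U.
    by move=> s [Vs fs0]; split=> //; apply: contra_neq fs0 => ->; rewrite reim0.
  exact: (filterS sub (filterI (open_nbhs_nbhs (conj Vo Vt)) n1)).
have Ut0 : U t0.
  split=> //; have [_ circ _ _ _] := HV _ Vt0; rewrite fE (ucfg_hcfg circ).
  have -> : fun_of_matrix (H t0) = h0 (w3 R) by apply/funext => i; apply/funext => k.
  exact: hL.
have XRU t : U t -> exists x : XR R 6, val x = ucfg (H t).
  move=> [Vt ft]; have [h1 circ [rows cols] ker _] := HV t Vt.
  have hn i m : H t i m != 0.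
    by apply/eqP => e; have := circ i m; rewrite e mul0r => /eqP; rewrite eq_sym oner_eq0.
  have hr k : H t o0 k = 1 by case: (h1 k).
  move: ft; rewrite fE (ucfg_hcfg circ) => ft.
  have orth : forall k l, k != l -> \sum_i H t i l / H t i k = 0.
    apply: (columns_orthogonal hn rows cols (oner_neq0 _)).
    move: ft; rewrite !mulf_eq0 !negb_or => /andP[_].
    have [-> ->] := jhat_hcfg hn hr; rewrite !scale1r mxE !eqxx.
    by move=> /minor_kernel kerM y /kerM; exact: vec36_eq0.
  have xX : XR R 6 (hcfg (H t)).
    split; first exact: (smooth_hcfg hn hr orth ker ft).
    by rewrite -ucfg_hcfg// => i; have [e1 e2] := ucfg_hermitian (H t) i; split; rewrite -?e1 -?e2.
  by exists (SigSub (mem_set xX)).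
have [x0 _] := XRU _ Ut0.
have [phi phiE] : exists phi : 'rV[R]_4 -> XR R 6, forall t, U t -> val (phi t) = ucfg (H t).
  suff : forall t, exists x : XR R 6, U t -> val x = ucfg (H t).
    by move=> /boolp.choice[phi phiE]; exists phi.
  move=> t; have [Ut|nUt] := pselect (U t); last by exists x0.
  by have [x xE] := XRU t Ut; exists x.
exists U, phi, H; split=> //; first by exists t0.
  by move=> i k c n; apply: smooth_to_sub (Hs i k c n) => t [].
by move=> t Ut; have [h1 _ _ _ him] := HV t Ut.1; split=> //; exact: phiE.
Qed.
End Chart.

Section Immersion.
Variable R : realType.
Local Notation C := R[i].

Definition entry (b : bool) (i a c : 'I_6) (x : config R 6) : C := (if b then x.1 i else x.2 i) a c.

Lemma coord_of_entry b i a c (x : config R 6) : coord_of x (enum_rank (b, i, (a, c))) = entry b i a c x.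
Proof. by rewrite /coord_of mxE enum_rankK. Qed.

(** All p_i and q_0 are constant along the family, so [a] commutes with them: it is diagonal, then
    scalar since every entry of q_0 is 1/6. Hence the derivative along [v] of every entry is zero,
    including those that give the parameters. *)
Lemma immersive_ucfg (U : set 'rV[R]_4) (phi : 'rV[R]_4 -> config R 6)
    (H : 'rV[R]_4 -> 'M[C]_6) t : open U -> U t ->
  (forall t, U t -> [/\ phi t = ucfg (H t), (forall k, H t o0 k = 1 /\ H t k o0 = 1)
    & forall s, complex.Im (H t (param s).1 (param s).2) = t 0 s]) ->
  immersive_mod_orbits phi t.
Proof.
move=> Uo Ut phiE v a _ D.
have De b i k l c : 'D_v (fun t => reim c (entry b i k l (phi t))) t =
    reim c (entry b i k l (ad_config a (phi t))).
  have [D1 D2] := D (enum_rank (b, i, (k, l))).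
  have eE x : reim true (entry b i k l x) = re_coord (enum_rank (b, i, (k, l))) x.
    by rewrite -coord_of_entry.
  have eE' x : reim false (entry b i k l x) = im_coord (enum_rank (b, i, (k, l))) x.
    by rewrite -coord_of_entry.
  case: c; first by rewrite eE -D1; congr ('D_v _ t); apply/funext => x; rewrite eE.
  by rewrite eE' -D2; congr ('D_v _ t); apply/funext => x; rewrite eE'.
have const b i k l z : (forall t, U t -> entry b i k l (phi t) = z) ->
    entry b i k l (ad_config a (phi t)) = 0.
  move=> ez; apply: reim_eq0; rewrite -De.
    rewrite -[RHS](@derive_cst R _ _ (reim true z) t v).
    by apply: near_eq_derive; apply: (near_open Uo Ut) => x Ux; rewrite ez.
  rewrite -[RHS](@derive_cst R _ _ (reim false z) t v).
  by apply: near_eq_derive; apply: (near_open Uo Ut) => x Ux; rewrite ez.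
have [phit h1 _] := phiE t Ut.
have mxBE (A B : 'M[C]_6) k l : (A - B) k l = A k l - B k l by rewrite !mxE.
have a_diag k i : k != i -> a k i = 0.
  move=> ki; have ez x : U x -> entry true i k i (phi x) = (delta_mx i i : 'M[C]_6) k i.
    by move=> Ux; have [-> _ _] := phiE x Ux.
  have := const _ _ _ _ _ ez; rewrite phit /entry /= mxBE mul_deltaE.
  rewrite [X in _ - X]mxE big1 ?oppr0 ?addr0// => m _.
  by rewrite mxE (negbTE ki) mul0r.
have a_const k : a k k = a o0 o0.
  have q0 x : U x -> forall m l, (phi x).2 o0 m l = 6%:R^-1.
    by move=> Ux m l; have [-> hx _] := phiE x Ux; rewrite mxE !(hx _).2 mul1r conjC1 mulr1.
  have := const false o0 k o0 6%:R^-1 (fun x Ux => q0 x Ux k o0).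
  rewrite /entry /= mxBE [X in X - _]mxE [X in _ - X]mxE.
  under eq_bigr do rewrite q0//.
  under [X in _ - X]eq_bigr do rewrite q0//.
  rewrite (bigD1 k)//= big1 ?addr0 => [|m mk]; last by rewrite a_diag ?mul0r// eq_sym.
  rewrite (bigD1 o0)//= big1 ?addr0 => [|m mk]; last by rewrite a_diag ?mulr0.
  rewrite mulrC -mulrBr => /eqP; rewrite mulf_eq0 invr_eq0 pnatr_eq0 /= subr_eq0.
  by move/eqP.
have aE : a = (a o0 o0)%:M.
  apply/matrixP => k l; rewrite mxE; have [->|kl] := eqVneq k l; last by rewrite a_diag.
  by rewrite a_const.
have ad0 b i k l : entry b i k l (ad_config a (phi t)) = 0.
  by rewrite /entry /ad_config aE; case: b; rewrite /= scalar_mxC subrr mxE.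
apply/rowP => s; rewrite mxE; apply: (mulfI (_ : 6%:R^-1 != 0 :> R)); first by rewrite invr_eq0 pnatr_eq0.
rewrite mulr0 -(derive_coord _ t v).
transitivity ('D_v (fun t => reim false (entry false (param s).2 (param s).1 o0 (phi t))) t).
  apply: near_eq_derive; apply: (near_open Uo Ut) => x Ux.
  have [-> hx <-] := phiE x Ux; rewrite /entry mxE (hx _).1.
  have -> : (6%:R^-1 : C) = (6%:R^-1)%:C by rewrite fmorphV rmorph_nat.
  by rewrite conjC1 mulr1 -[X in reim _ X]addr0 reim_linear reim0 addr0.
by rewrite De ad0 reim0.
Qed.
End Immersion.

Theorem theorem22 (R : realType) :
  exists S : set (MR R 6), S !=set0 /\ real_submanifold 4 S.
Proof.
have [U [phi [H [Uo [t1 Ut1] sH HU]]]] := XR_chart R.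
have psi_phi t : U t -> psi (val (phi t)) = t.
  move=> Ut; have [-> h1 him] := HU t Ut.
  by apply/rowP => s; rewrite psi_ucfg.
pose chart := @orbit_class R 6 \o phi.
exists (chart @` U); split; first by exists (chart t1), t1.
move=> s Ss; exists U, phi; split.
- by [].
- have sc := csmooth_ucfg_cc Uo sH.
  have s_ext c l k : C_k k U (fun t => reim c (coord_of (val (phi t)) l)).
    apply: smooth_to_C_k; apply: (smooth_to_ext Uo _ (sc l c k)) => t; rewrite inE => Ut.
    by have [-> _ _] := HU t Ut.
  by move=> l; split=> k; [exact: (s_ext true)|exact: (s_ext false)].
- by move=> t Ut; exact: (immersive_ucfg Uo Ut HU).
- move=> t t'; rewrite !inE => Ut Ut' /orbit_classP[u uU e].
  by rewrite -(psi_phi t Ut) -(psi_phi t' Ut') e psi_conj.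
(* On the image of the chart the value of [psi] is the parameter, and it may be read on any
   representative of the orbit. *)
- move=> W Wo WU; exists [set s : MR R 6 | exists2 x : XR R 6, orbit_class x = s & W (psi (val x))].
    exact: open_psi.
  apply/seteqP; split=> [_ [t Wt <-]|_ [[t Ut <-]] [x xt Wx]].
    split; first by exists t => //; exact: WU.
    by exists (phi t) => //; rewrite psi_phi//; exact: WU.
  exists t => //; rewrite -(psi_phi t Ut).
  by have [u uU ->] := orbit_classP xt; rewrite psi_conj.
Qed.
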